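(* Let $K>0$, $\mathcal C=\{\xi\in\mathbb C:\ \Re(\xi)>K,\ |\Im(\xi)|<K^{-1}\Re(\xi)\}$ and $\rho\colon\mathcal C\cup\mathbb R_+\to\mathbb C$ be such that 1. $\rho$ is holomorphic on $\mathcal C$; 2. $\rho(\xi)=o(|\xi|)$ in the limit $|\xi|\to+\infty$, $\xi\in\mathcal C$; 3. $\rho$ is measurable on $\mathbb R_+$ and $\inf_{\xi\in\mathbb R_+}\Re(\rho(\xi))>-\infty$. Let $\Omega=\mathbb R$ or $\mathbb T$, let $\omega\subset\Omega$ be an open subset such that $\Omega\setminus\omega$ has nonempty interior, and let $T>0$. Then the equation $$(\partial_t+\rho(\sqrt{-\Delta}))f(t,x)=\mathds 1_\omega u(t,x),\qquad t\in[0,T],\ x\in\Omega,$$ is not null-controllable on $\omega$ in time $T$.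
   Context: $\mathbb R_+=[0,+\infty)$, $\mathbb T=\mathbb R/2\pi\mathbb Z$, and $\mathds 1_\omega$ is the indicator function of $\omega$. All functions are complex-valued. The operator $\rho(\sqrt{-\Delta})$ is defined by functional calculus: if $\Omega=\mathbb R$, $\rho(\sqrt{-\Delta})f=\mathcal F^{-1}(\rho(|\xi|)\mathcal F f)$ with $\mathcal F$ the Fourier transform; if $\Omega=\mathbb T$, $c_n(\rho(\sqrt{-\Delta})f)=\rho(|n|)c_n(f)$ where $c_n(f)$ is the $n$-th Fourier coefficient, $n\in\mathbb Z$. Solutions are understood in the (mild) sense of the strongly continuous semigroup on $L^2(\Omega)$ given by the Fourier multipliers $e^{-t\rho(|\xi|)}$ (resp. $e^{-t\rho(|n|)}$), $t\ge0$. Definition: the equation is null-controllable on $\omega$ in time $T>0$ if for every $f_0\in L^2(\Omega)$ there exists $u\in L^2([0,T]\times\omega)$ such that the solution $f$ with initial condition $f(0,\cdot)=f_0$ satisfies $f(T,\cdot)=0$ on $\Omega$. *)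

(* Defs.v *)
From HB Require Import structures.
From mathcomp Require Import all_boot all_order all_algebra.
From mathcomp Require Import all_classical all_reals all_analysis.
From mathcomp Require Import measurable_realfun complex.

Set Implicit Arguments.
Unset Strict Implicit.
Unset Printing Implicit Defensive.

Import Order.TTheory GRing.Theory Num.Theory.
Import numFieldNormedType.Exports.

Local Open Scope classical_set_scope.
Local Open Scope ring_scope.
Local Open Scope complex_scope.

Section ComplexValued.
Context {R : realType}.

Definition cexp (z : R[i]) : R[i] :=
  (expR (complex.Re z) * cos (complex.Im z)) +i*
  (expR (complex.Re z) * sin (complex.Im z)).

Definition sqrnormc (z : R[i]) : R := complex.Re z ^+ 2 + complex.Im z ^+ 2.

(* Meaningful when [f] is integrable on [D]; junk value otherwise. *)
Definition cintegral (D : set R) (f : R -> R[i]) : R[i] :=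
  (\int[lebesgue_measure]_(x in D) complex.Re (f x)) +i*
  (\int[lebesgue_measure]_(x in D) complex.Im (f x)).

(* Representatives of classes of L^2(D, mu) are functions defined on the whole
   type, of which only the values on D matter. *)
Definition L2 d (T : measurableType d) (mu : set T -> \bar R) (D : set T)
    (f : T -> R[i]) : Prop :=
  [/\ measurable_fun D (fun x => complex.Re (f x)),
      measurable_fun D (fun x => complex.Im (f x)) &
      (\int[mu]_(x in D) (sqrnormc (f x))%:E < +oo)%E].

Definition lebesgue2 : set (R * R) -> \bar R :=
  (@lebesgue_measure R \x @lebesgue_measure R)%E.

(* The canonical measurable sets of R are the Borel ones. *)
Definition lebesgue_measurable_fun (D : set R) (f : R -> R) : Prop :=
  measurable_fun
    (D : set (g_sigma_algebraType
                (completed_algebra_gen (@lebesgue_measure R)))) f.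

End ComplexValued.

Inductive ambient := Line | Circle.

Section Ambient.
Context {R : realType}.

(* The circle is R/2piZ: a function on it is given by its values on the
   fundamental domain [0, 2pi[, a subset of it by its 2pi-periodic preimage
   in R, which is open in R iff the subset is open in the circle. *)
Definition domain (Omega : ambient) : set R :=
  match Omega with
  | Line => setT
  | Circle => `[0, 2 * pi[
  end.

Definition subset_of (Omega : ambient) (omega : set R) : Prop :=
  match Omega with
  | Line => True
  | Circle => forall x, omega (x + 2 * pi) <-> omega x
  end.

(* [fhat] is the Fourier transform of [f] in L^2(R): the L^2-limit, as n tends
   to infinity, of the Fourier integrals of [f] truncated to [-n, n]. *)
Definition is_fourier_transform (f fhat : R -> R[i]) : Prop :=
  [/\ L2 (@lebesgue_measure R) setT f,
      L2 (@lebesgue_measure R) setT fhat &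
      (fun n : nat => \int[lebesgue_measure]_(xi in setT)
         (sqrnormc (cintegral `[- n%:R, n%:R]
                      (fun x => f x * cexp (0 -i* (x * xi)))
                    - fhat xi))%:E)%E @ \oo --> 0%E].

Definition fourier_coef (f : R -> R[i]) (n : int) : R[i] :=
  ((2 * pi)^-1)%:C *
  cintegral `[0, 2 * pi[ (fun x => f x * cexp (0 -i* (n%:~R * x))).

(* [g = m (sqrt (- Delta)) f] *)
Definition multiplier (Omega : ambient) (m : R -> R[i]) (f g : R -> R[i])
    : Prop :=
  match Omega with
  | Line => exists fhat ghat : R -> R[i],
      [/\ is_fourier_transform f fhat, is_fourier_transform g ghat &
          {ae @lebesgue_measure R, forall xi, ghat xi = m `|xi| * fhat xi}]
  | Circle =>
      [/\ L2 (@lebesgue_measure R) (domain Circle) f,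
          L2 (@lebesgue_measure R) (domain Circle) g &
          forall n : int, fourier_coef g n = m `|n%:~R| * fourier_coef f n]
  end.

(* [g = S(t) f], with [S] the semigroup of generator
   [- rho (sqrt (- Delta))]. *)
Definition semigroup (Omega : ambient) (rho : R[i] -> R[i]) (t : R)
    (f g : R -> R[i]) : Prop :=
  multiplier Omega (fun r => cexp (- t%:C * rho r%:C)) f g.

(* f(t) = S(t) f0 + \int_0^t S(t - s) v(s) ds for all t in [0, T].
   Here [a] is S(t) f0 and [b s] is S(t - s) v(s); under the identification of
   L^2(0, t; L^2(Omega)) with L^2((0, t) x Omega), the L^2(Omega)-valued
   integral is computed pointwise in x. *)
Definition mild_solution (Omega : ambient) (rho : R[i] -> R[i]) (T : R)
    (f0 : R -> R[i]) (v f : R -> R -> R[i]) : Prop :=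
  forall t, 0 <= t <= T ->
  L2 (@lebesgue_measure R) (domain Omega) (f t) /\
  exists (a : R -> R[i]) (b : R -> R -> R[i]),
    [/\ semigroup Omega rho t f0 a,
        L2 lebesgue2 (`[0, t] `*` domain Omega) (fun z => b z.1 z.2),
        {ae @lebesgue_measure R, forall s,
           0 <= s <= t -> semigroup Omega rho (t - s) (v s) (b s)} &
        {ae @lebesgue_measure R, forall x, domain Omega x ->
           f t x = a x + cintegral `[0, t] (fun s => b s x)}].

Definition null_controllable (Omega : ambient) (rho : R[i] -> R[i])
    (omega : set R) (T : R) : Prop :=
  forall f0 : R -> R[i], L2 (@lebesgue_measure R) (domain Omega) f0 ->
  exists u : R -> R -> R[i],
    L2 lebesgue2 (`[0, T] `*` (omega `&` domain Omega))
      (fun z => u z.1 z.2) /\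
    exists f : R -> R -> R[i],
      mild_solution Omega rho T f0 (fun t x => (\1_omega x)%:C * u t x) f /\
      {ae @lebesgue_measure R, forall x, domain Omega x -> f T x = 0}.

Definition cone (K : R) : set R[i] :=
  [set xi | K < complex.Re xi /\ `|complex.Im xi| < K^-1 * complex.Re xi].

Definition holomorphic_on (D : set R[i]) (f : R[i] -> R[i]) : Prop :=
  forall z, D z -> derivable (f : R[i]^o -> R[i]^o) z 1.

Definition little_o_norm_on (D : set R[i]) (f : R[i] -> R[i]) : Prop :=
  forall eps : R, 0 < eps -> exists M : R, forall z, D z ->
    M%:C < `|z| -> `|f z| <= eps%:C * `|z|.

End Ambient.

(* Main.v *)
(* Duality turns null-controllability into an observability bound: if kernels
   kappa(s) satisfy <S(T - s) f, kappa(T)> = <f, kappa(s)>, then pairing a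
   solution that vanishes at time T with kappa gives
   <f0, kappa(0)> = - \int_0^T <1_omega u(s), kappa(s)> ds, which is at most
   C(f0) times the supremum over s of (a weighted) |kappa(s)| on omega.

   Take for kappa(s) the wave packet at x0 (an interior point of the complement
   of omega) of frequency N, i.e. the integral or the sum over
   N/2 <= xi <= 3N/2 of exp(s rho(xi) - (xi - N)^2 / N - i (x - x0) xi).
   If |x - x0| >= r, the frequencies can be moved to Im xi = -+ delta N, where
   exp(-i (x - x0) xi) decays like exp(- delta r N), while exp(s rho) costs only
   exp(o(N)): the packet is exponentially small on omega, uniformly in s. For
   the circle, the sum over integers is first written as a contour integral
   against 1 / (1 - exp(2 i pi xi)).

   If f0 is the indicator function of an interval starting at x0, the imaginary
   parts of all the frequencies' contributions to <f0, kappa(0)> have the same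
   sign, so that this pairing is at least a constant over N; this is a
   contradiction for large N. *)

Require Import Defs.
From HB Require Import structures.
From mathcomp Require Import all_boot all_order all_algebra.
From mathcomp Require Import all_classical all_reals all_analysis.
From mathcomp Require Import measurable_realfun complex ring lra.

Import Order.TTheory GRing.Theory Num.Theory.
Import numFieldNormedType.Exports.

Local Open Scope classical_set_scope.
Local Open Scope ring_scope.
Local Open Scope complex_scope.

(** * Integrals of complex-valued functions *)

(** The datum f0 is fixed before N, so the constant C given by its control stays fixed while the
    packets sharpen: a single indicator function yields the contradiction. The window [N/2, 3N/2] is
    dictated by the cone: a band of height delta N around it stays where rho is holomorphic once
    delta is at most 1/(4K) and N is large. Cutting sharply at its ends is harmless because the
    Gaussian equals exp(-N/4) there. All exponents are then linear in N: losses delta^2 N (Gaussian)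
    and o(N) (rho) against the gain delta r N, whence delta of order r. On the circle both
    horizontal sides of a rectangle contribute, whatever the sign of y = x - x0. The growth exp(y
    delta N) on the upper side is beaten by the decay exp(-2 pi delta N) of the kernel because y can
    be taken in [r, 2 pi - r] modulo the period. On the line the packets must also be
    square-integrable in x: the contour shift is arranged to yield a factor 1/|x - x0|. The pairing
    is bilinear, without conjugation, so that rho itself and not its conjugate acts on the packets,
    which keeps them holomorphic in the frequency. *)

Section ComplexIntegral.
Set Implicit Arguments.
Unset Strict Implicit.
Context {R : realType}.
Implicit Types (z w : R[i]) (f g : R -> R[i]) (D : set R).
Local Notation mu := (@lebesgue_measure R).
Local Notation Re := complex.Re.
Local Notation Im := complex.Im.

(* A norm equivalent to the modulus, without square roots. *)
Definition norm1 (z : R[i]) : R := `|Re z| + `|Im z|.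

Lemma norm1_ge0 z : 0 <= norm1 z. Proof. by rewrite addr_ge0. Qed.

Lemma norm10 : norm1 0 = 0. Proof. by rewrite /norm1 /= normr0 addr0. Qed.

Lemma ReD z w : Re (z + w) = Re z + Re w. Proof. by case: z w => ? ? []. Qed.
Lemma ImD z w : Im (z + w) = Im z + Im w. Proof. by case: z w => ? ? []. Qed.
Lemma ReN z : Re (- z) = - Re z. Proof. by case: z. Qed.
Lemma ImN z : Im (- z) = - Im z. Proof. by case: z. Qed.
Lemma ReM z w : Re (z * w) = Re z * Re w - Im z * Im w.
Proof. by case: z w => ? ? []. Qed.
Lemma ImM z w : Im (z * w) = Re z * Im w + Im z * Re w.
Proof. by case: z w => ? ? []. Qed.
Definition ReImE := (ReD, ImD, ReN, ImN, ReM, ImM).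

Lemma complex_ext z w : Re z = Re w -> Im z = Im w -> z = w.
Proof. by case: z w => ? ? [? ?] /= -> ->. Qed.

Lemma norm1_eq0 z : norm1 z = 0 -> z = 0.
Proof.
move=> z0; apply: complex_ext => /=; apply/normr0_eq0/eqP;
by move/eqP: z0; rewrite paddr_eq0// => /andP[].
Qed.

Lemma norm1D z w : norm1 (z + w) <= norm1 z + norm1 w.
Proof.
rewrite /norm1 !ReImE addrACA; apply: lerD; exact: ler_normD.
Qed.

Lemma norm1N z : norm1 (- z) = norm1 z.
Proof. by rewrite /norm1 !ReImE !normrN. Qed.

Lemma norm1B z w : norm1 (z - w) <= norm1 z + norm1 w.
Proof. by rewrite -(norm1N w) norm1D. Qed.

Lemma norm1M z w : norm1 (z * w) <= norm1 z * norm1 w.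
Proof.
rewrite /norm1 !ReImE.
have := ler_normB (Re z * Re w) (Im z * Im w).
have := ler_normD (Re z * Im w) (Im z * Re w).
rewrite !normrM => ? ?; lra.
Qed.

Lemma norm1_real (x : R) : norm1 x%:C = `|x|.
Proof. by rewrite /norm1 /= normr0 addr0. Qed.

Lemma norm1Zr (x : R) z : norm1 (x%:C * z) = `|x| * norm1 z.
Proof. by rewrite /norm1 !ReImE /= !mul0r subr0 addr0 !normrM mulrDr. Qed.

Lemma norm1_sum (I : Type) (s : seq I) (P : pred I) (F : I -> R[i]) :
  norm1 (\sum_(i <- s | P i) F i) <= \sum_(i <- s | P i) norm1 (F i).
Proof.
elim/big_rec2: _ => [|i y x _ yx]; first by rewrite norm10.
by apply: le_trans (norm1D _ _) _; rewrite lerD2l.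
Qed.

Lemma norm1_sqr z : norm1 z ^+ 2 <= 2 * sqrnormc z.
Proof.
rewrite /norm1 /sqrnormc -(real_normK (num_real (Re z))).
rewrite -(real_normK (num_real (Im z))).
have := sqr_ge0 (`|Re z| - `|Im z|); nra.
Qed.

Lemma sqrnormc_norm1 z : sqrnormc z <= norm1 z ^+ 2.
Proof.
rewrite /norm1 /sqrnormc -(real_normK (num_real (Re z))).
rewrite -(real_normK (num_real (Im z))).
have := mulr_ge0 (normr_ge0 (Re z)) (normr_ge0 (Im z)); nra.
Qed.

Lemma sqrnormc_ge0 z : 0 <= sqrnormc z.
Proof. by rewrite addr_ge0 ?sqr_ge0. Qed.

Definition cintegrable D f :=
  mu.-integrable D (fun x => (Re (f x))%:E) /\
  mu.-integrable D (fun x => (Im (f x))%:E).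

Lemma cintegrableD D f g : measurable D -> cintegrable D f ->
  cintegrable D g -> cintegrable D (fun x => f x + g x).
Proof.
move=> mD [f1 f2] [g1 g2]; split.
- by under eq_fun do rewrite ReD EFinD; exact: integrableD.
- by under eq_fun do rewrite ImD EFinD; exact: integrableD.
Qed.

Lemma cintegrableZ D f (c : R[i]) : measurable D -> cintegrable D f ->
  cintegrable D (fun x => c * f x).
Proof.
move=> mD [f1 f2]; split.
- under eq_fun do rewrite ReM EFinB !EFinM.
  by apply: integrableB => //; exact: integrableZl.
- under eq_fun do rewrite ImM EFinD !EFinM.
  by apply: integrableD => //; exact: integrableZl.
Qed.

Lemma cintegrableN D f : measurable D -> cintegrable D f ->
  cintegrable D (fun x => - f x).
Proof.
move=> mD fi; have := cintegrableZ (-1) mD fi.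
by under eq_fun do rewrite mulN1r.
Qed.

Lemma cintegrableB D f g : measurable D -> cintegrable D f ->
  cintegrable D g -> cintegrable D (fun x => f x - g x).
Proof. by move=> mD fi gi; apply: cintegrableD => //; exact: cintegrableN. Qed.

Lemma cintegralD D f g : measurable D -> cintegrable D f -> cintegrable D g ->
  cintegral D (fun x => f x + g x) = cintegral D f + cintegral D g.
Proof.
move=> mD [f1 f2] [g1 g2]; apply: complex_ext; rewrite !ReImE /cintegral /=.
- by under eq_Rintegral do rewrite ReD; rewrite RintegralD.
- by under eq_Rintegral do rewrite ImD; rewrite RintegralD.
Qed.

Lemma cintegralZ D f (c : R[i]) : measurable D -> cintegrable D f ->
  cintegral D (fun x => c * f x) = c * cintegral D f.
Proof.
move=> mD [f1 f2].
have i1 k : mu.-integrable D (EFin \o (fun x => k * Re (f x))).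
  by rewrite /comp; under eq_fun do rewrite EFinM; exact: integrableZl.
have i2 k : mu.-integrable D (EFin \o (fun x => k * Im (f x))).
  by rewrite /comp; under eq_fun do rewrite EFinM; exact: integrableZl.
apply: complex_ext; rewrite !ReImE /cintegral /=.
- by under eq_Rintegral do rewrite ReM; rewrite RintegralB// !RintegralZl.
- by under eq_Rintegral do rewrite ImM; rewrite RintegralD// !RintegralZl.
Qed.

Lemma cintegralN D f : measurable D -> cintegrable D f ->
  cintegral D (fun x => - f x) = - cintegral D f.
Proof.
move=> mD fi; have := cintegralZ (-1) mD fi; rewrite mulN1r => <-.
by congr cintegral; apply/funext => x; rewrite mulN1r.
Qed.

Lemma cintegralB D f g : measurable D -> cintegrable D f -> cintegrable D g ->
  cintegral D (fun x => f x - g x) = cintegral D f - cintegral D g.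
Proof.
by move=> mD fi gi; rewrite cintegralD ?cintegralN//; exact: cintegrableN.
Qed.

Lemma eq_cintegral D f g : {in D, f =1 g} -> cintegral D f = cintegral D g.
Proof.
by move=> fg; congr (_ +i* _); apply: eq_Rintegral => x xD; rewrite fg.
Qed.

Lemma eq_cintegrable D f g : measurable D -> {in D, f =1 g} ->
  cintegrable D f -> cintegrable D g.
Proof.
move=> mD fg [f1 f2]; split.
- by apply: eq_integrable f1 => // x xD; rewrite fg.
- by apply: eq_integrable f2 => // x xD; rewrite fg.
Qed.

Lemma cintegrable_sum (I : Type) (s : seq I) D (F : I -> R -> R[i]) :
  measurable D -> (forall i, cintegrable D (F i)) ->
  cintegrable D (fun x => \sum_(i <- s) F i x).
Proof.
move=> mD Fi; elim: s => [|i s IH].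
  apply: (@eq_cintegrable _ (fun=> 0)) => //; first by move=> x _; rewrite big_nil.
  by split; exact: integrable0.
apply: (@eq_cintegrable _ (fun x => F i x + \sum_(j <- s) F j x)) => //.
  by move=> x _; rewrite big_cons.
exact: cintegrableD.
Qed.

Lemma cintegral0 D : cintegral D (fun=> 0) = 0.
Proof. by apply: complex_ext; rewrite /cintegral /= /Rintegral integral0. Qed.

Lemma cintegral_sum (I : Type) (s : seq I) D (F : I -> R -> R[i]) :
  measurable D -> (forall i, cintegrable D (F i)) ->
  cintegral D (fun x => \sum_(i <- s) F i x) = \sum_(i <- s) cintegral D (F i).
Proof.
move=> mD Fi; elim: s => [|i s IH].
  rewrite big_nil -[RHS](cintegral0 D); apply: eq_cintegral => x _.
  by rewrite big_nil.
rewrite big_cons -IH -cintegralD//; last exact: cintegrable_sum.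
by apply: eq_cintegral => x _; rewrite big_cons.
Qed.

Lemma cintegrable_norm1 D f : measurable D -> cintegrable D f ->
  mu.-integrable D (fun x => (norm1 (f x))%:E).
Proof.
move=> mD [f1 f2]; rewrite /norm1.
under eq_fun do rewrite EFinD.
by apply: integrableD => //; [have := integrable_abse f1|have := integrable_abse f2].
Qed.

Lemma le_norm1_cintegral D f : measurable D -> cintegrable D f ->
  norm1 (cintegral D f) <= \int[mu]_(x in D) norm1 (f x).
Proof.
move=> mD [f1 f2]; rewrite /norm1 /cintegral /=.
rewrite RintegralD//; [|exact: integrable_abse f1|exact: integrable_abse f2].
by apply: lerD; exact: le_normr_Rintegral.
Qed.

Lemma le_cintegrable D f (g : R -> R) : measurable D ->
  measurable_fun D (fun x => Re (f x)) ->
  measurable_fun D (fun x => Im (f x)) ->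
  (forall x, D x -> norm1 (f x) <= g x) ->
  mu.-integrable D (fun x => (g x)%:E) -> cintegrable D f.
Proof.
move=> mD m1 m2 fg ig; split; apply: le_integrable ig => //;
  try exact/measurable_EFinP.
- move=> x Dx; rewrite /= lee_fin; apply: le_trans (ler_norm _).
  by apply: le_trans (fg _ Dx); rewrite lerDl.
- move=> x Dx; rewrite /= lee_fin; apply: le_trans (ler_norm _).
  by apply: le_trans (fg _ Dx); rewrite lerDr.
Qed.

End ComplexIntegral.

(** * Complex differentiability *)

Section Differentiability.
Set Implicit Arguments.
Unset Strict Implicit.

Lemma derivable_expansion (K : numFieldType) (f : K^o -> K^o) (z : K) :
  derivable f z 1 <-> exists l : K, forall eps : K, 0 < eps ->
    exists2 d : K, 0 < d & forall h, `|h| < d ->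
      `|f (z + h) - f z - l * h| <= eps * `|h|.
Proof.
have quot l h : h != 0 ->
    f (z + h) - f z - l * h = - (l - h^-1 * (f (h * 1 + z) - f z)) * h.
  by move=> h0; rewrite mulr1 [h + z]addrC; field.
split.
- move=> /cvg_ex [l /cvgrPdist_le dl]; exists l => eps eps0.
  have := dl _ eps0.
  rewrite /nbhs /= /dnbhs /within /= => /nbhs_normP [d /= d0 dP].
  exists d => // h hd; have [->|h0] := eqVneq h 0.
    by rewrite addr0 mulr0 subr0 subrr normr0 mulr0.
  rewrite quot// normrM normrN; apply: ler_wpM2r => //.
  by apply: dP => //=; rewrite sub0r normrN.
- move=> [l Hl]; apply/cvg_ex; exists l; apply/cvgrPdist_le => eps eps0.
  have [d d0 dP] := Hl _ eps0.
  rewrite /nbhs /= /dnbhs /within /=; apply/nbhs_normP.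
  exists d => //= h hd h0; rewrite /= sub0r normrN in hd.
  have := dP _ hd; rewrite quot// normrM normrN ler_pM2r ?normr_gt0//.
Qed.

Lemma is_derive_expansion (K : numFieldType) (f : K^o -> K^o) (z l : K) :
  is_derive z 1 (f : K^o -> K^o) l -> forall eps : K, 0 < eps ->
    exists2 d : K, 0 < d & forall h, `|h| < d ->
      `|f (z + h) - f z - l * h| <= eps * `|h|.
Proof.
have quot h : h != 0 ->
    f (z + h) - f z - l * h = - (l - h^-1 * (f (h * 1 + z) - f z)) * h.
  by move=> h0; rewrite mulr1 [h + z]addrC; field.
move=> [/cvg_ex [l' dl'] /= dE].
have {}dl' : h^-1 *: ((f \o shift z) (h *: (1 : K^o)) - f z) @[h --> 0^'] --> (l : K^o).
  by rewrite -dE /derive (cvg_lim _ dl').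
move/cvgrPdist_le : dl' => dl eps eps0.
have := dl _ eps0.
rewrite /nbhs /= /dnbhs /within /= => /nbhs_normP [d /= d0 dP].
exists d => // h hd; have [->|h0] := eqVneq h 0.
  by rewrite addr0 mulr0 subr0 subrr normr0 mulr0.
rewrite quot// normrM normrN; apply: ler_wpM2r => //.
by apply: dP => //=; rewrite sub0r normrN.
Qed.

Context {R : realType}.
Implicit Types (z w l h : R[i]) (F G : R[i] -> R[i]).
Local Notation Re := complex.Re.
Local Notation Im := complex.Im.

Lemma le_abs_norm1 z : `|z| <= (norm1 z)%:C.
Proof.
rewrite normc_def lecR -[leRHS]ger0_norm ?norm1_ge0// -sqrtr_sqr.
by apply: ler_wsqrtr; exact: sqrnormc_norm1.
Qed.

Lemma le_norm1_abs z : (norm1 z)%:C <= 2 * `|z|.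
Proof.
rewrite normc_def -[2]/(2%:R) -(rmorph_nat (real_complex R)) -rmorphM lecR.
rewrite -[leLHS]ger0_norm ?norm1_ge0// -sqrtr_sqr.
apply: (@le_trans _ _ (Num.sqrt (2 * sqrnormc z))).
  by apply: ler_wsqrtr; exact: norm1_sqr.
rewrite sqrtrM// ler_wpM2r ?sqrtr_ge0//.
rewrite -[leRHS]ger0_norm// -sqrtr_sqr ler_wsqrtr//; lra.
Qed.

Lemma complex_gt0 z : 0 < z -> z = (Re z)%:C /\ 0 < Re z.
Proof. by case: z => a b; rewrite ltcE /= => /andP[/eqP -> ->]. Qed.

Definition holo F z := derivable (F : R[i]^o -> R[i]^o) z 1.

(** A positive element of [R[i]] is real, and [norm1] lies between the modulus and twice the
    modulus, so real tolerances and [norm1] express the same differentiability. *)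
Lemma holo_norm1 F z : holo F z <-> exists l, forall eps : R, 0 < eps ->
  exists2 d : R, 0 < d & forall h, norm1 h < d ->
    norm1 (F (z + h) - F z - l * h) <= eps * norm1 h.
Proof.
split=> [/derivable_expansion [l Hl]|[l Hl]].
- exists l => eps eps0.
  have [|d /complex_gt0 [-> d0] dP] := Hl (eps / 2)%:C.
    by rewrite ltcR divr_gt0.
  exists (Re d) => // h hd; rewrite -lecR.
  apply: le_trans (le_norm1_abs _) _.
  have /dP/(ler_wpM2l (ler0n _ 2)) : `|h| < (Re d)%:C.
    by apply: le_lt_trans (le_abs_norm1 _) _; rewrite ltcR.
  have -> : 2 * ((eps / 2)%:C * `|h|) = eps%:C * `|h|.
    rewrite mulrA -(rmorph_nat (real_complex R)) -rmorphM /=.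
    by congr (_%:C * _); field.
  move=> /le_trans; apply; rewrite rmorphM.
  by rewrite ler_wpM2l ?le_abs_norm1// lecR ltW.
- apply/derivable_expansion; exists l => eps /complex_gt0 [-> eps0].
  have [|d d0 dP] := Hl (Re eps / 2); first by rewrite divr_gt0.
  exists (d / 2)%:C; first by rewrite ltcR divr_gt0.
  move=> h hd.
  have : norm1 h < d.
    rewrite -ltcR; apply: le_lt_trans (le_norm1_abs _) _.
    move: hd; rewrite -(ltr_pM2l (ltr0n _ 2)) => /lt_le_trans; apply.
    by rewrite -(rmorph_nat (real_complex R)) -rmorphM lecR; lra.
  move=> /dP H; apply: le_trans (le_abs_norm1 _) _.
  apply: (@le_trans _ _ (Re eps / 2 * norm1 h)%:C); first by rewrite lecR.
  have -> : (Re eps)%:C * `|h| = (Re eps / 2)%:C * (2 * `|h|).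
    have -> : (2 : R[i]) = (2 : R)%:C by rewrite rmorph_nat.
    by rewrite mulrA -[_ * 2%:C]rmorphM /= divfK ?pnatr_eq0.
  rewrite rmorphM ler_wpM2l ?le_norm1_abs//.
  by rewrite -[0]/(0%:C) lecR divr_ge0 ?ltW.
Qed.

Lemma holo_cst (c : R[i]) z : holo (fun=> c) z.
Proof. exact: derivable_cst. Qed.

Lemma holo_id z : holo (fun w => w) z.
Proof. exact: derivable_id. Qed.

Lemma holoD F G z : holo F z -> holo G z -> holo (fun w => F w + G w) z.
Proof. exact: derivableD. Qed.

Lemma holoB F G z : holo F z -> holo G z -> holo (fun w => F w - G w) z.
Proof. exact: derivableB. Qed.

Lemma holoM F G z : holo F z -> holo G z -> holo (fun w => F w * G w) z.
Proof. exact: derivableM. Qed.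

Lemma holoV F z : F z != 0 -> holo F z -> holo (fun w => (F w)^-1) z.
Proof. exact: derivableV. Qed.

Lemma holo_comp F G z : holo F z -> holo G (F z) -> holo (fun w => G (F w)) z.
Proof.
move=> /derivable1_diffP dF /derivable1_diffP dG.
by apply/derivable1_diffP; exact: (differentiable_comp dF dG).
Qed.

Lemma cexpD z w : cexp (z + w) = cexp z * cexp w.
Proof.
apply: complex_ext; rewrite /cexp !ReImE /= expRD ?cosD ?sinD; ring.
Qed.

Lemma cexp0 : cexp (0 : R[i]) = 1.
Proof. by apply: complex_ext; rewrite /cexp /= expR0 ?cos0 ?sin0 ?mulr0 ?mulr1. Qed.

Lemma norm1_cexp z : norm1 (cexp z) <= 2 * expR (Re z).
Proof.
rewrite /norm1 /cexp /= !normrM !(ger0_norm (expR_ge0 _)) -mulrDr mulrC.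
rewrite ler_wpM2r ?expR_ge0//.
by have := cos_max (Im z); have := sin_max (Im z); lra.
Qed.

(** The addition formula reduces the expansion to the origin, where it follows from the first-order
    expansions of the real functions exp, cos and sin. *)
Lemma cexp_expansion z (eps : R) : 0 < eps -> exists2 d : R, 0 < d &
  forall h, norm1 h < d ->
    norm1 (cexp (z + h) - cexp z - cexp z * h) <= eps * norm1 h.
Proof.
move=> eps0.
have [M M0 zM] : exists2 M : R, 0 < M & norm1 (cexp z) <= M.
  by exists (norm1 (cexp z) + 1); have := norm1_ge0 (cexp z); lra.
(* M bounds the factor [cexp z], and 8 covers the errors estimated below, which add up to e|a| +
   7e|b| for h = a + ib. *)
pose e := Num.min 1 (eps / (8 * M)).
have e0 : 0 < e by rewrite lt_min ltr01 divr_gt0 ?mulr_gt0.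
have e1 : e <= 1 by rewrite ge_min lexx.
have eM : 8 * e * M <= eps.
  have : e <= eps / (8 * M) by rewrite ge_min lexx orbT.
  by rewrite ler_pdivlMr ?mulr_gt0//; lra.
clearbody e.
have [d1 d10 H1] := is_derive_expansion (is_derive_expR 0) e0.
have [d2 d20 H2] := is_derive_expansion (is_derive_cos (0 : R)) e0.
have [d3 d30 H3] := is_derive_expansion (is_derive_sin (0 : R)) e0.
pose d := Num.min (Num.min d1 d2) (Num.min d3 e).
exists d; first by rewrite !lt_min d10 d20 d30 e0.
move=> h; rewrite !lt_min => /andP[/andP[h1 h2] /andP[h3 he]].
have lea : `|Re h| <= norm1 h by rewrite lerDl.
have leb : `|Im h| <= norm1 h by rewrite lerDr.
have {}H1 := H1 _ (le_lt_trans lea h1).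
have {}H2 := H2 _ (le_lt_trans leb h2).
have {}H3 := H3 _ (le_lt_trans leb h3).
rewrite !add0r expR0 mul1r in H1.
rewrite !add0r sin0 oppr0 cos0 mul0r subr0 in H2.
rewrite !add0r sin0 cos0 subr0 mul1r in H3.
have -> : cexp (z + h) - cexp z - cexp z * h = cexp z * (cexp h - 1 - h).
  by rewrite cexpD; ring.
apply: le_trans (norm1M _ _) _.
have ae : `|Re h| <= e by apply: le_trans lea (ltW he).
apply: (@le_trans _ _ (M * (8 * e * norm1 h))); last first.
  by have := norm1_ge0 h; nra.
apply: ler_pM; rewrite ?norm1_ge0//.
set a := Re h in H1 ae *; set b := Im h in H2 H3 *.
rewrite /norm1 !ReImE /cexp /= -/a -/b oppr0 addr0.
have -> : expR a * cos b - 1 - a =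
  (expR a - 1 - a) * cos b + (1 + a) * (cos b - 1) by ring.
have -> : expR a * sin b - b = (expR a - 1) * sin b + (sin b - b) by ring.
have c1 := cos_max b.
have ea : `|expR a - 1| <= 2 * e.
  have -> : expR a - 1 = (expR a - 1 - a) + a by ring.
  apply: le_trans (ler_normD _ _) _; have := normr_ge0 a; nra.
have sb : `|sin b| <= 2 * `|b|.
  have -> : sin b = (sin b - b) + b by ring.
  apply: le_trans (ler_normD _ _) _; have := normr_ge0 b; nra.
have a1 : `|1 + a| <= 2.
  by apply: le_trans (ler_normD _ _) _; rewrite normr1; lra.
have X1 : `|(expR a - 1 - a) * cos b| <= e * `|a|.
  by rewrite normrM -[leRHS]mulr1; apply: ler_pM.
have X2 : `|(1 + a) * (cos b - 1)| <= 2 * (e * `|b|).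
  by rewrite normrM; apply: ler_pM.
have X3 : `|(expR a - 1) * sin b| <= 2 * e * (2 * `|b|).
  by rewrite normrM; apply: ler_pM.
have X4 := ler_normD ((expR a - 1 - a) * cos b) ((1 + a) * (cos b - 1)).
have X5 := ler_normD ((expR a - 1) * sin b) (sin b - b).
have := normr_ge0 a; have := normr_ge0 b; nra.
Qed.

Lemma holo_cexp z : holo cexp z.
Proof.
by apply/holo_norm1; exists (cexp z) => eps eps0; exact: cexp_expansion.
Qed.

Definition contat F z := forall eps : R, 0 < eps ->
  exists2 d : R, 0 < d & forall h, norm1 h < d -> norm1 (F (z + h) - F z) <= eps.

Lemma holo_contat F z : holo F z -> contat F z.
Proof.
move=> /holo_norm1 [l Hl] eps eps0; have [d d0 dP] := Hl 1 ltr01.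
have M0 : 0 < 1 + norm1 l by have := norm1_ge0 l; lra.
exists (Num.min d (eps / (1 + norm1 l))).
  by rewrite lt_min d0 divr_gt0.
move=> h; rewrite lt_min => /andP[hd]; rewrite ltr_pdivlMr// => he.
have -> : F (z + h) - F z = (F (z + h) - F z - l * h) + l * h by ring.
apply: le_trans (norm1D _ _) _.
have := dP _ hd; have := norm1M l h; lra.
Qed.

End Differentiability.

(** * Integrals of continuous functions over segments *)

Section Segments.
Set Implicit Arguments.
Unset Strict Implicit.
Context {R : realType}.
Implicit Types (f g : R -> R[i]) (a b c d : R).
Local Notation mu := (@lebesgue_measure R).
Local Notation Re := complex.Re.
Local Notation Im := complex.Im.

(** The point s may leave [a, b]: continuity is two-sided even at the endpoints, so it restricts to
    subintervals without any care. *)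
Definition pathcont f a b := forall t, a <= t <= b ->
  forall eps : R, 0 < eps -> exists2 d : R, 0 < d &
    forall s, `|s - t| < d -> norm1 (f s - f t) <= eps.

Lemma pathcont_within f a b : pathcont f a b ->
  {within `[a, b], continuous (fun t => Re (f t))} /\
  {within `[a, b], continuous (fun t => Im (f t))}.
Proof.
move=> fc; split; apply: continuous_in_subspaceT => t;
  rewrite inE /= in_itv /= => tab; apply/cvgrPdist_le => eps eps0;
  have [d d0 dP] := fc _ tab _ eps0; apply/nbhs_normP; exists d => //= s /= st;
  rewrite distrC in st; have := dP _ st; apply: le_trans;
  rewrite distrC /norm1 !ReImE.
- by rewrite lerDl.
- by rewrite lerDr.
Qed.

Lemma pathcont_cintegrable f a b : pathcont f a b -> cintegrable `[a, b] f.
Proof.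
move=> /pathcont_within [c1 c2].
by split; apply: continuous_compact_integrable => //; exact: segment_compact.
Qed.

Lemma pathcont_sub f a b a' b' : a <= a' -> b' <= b -> pathcont f a b ->
  pathcont f a' b'.
Proof. by move=> aa bb fc t /andP[? ?]; apply: fc; apply/andP; split; lra. Qed.

Lemma cintegral_itv_split f a m b : a <= m -> m <= b ->
  cintegrable `[a, b] f ->
  cintegral `[a, b] f = cintegral `[a, m] f + cintegral `[m, b] f.
Proof.
move=> am mb [i1 i2].
have sub : ([set` `[m, b]] `<=` [set` `[a, b]]).
  by move=> x /=; rewrite !in_itv /= => /andP[? ?]; apply/andP; split; lra.
have sub2 : ([set` `]m, b]] `<=` [set` `[m, b]]).
  by move=> x /=; rewrite !in_itv /= => /andP[? ?]; apply/andP; split; lra.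
apply: complex_ext; rewrite !ReImE /cintegral /=.
- rewrite -(Rintegral_itv_obnd_cbnd (r := m) (f := fun x => Re (f x))).
    have /= <- := @Rintegral_itvB _ (fun x => Re (f x)) (BLeft a) (BRight b) m i1 am mb.
    by rewrite addrC subrK.
  by apply: integrableS i1 => //; exact: subset_trans sub2 sub.
- rewrite -(Rintegral_itv_obnd_cbnd (r := m) (f := fun x => Im (f x))).
    have /= <- := @Rintegral_itvB _ (fun x => Im (f x)) (BLeft a) (BRight b) m i2 am mb.
    by rewrite addrC subrK.
  by apply: integrableS i2 => //; exact: subset_trans sub2 sub.
Qed.

Lemma norm1_cintegral_itv f a b (M : R) : a <= b -> cintegrable `[a, b] f ->
  (forall t, a <= t <= b -> norm1 (f t) <= M) ->
  norm1 (cintegral `[a, b] f) <= M * (b - a).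
Proof.
move=> ab fi fM; apply: le_trans (le_norm1_cintegral _ fi) _ => //.
apply: (@le_trans _ _ (\int[mu]_(x in `[a, b]) M)).
  apply: le_Rintegral => //.
  - exact: cintegrable_norm1.
  - apply: continuous_compact_integrable; first exact: segment_compact.
    by apply: continuous_subspaceT => x; exact: cvg_cst.
rewrite Rintegral_cst//= lebesgue_measure_itv /= lte_fin.
by move: ab; rewrite le_eqVlt => /predU1P[->|->]//=; rewrite ltxx subrr.
Qed.

Lemma Rintegral_affine (p q a b : R) : a <= b ->
  \int[mu]_(t in `[a, b]) (p + q * t) = p * (b - a) + q * (b ^+ 2 - a ^+ 2) / 2.
Proof.
rewrite le_eqVlt => /predU1P[<-|ab].
  by rewrite set_itv1 Rintegral_set1 !subrr !mulr0 mul0r addr0.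
pose F x : R := p * x + q / 2 * x ^+ 2.
have dF (x : R) : is_derive x 1 F (p + q * x).
  rewrite /F; apply: is_derive_eq.
  by rewrite /GRing.scale /= mulr1; field.
have FTC : (\int[mu]_(t in `[a, b]) (p + q * t)%:E = (F b)%:E - (F a)%:E)%E.
  apply: continuous_FTC2 => //.
  - apply: continuous_subspaceT => y.
    by apply: cvgD; [exact: cvg_cst|apply: cvgM; [exact: cvg_cst|exact: cvg_id]].
  - have cF (y : R) : {for y, continuous F}.
      by apply/differentiable_continuous/derivable1_diffP; exact: ex_derive.
    split; first by move=> y _; exact: ex_derive.
    + by apply: cvg_at_right_filter; exact: cF.
    + by apply: cvg_at_left_filter; exact: cF.
  - by move=> y _; rewrite derive1E derive_val.
by rewrite /Rintegral FTC /= /F; field.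
Qed.

Lemma cintegral_affine (p q : R[i]) a b : a <= b ->
  cintegral `[a, b] (fun t => p + q * t%:C) =
  p * (b - a)%:C + q * ((b ^+ 2 - a ^+ 2) / 2)%:C.
Proof.
move=> ab; apply: complex_ext; rewrite !ReImE /cintegral /=.
- under eq_Rintegral do rewrite !ReImE /= mulr0 subr0.
  by rewrite Rintegral_affine//; ring.
- under eq_Rintegral do rewrite !ReImE /= mulr0 add0r.
  by rewrite Rintegral_affine//; ring.
Qed.

Lemma pathcont_affine (p q : R[i]) a b : pathcont (fun t => p + q * t%:C) a b.
Proof.
move=> t _ eps eps0; have n0 := norm1_ge0 q.
exists (eps / (1 + norm1 q)); first by rewrite divr_gt0//; lra.
move=> s; rewrite ltr_pdivlMr; last by lra.
have -> : p + q * s%:C - (p + q * t%:C) = (s - t)%:C * q.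
  by rewrite rmorphB; ring.
by rewrite norm1Zr; have := normr_ge0 (s - t); nra.
Qed.

End Segments.

(** * Goursat's theorem on rectangles *)

Section Goursat.
Set Implicit Arguments.
Unset Strict Implicit.
Context {R : realType}.
Implicit Types (F G : R[i] -> R[i]) (a b c d x y t W H : R).

(** The contour integral along the boundary of [a, b] x [c, d], counterclockwise; the factor i comes
    from dz = i dy on the vertical sides. *)
Definition rect F a b c d : R[i] :=
  cintegral `[a, b] (fun x => F (x +i* c)) -
  cintegral `[a, b] (fun x => F (x +i* d)) +
  (0 +i* 1) * (cintegral `[c, d] (fun y => F (b +i* y)) -
               cintegral `[c, d] (fun y => F (a +i* y))).

Definition rcont F a b c d := forall x y, a <= x <= b -> c <= y <= d ->
  contat F (x +i* y).

Lemma rcont_h F a b c d y : c <= y <= d -> rcont F a b c d ->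
  pathcont (fun x => F (x +i* y)) a b.
Proof.
move=> yc Fc x xab eps eps0; have [e e0 eP] := Fc _ _ xab yc _ eps0.
exists e => // s sx.
have -> : s +i* y = (x +i* y) + (s - x)%:C by apply: complex_ext => /=; ring.
by apply: eP; rewrite norm1_real.
Qed.

Lemma rcont_v F a b c d x : a <= x <= b -> rcont F a b c d ->
  pathcont (fun y => F (x +i* y)) c d.
Proof.
move=> xa Fc y ycd eps eps0; have [e e0 eP] := Fc _ _ xa ycd _ eps0.
exists e => // s sy.
have -> : x +i* s = (x +i* y) + (0 +i* (s - y)).
  by apply: complex_ext => /=; ring.
by apply: eP; rewrite /norm1 /= normr0 add0r.
Qed.

Lemma rcont_sub F a b c d a' b' c' d' : a <= a' -> b' <= b -> c <= c' ->
  d' <= d -> rcont F a b c d -> rcont F a' b' c' d'.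
Proof.
by move=> ? ? ? ? Fc x y /andP[? ?] /andP[? ?]; apply: Fc; apply/andP; split; lra.
Qed.

(** Linearity of [rect] only involves the four sides; asking for no more keeps it available for
    functions with a pole inside. *)
Definition bcont F a b c d :=
  [/\ pathcont (fun x => F (x +i* c)) a b, pathcont (fun x => F (x +i* d)) a b,
      pathcont (fun y => F (a +i* y)) c d & pathcont (fun y => F (b +i* y)) c d].

Lemma rcont_bcont F a b c d : a <= b -> c <= d -> rcont F a b c d ->
  bcont F a b c d.
Proof.
move=> ab cd Fc; split.
- by apply: rcont_h Fc; rewrite lexx.
- by apply: rcont_h Fc; rewrite lexx cd.
- by apply: rcont_v Fc; rewrite lexx.
- by apply: rcont_v Fc; rewrite lexx ab.
Qed.

Lemma rect_splitx F a m b c d : a <= m -> m <= b ->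
  pathcont (fun x => F (x +i* c)) a b -> pathcont (fun x => F (x +i* d)) a b ->
  rect F a b c d = rect F a m c d + rect F m b c d.
Proof.
move=> am mb Fc Fd; rewrite /rect.
by rewrite !(cintegral_itv_split am mb); [ring|exact: pathcont_cintegrable..].
Qed.

Lemma rect_splity F a b c m d : c <= m -> m <= d ->
  pathcont (fun y => F (a +i* y)) c d -> pathcont (fun y => F (b +i* y)) c d ->
  rect F a b c d = rect F a b c m + rect F a b m d.
Proof.
move=> cm md Fa Fb; rewrite /rect.
by rewrite !(cintegral_itv_split cm md); [ring|exact: pathcont_cintegrable..].
Qed.

Lemma rectB F G a b c d : bcont F a b c d -> bcont G a b c d ->
  rect (fun z => F z - G z) a b c d = rect F a b c d - rect G a b c d.
Proof.
move=> [F1 F2 F3 F4] [G1 G2 G3 G4].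
rewrite /rect !cintegralB//; try exact: pathcont_cintegrable.
by ring.
Qed.

Lemma rectZ F (k : R[i]) a b c d : bcont F a b c d ->
  rect (fun z => k * F z) a b c d = k * rect F a b c d.
Proof.
move=> [F1 F2 F3 F4].
rewrite /rect !cintegralZ//; try exact: pathcont_cintegrable.
by ring.
Qed.

(** The four integrals are computed explicitly. This lets the first-order part of a function be
    removed from its contour integral in Goursat's argument. *)
Lemma rect_affine (p q : R[i]) a b c d : a <= b -> c <= d ->
  rect (fun z => p + q * z) a b c d = 0.
Proof.
move=> ab cd.
have h y x : p + q * (x +i* y) = (p + q * (0 +i* y)) + q * x%:C.
  have -> : x +i* y = x%:C + (0 +i* y) by apply: complex_ext => /=; ring.
  by ring.
have v x y : p + q * (x +i* y) = (p + q * x%:C) + q * (0 +i* 1) * y%:C.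
  have -> : x +i* y = x%:C + (0 +i* 1) * y%:C by apply: complex_ext => /=; ring.
  by ring.
rewrite /rect (eq_cintegral (g := fun x => (p + q * (0 +i* c)) + q * x%:C));
  last by move=> x _; exact: h.
rewrite [X in _ - X + _](eq_cintegral (g := fun x => (p + q * (0 +i* d)) + q * x%:C));
  last by move=> x _; exact: h.
rewrite [X in _ * (X - _)](eq_cintegral (g := fun y => (p + q * b%:C) + q * (0 +i* 1) * y%:C));
  last by move=> x _; exact: v.
rewrite [X in _ * (_ - X)](eq_cintegral (g := fun y => (p + q * a%:C) + q * (0 +i* 1) * y%:C));
  last by move=> x _; exact: v.
rewrite !cintegral_affine//.
have E y : 0 +i* y = (0 +i* 1) * y%:C by apply: complex_ext => /=; ring.
rewrite (E c) (E d) !rmorphB; ring.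
Qed.

Lemma norm1_rect F a b c d (M : R) : a <= b -> c <= d -> bcont F a b c d ->
  (forall x, a <= x <= b ->
    norm1 (F (x +i* c)) <= M /\ norm1 (F (x +i* d)) <= M) ->
  (forall y, c <= y <= d ->
    norm1 (F (a +i* y)) <= M /\ norm1 (F (b +i* y)) <= M) ->
  norm1 (rect F a b c d) <= 2 * M * ((b - a) + (d - c)).
Proof.
move=> ab cd [F1 F2 F3 F4] Mh Mv.
have i1 (z : R[i]) : norm1 ((0 +i* 1) * z) = norm1 z.
  by rewrite /norm1 !ReImE /= !mul0r !mul1r sub0r add0r normrN addrC.
rewrite /rect; apply: le_trans (norm1D _ _) _.
rewrite i1; apply: le_trans (lerD (norm1B _ _) (norm1B _ _)) _.
have B1 := norm1_cintegral_itv ab (pathcont_cintegrable F1) (fun x xa => (Mh x xa).1).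
have B2 := norm1_cintegral_itv ab (pathcont_cintegrable F2) (fun x xa => (Mh x xa).2).
have B3 := norm1_cintegral_itv cd (pathcont_cintegrable F3) (fun x xa => (Mv x xa).1).
have B4 := norm1_cintegral_itv cd (pathcont_cintegrable F4) (fun x xa => (Mv x xa).2).
lra.
Qed.

Let eq_ler x y : x = y -> x <= y. Proof. by move->. Qed.

Lemma half_pow_lt (e : R) : 0 < e -> exists n : nat, (1 / 2) ^+ n < e.
Proof.
move=> e0; pose n := Num.bound e^-1.
have en : e^-1 < n%:R by apply: archi_boundP; rewrite invr_ge0 ltW.
exists n; rewrite div1r exprVn -[e]invrK ltf_pV2 ?posrE ?exprn_gt0 ?invr_gt0//.
by apply: lt_le_trans en _; rewrite -natrX ler_nat ltnW// ltn_expl.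
Qed.

Lemma nested_intervals (s : nat -> R) W : 0 <= W ->
  (forall n, s n <= s n.+1) ->
  (forall n, s n.+1 + (1 / 2) ^+ n.+1 * W <= s n + (1 / 2) ^+ n * W) ->
  exists x, forall n, s n <= x <= s n + (1 / 2) ^+ n * W.
Proof.
move=> W0 s1 s2.
have inc n k : s n <= s (k + n)%N.
  by elim: k => // k IH; apply: le_trans IH (s1 _).
have dec n k : s (k + n)%N + (1 / 2) ^+ (k + n) * W <= s n + (1 / 2) ^+ n * W.
  by elim: k => // k IH; apply: le_trans (s2 _) IH.
have pw n : 0 <= (1 / 2 : R) ^+ n * W by rewrite mulr_ge0// exprn_ge0//; lra.
have ub n m : s m <= s n + (1 / 2) ^+ n * W.
  case: (leqP m n) => mn.
    by have := inc m (n - m)%N; rewrite subnK//; have := pw n; lra.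
  by have := dec n (m - n)%N; rewrite subnK 1?ltnW//; have := pw m; lra.
exists (sup (range s)) => n; apply/andP; split.
  apply: ub_le_sup; last by exists n.
  by exists (s 0%N + (1 / 2) ^+ 0 * W) => _ [m _ <-]; exact: ub.
apply: ge_sup; first by exists (s n), n.
by move=> _ [m _ <-]; exact: ub.
Qed.

(** [P a c t] speaks of the rectangle with corner (a, c) and sides tW, tH. A failure of P would pass
    to one of the four quarters at every scale, and these nested rectangles would shrink to a point
    near which P holds. *)
Lemma bisection W H (P : R -> R -> R -> Prop) a0 c0 : 0 <= W -> 0 <= H ->
  (forall a c t, 0 < t -> P a c (t / 2) -> P (a + t / 2 * W) c (t / 2) ->
    P a (c + t / 2 * H) (t / 2) -> P (a + t / 2 * W) (c + t / 2 * H) (t / 2) ->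
    P a c t) ->
  (forall x y, a0 <= x <= a0 + W -> c0 <= y <= c0 + H ->
    exists2 e : R, 0 < e & forall a c t, 0 < t -> t < e ->
      a <= x <= a + t * W -> c <= y <= c + t * H -> P a c t) ->
  P a0 c0 1.
Proof.
move=> W0 H0 Ps Pl; apply: contrapT => nP.
have h0 n : 0 < (1 / 2 : R) ^+ n by rewrite exprn_gt0//; lra.
have hS n : (1 / 2 : R) ^+ n / 2 = (1 / 2) ^+ n.+1.
  by rewrite exprSr mul1r.
(* The next corner is only constrained when P fails, which makes the choice a total function that
   can be iterated. *)
have /choice [nxt nxtP] : forall pn : (R * R) * nat, exists q : R * R,
    ~ P pn.1.1 pn.1.2 ((1 / 2) ^+ pn.2) ->
    [/\ ~ P q.1 q.2 ((1 / 2) ^+ pn.2.+1),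
      pn.1.1 <= q.1 <= pn.1.1 + (1 / 2) ^+ pn.2.+1 * W &
      pn.1.2 <= q.2 <= pn.1.2 + (1 / 2) ^+ pn.2.+1 * H].
  move=> [[a c] n] /=.
  have [|nPn] := pselect (P a c ((1 / 2) ^+ n)); first by exists (a, c).
  have pW : 0 <= (1 / 2 : R) ^+ n.+1 * W by rewrite mulr_ge0// ltW.
  have pH : 0 <= (1 / 2 : R) ^+ n.+1 * H by rewrite mulr_ge0// ltW.
  apply: contrapT => /forallNP Q; apply: nPn; apply: Ps => //; rewrite hS;
    apply: contrapT => nP'.
  - by apply: (Q (a, c)) => _ /=; split=> //; apply/andP; split; lra.
  - by apply: (Q (a + (1 / 2) ^+ n.+1 * W, c)) => _ /=; split=> //; apply/andP; split; lra.
  - by apply: (Q (a, c + (1 / 2) ^+ n.+1 * H)) => _ /=; split=> //; apply/andP; split; lra.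
  - by apply: (Q (a + (1 / 2) ^+ n.+1 * W, c + (1 / 2) ^+ n.+1 * H)) => _ /=; split=> //; apply/andP; split; lra.
pose s := fix s n := if n is m.+1 then nxt (s m, m) else (a0, c0).
have sP n : ~ P (s n).1 (s n).2 ((1 / 2) ^+ n).
  elim: n => [|n IH]; first by rewrite expr0.
  by have [] := nxtP (s n, n) IH.
have hW n (V : R) : (1 / 2) ^+ n * V = (1 / 2) ^+ n.+1 * V + (1 / 2) ^+ n.+1 * V.
  by rewrite exprS; field.
have [x xP] : exists x, forall n, (s n).1 <= x <= (s n).1 + (1 / 2) ^+ n * W.
  apply: nested_intervals => // n; have [_ /andP[q1 q2] _] := nxtP (s n, n) (sP n).
    exact: q1.
  by rewrite (hW n W); move: q2 => /=; lra.
have [y yP] : exists y, forall n, (s n).2 <= y <= (s n).2 + (1 / 2) ^+ n * H.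
  apply: nested_intervals => // n; have [_ _ /andP[q1 q2]] := nxtP (s n, n) (sP n).
    exact: q1.
  by rewrite (hW n H); move: q2 => /=; lra.
have := xP 0%N; have := yP 0%N; rewrite /= expr0 !mul1r => yb xb.
have [e e0 eP] := Pl _ _ xb yb.
have [n ne] := half_pow_lt e0.
by apply: (sP n); apply: eP.
Qed.

(** By bisection it suffices to bound the contour integral by eps times the area scale. Near a point
    F is affine up to eps times the distance, and the perimeter of a small rectangle supplies the
    second factor t. *)
Theorem goursat F a b c d : a <= b -> c <= d ->
  (forall x y, a <= x <= b -> c <= y <= d -> holo F (x +i* y)) ->
  rect F a b c d = 0.
Proof.
move=> ab cd Fh; pose W := b - a; pose H := d - c.
have W0 : 0 <= W by rewrite subr_ge0.
have H0 : 0 <= H by rewrite subr_ge0.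
have Fc : rcont F a b c d by move=> x y xa yc; apply/holo_contat/Fh.
suff key (eps : R) : 0 < eps ->
    norm1 (rect F a b c d) <= eps * (2 * (W + H) ^+ 2).
  apply: norm1_eq0; apply/eqP; rewrite eq_le norm1_ge0 andbT.
  apply/ler_addgt0Pr => e e0; rewrite add0r.
  have K0 : 0 < 1 + 2 * (W + H) ^+ 2 by have := sqr_ge0 (W + H); lra.
  apply: le_trans (key (e / (1 + 2 * (W + H) ^+ 2)) _) _.
    by rewrite divr_gt0.
  by rewrite mulrAC ler_pdivrMr// ler_pM2l// lerDr.
move=> eps0.
(* The power t^2 makes four bounds at scale t/2 add up exactly to the bound at scale t; 2(W + H)^2
   is the perimeter times the [norm1] diameter at scale 1. *)
pose P a' c' t := a <= a' -> a' + t * W <= b -> c <= c' -> c' + t * H <= d ->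
  norm1 (rect F a' (a' + t * W) c' (c' + t * H)) <=
  eps * (2 * (W + H) ^+ 2) * t ^+ 2.
have : P a c 1.
  apply: (bisection W0 H0) => [a' c' t t0 P1 P2 P3 P4 aa bb cc dd|x y].
    have w0 : 0 <= t / 2 * W by rewrite mulr_ge0// divr_ge0// ltW.
    have h0 : 0 <= t / 2 * H by rewrite mulr_ge0// divr_ge0// ltW.
    have EW : a' + t * W = a' + t / 2 * W + t / 2 * W by field.
    have EH : c' + t * H = c' + t / 2 * H + t / 2 * H by field.
    rewrite EW in bb *; rewrite EH in dd *; move: P1 P2 P3 P4; rewrite /P.
    move: (t / 2 * W) (t / 2 * H) w0 h0 bb dd {EW EH} => w h w0 h0 bb dd.
    have aw : a' <= a' + w by rewrite lerDl.
    have aww : a' + w <= a' + w + w by rewrite lerDl.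
    have ch : c' <= c' + h by rewrite lerDl.
    have chh : c' + h <= c' + h + h by rewrite lerDl.
    move=> /(_ aa (le_trans aww bb) cc (le_trans chh dd)) P1.
    move=> /(_ (le_trans aa aw) bb cc (le_trans chh dd)) P2.
    move=> /(_ aa (le_trans aww bb) (le_trans cc ch) dd) P3.
    move=> /(_ (le_trans aa aw) bb (le_trans cc ch) dd) P4.
    have Fc' : rcont F a' (a' + w + w) c' (c' + h + h) by exact: rcont_sub Fc.
    have Fy y : c' <= y <= c' + h + h ->
        pathcont (fun x => F (x +i* y)) a' (a' + w + w).
      by move=> yc; exact: rcont_h Fc'.
    have Fx x : a' <= x <= a' + w + w ->
        pathcont (fun y => F (x +i* y)) c' (c' + h + h).
      by move=> xa; exact: rcont_v Fc'.
    rewrite (rect_splitx aw aww); [|apply: Fy..];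
      rewrite ?lexx ?(le_trans ch chh)//.
    rewrite !(rect_splity ch chh); try (apply: Fx);
      rewrite ?lexx ?aw ?aww ?(le_trans aw aww)//.
    apply: le_trans (norm1D _ _) _.
    apply: le_trans (lerD (norm1D _ _) (norm1D _ _)) _.
    apply: le_trans (lerD (lerD P1 P3) (lerD P2 P4)) _.
    by apply: eq_ler; field.
  rewrite /W /H !subrKC => xab ycd.
  have /holo_norm1 [l Hl] := Fh _ _ xab ycd.
  have [e e0 eP] := Hl _ eps0.
  have K0 : 0 < 1 + (W + H) by lra.
  (* The 1 keeps the denominator positive, since W and H may both vanish. *)
  exists (e / (1 + (W + H))); first by rewrite divr_gt0.
  move=> a' c' t t0; rewrite ltr_pdivlMr// => te.
  rewrite -/W -/H => /andP[ax xa] /andP[cy yc] aa bb cc dd.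
  have tW : 0 <= t * W by rewrite mulr_ge0// ltW.
  have tH : 0 <= t * H by rewrite mulr_ge0// ltW.
  pose z := x +i* y.
  (* The first-order approximation of F at z, written as an affine function of w so that
     [rect_affine] applies. *)
  pose A w := (F z - l * z) + l * w.
  have Ac a1 b1 c1 d1 : rcont A a1 b1 c1 d1.
    move=> u v _ _; apply: holo_contat; apply: holoD; first exact: holo_cst.
    by apply: holoM; [exact: holo_cst|exact: holo_id].
  have aW : a' <= a' + t * W by rewrite lerDl.
  have cH : c' <= c' + t * H by rewrite lerDl.
  have Fc' : bcont F a' (a' + t * W) c' (c' + t * H).
    by apply: rcont_bcont => //; exact: rcont_sub Fc.
  have Ac' : bcont A a' (a' + t * W) c' (c' + t * H) by exact: rcont_bcont.
  have -> : rect F a' (a' + t * W) c' (c' + t * H) =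
            rect (fun w => F w - A w) a' (a' + t * W) c' (c' + t * H).
    by rewrite rectB// rect_affine// subr0.
  have rc : bcont (fun w => F w - A w) a' (a' + t * W) c' (c' + t * H).
    apply: rcont_bcont => // u v /andP[u1 u2] /andP[v1 v2].
    apply: holo_contat; apply: holoB.
      by apply: Fh; rewrite ?(le_trans aa u1) ?(le_trans u2 bb)//
        ?(le_trans cc v1) ?(le_trans v2 dd).
    apply: holoD; first exact: holo_cst.
    by apply: holoM; [exact: holo_cst|exact: holo_id].
  have key u v : a' <= u <= a' + t * W -> c' <= v <= c' + t * H ->
      norm1 (F (u +i* v) - A (u +i* v)) <= eps * (t * (W + H)).
    move=> /andP[u1 u2] /andP[v1 v2]; pose h := (u - x) +i* (v - y).
    have hb : norm1 h <= t * (W + H).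
      clear - u1 u2 v1 v2 ax xa cy yc.
      rewrite /norm1 /= mulrDr; apply: lerD; rewrite ler_norml;
      apply/andP; split; lra.
    have -> : F (u +i* v) - A (u +i* v) = F (z + h) - F z - l * h.
      have E : u +i* v = z + h by apply: complex_ext; rewrite /= addrC subrK.
      by rewrite /A E; ring.
    apply: le_trans (eP h _) _; first by apply: le_lt_trans hb _; clear - te t0; lra.
    by rewrite ler_pM2l.
  apply: le_trans (norm1_rect (M := eps * (t * (W + H))) _ _ rc _ _) _ => //.
  - by move=> u ut; split; apply: key; rewrite ?lexx ?cH.
  - by move=> v vt; split; apply: key; rewrite ?lexx ?aW.
  - by apply: eq_ler; ring.
rewrite /P /W /H !mul1r !subrKC expr1n mulr1; exact.
Qed.

End Goursat.

(** * Sums over integers as contour integrals *)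

Section Residues.
Set Implicit Arguments.
Unset Strict Implicit.
Context {R : realType}.
Implicit Types (F G : R[i] -> R[i]) (a b c d x y t e : R).
Local Notation mu := (@lebesgue_measure R).
Local Notation Re := complex.Re.
Local Notation Im := complex.Im.

Definition holo_rect F a b c d := forall x y, a <= x <= b -> c <= y <= d ->
  holo F (x +i* y).

Definition holo_rect_except F a b c d (z0 : R[i]) :=
  forall x y, a <= x <= b -> c <= y <= d -> x +i* y != z0 -> holo F (x +i* y).

Lemma holo_rect_rcont F a b c d : holo_rect F a b c d -> rcont F a b c d.
Proof. by move=> Fh x y xa yc; apply/holo_contat/Fh. Qed.

Lemma except_pathcont_h F a b c d z0 y : c <= y <= d -> y != Im z0 ->
  holo_rect_except F a b c d z0 -> pathcont (fun x => F (x +i* y)) a b.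
Proof.
move=> yc yz Fh; apply: (@rcont_h _ _ _ _ y y); first by rewrite lexx.
move=> x y' xa /andP[y1 y2].
have -> : y' = y by apply/eqP; rewrite eq_le y2 y1.
apply/holo_contat/Fh => //; apply: contra yz => /eqP <- //.
Qed.

Lemma except_pathcont_v F a b c d z0 x : a <= x <= b -> x != Re z0 ->
  holo_rect_except F a b c d z0 -> pathcont (fun y => F (x +i* y)) c d.
Proof.
move=> xa xz Fh; apply: (@rcont_v _ _ x x); first by rewrite lexx.
move=> x' y /andP[x1 x2] yc.
have -> : x' = x by apply/eqP; rewrite eq_le x2 x1.
apply/holo_contat/Fh => //; apply: contra xz => /eqP <- //.
Qed.

(** Cutting along the vertical sides of the small square, then along its horizontal ones, leaves
    four rectangles that avoid the singular point, where Goursat's theorem applies. *)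
Lemma rect_shrink F a b c d x0 y0 e : 0 < e -> a <= x0 - e -> x0 + e <= b ->
  c <= y0 - e -> y0 + e <= d -> holo_rect_except F a b c d (x0 +i* y0) ->
  rect F a b c d = rect F (x0 - e) (x0 + e) (y0 - e) (y0 + e).
Proof.
move=> e0 ax xb cy yd Fh.
have ee x : x - e <= x + e by lra.
have cd : c <= d by rewrite (le_trans cy)// (le_trans (ee _)).
have ab : a <= b by rewrite (le_trans ax)// (le_trans (ee _)).
have ph y : c <= y <= d -> y != y0 -> pathcont (fun x => F (x +i* y)) a b.
  by move=> yc yy; exact: except_pathcont_h Fh.
have pv x : a <= x <= b -> x != x0 -> pathcont (fun y => F (x +i* y)) c d.
  by move=> xa xx; exact: except_pathcont_v Fh.
have pe x : x + e != x by rewrite gt_eqF// ltrDl.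
have me x : x - e != x by rewrite lt_eqF// gtrBl.
have pc : pathcont (fun x => F (x +i* c)) a b.
  by apply: ph; rewrite ?lexx//; apply: contraTneq e0 => E; lra.
have pd : pathcont (fun x => F (x +i* d)) a b.
  by apply: ph; rewrite ?lexx ?cd//; apply: contraTneq e0 => E; lra.
have xe1 : a <= x0 - e <= b by apply/andP; split; lra.
have xe2 : a <= x0 + e <= b by apply/andP; split; lra.
have z0 a' b' c' d' : a <= a' -> b' <= b -> c <= c' -> d' <= d ->
    a' <= b' -> c' <= d' ->
    (forall x y, a' <= x <= b' -> c' <= y <= d' -> x +i* y != x0 +i* y0) ->
    rect F a' b' c' d' = 0.
  move=> h1 h2 h3 h4 h5 h6 h7; apply: goursat => // x y xa yc.
  move: (xa) (yc) => /andP[x1 x2] /andP[y1 y2].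
  apply: Fh; last exact: h7.
    by rewrite (le_trans h1 x1) (le_trans x2 h2).
  by rewrite (le_trans h3 y1) (le_trans y2 h4).
have neqx x y : x < x0 \/ x0 < x -> x +i* y != x0 +i* y0.
  by move=> xx; apply/eqP => -[E _]; lra.
have neqy x y : y < y0 \/ y0 < y -> x +i* y != x0 +i* y0.
  by move=> yy; apply/eqP => -[_ E]; lra.
rewrite (@rect_splitx _ _ _ (x0 - e)) ?(le_trans (ee _))//.
rewrite (@rect_splitx _ _ (x0 - e) (x0 + e))//;
  [|exact: pathcont_sub pc|exact: pathcont_sub pd].
rewrite (z0 a)//; last 2 first.
  by case/andP: xe1.
  by move=> x y /andP[x1 x2] _; apply: neqx; lra.
rewrite (z0 (x0 + e))//; last 2 first.
  by case/andP: xe2.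
  by move=> x y /andP[x1 x2] _; apply: neqx; lra.
rewrite add0r addr0.
rewrite (@rect_splity _ _ _ _ _ (y0 - e)) ?(le_trans (ee _))//;
  [|exact: pv..].
have pm := pv _ xe1 (me x0); have pp := pv _ xe2 (pe x0).
rewrite (@rect_splity _ _ _ _ (y0 - e) (y0 + e))//;
  [|exact: pathcont_sub pm|exact: pathcont_sub pp].
rewrite (z0 _ _ c)//; last 2 first.
  by rewrite (le_trans (ee _)).
  by move=> x y _ /andP[x1 x2]; apply: neqy; lra.
rewrite (z0 _ _ (y0 + e))//; last 2 first.
  by rewrite (le_trans cy)// (le_trans (ee _)).
  by move=> x y _ /andP[x1 x2]; apply: neqy; lra.
by rewrite add0r addr0.
Qed.

(** The contour shrinks to a square of half-side e around the point; F is bounded there and the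
    perimeter 8e tends to 0. *)
Lemma rect_removable F a b c d x0 y0 (M e0 : R) : 0 < e0 ->
  a < x0 < b -> c < y0 < d -> holo_rect_except F a b c d (x0 +i* y0) ->
  (forall h, 0 < norm1 h -> norm1 h < e0 -> norm1 (F (x0 +i* y0 + h)) <= M) ->
  rect F a b c d = 0.
Proof.
move=> e00 /andP[ax xb] /andP[cy yd] Fh FM.
apply: norm1_eq0; apply/eqP; rewrite eq_le norm1_ge0 andbT.
apply/ler_addgt0Pr => eps eps0; rewrite add0r.
pose M' := `|M| + 1; have M'0 : 0 < M' by rewrite ltr_wpDl.
(* The square must fit in the rectangle; its points are at [norm1] distance at most 2e from the
   centre, hence e0/3, and 8M' comes from the perimeter. *)
pose e := Num.min (Num.min (Num.min (x0 - a) (b - x0)) (Num.min (y0 - c) (d - y0)))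
                  (Num.min (e0 / 3) (eps / (8 * M'))).
have [e_gt0 e1 e2 e3] : [/\ 0 < e, e <= x0 - a /\ e <= b - x0,
   e <= y0 - c /\ e <= d - y0 & e <= e0 / 3 /\ e <= eps / (8 * M')].
  rewrite /e !lt_min !ge_min !lexx ?orbT !subr_gt0 ax xb cy yd !divr_gt0//.
  by rewrite mulr_gt0.
have {e1}[e1 e1'] := e1; have {e2}[e2 e2'] := e2; have {e3}[e3 e3'] := e3.
clearbody e.
have ee x : x - e <= x + e by lra.
rewrite (@rect_shrink _ _ _ _ _ x0 y0 e)//; [|lra..].
have bnd x y : x0 - e <= x <= x0 + e -> y0 - e <= y <= y0 + e ->
   x +i* y != x0 +i* y0 -> norm1 (F (x +i* y)) <= M'.
  move=> /andP[x1 x2] /andP[y1 y2] ne.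
  have E : x +i* y = x0 +i* y0 + ((x - x0) +i* (y - y0)).
    by apply: complex_ext => /=; ring.
  rewrite E; apply: le_trans (FM _ _ _) _.
  - rewrite lt_neqAle norm1_ge0 andbT; apply: contra ne => /eqP/esym/norm1_eq0.
    by rewrite E => ->; rewrite addr0.
  - rewrite /norm1 /=.
    have : `|x - x0| <= e by rewrite ler_norml; apply/andP; split; lra.
    have : `|y - y0| <= e by rewrite ler_norml; apply/andP; split; lra.
    lra.
  - by rewrite /M'; have := ler_norm M; lra.
have xm : x0 - e <= x0 - e <= x0 + e by rewrite lexx ee.
have xp : x0 - e <= x0 + e <= x0 + e by rewrite lexx ee.
have ym : y0 - e <= y0 - e <= y0 + e by rewrite lexx ee.
have yp : y0 - e <= y0 + e <= y0 + e by rewrite lexx ee.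
have pe x : x + e != x by rewrite gt_eqF// ltrDl.
have me x : x - e != x by rewrite lt_eqF// gtrBl.
have Fh' : holo_rect_except F (x0 - e) (x0 + e) (y0 - e) (y0 + e) (x0 +i* y0).
  move=> x y /andP[x1 x2] /andP[y1 y2] ne; apply: Fh => //;
  by apply/andP; split; lra.
apply: le_trans (norm1_rect (M := M') _ _ _ _ _) _ => //.
- split; first [exact: (except_pathcont_h _ _ Fh')|exact: (except_pathcont_v _ _ Fh')].
- move=> x xx; split; apply: bnd => //; apply/eqP => -[_ E].
    by have := me y0; rewrite E eqxx.
  by have := pe y0; rewrite E eqxx.
- move=> y yy; split; apply: bnd => //; apply/eqP => -[E _].
    by have := me x0; rewrite E eqxx.
  by have := pe x0; rewrite E eqxx.
- move: e3'; rewrite ler_pdivlMr ?mulr_gt0//; lra.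
Qed.

Lemma cintegral_shift (f : R -> R[i]) a b k : a <= b ->
  pathcont f (a + k) (b + k) ->
  cintegral `[a + k, b + k] f = cintegral `[a, b] (fun x => f (x + k)).
Proof.
move=> ab /pathcont_within [c1 c2].
have dF (x : R) : is_derive x 1 (fun y => y + k) 1.
  by apply: is_derive_eq; rewrite addr0.
have D1 : ((fun y : R => y + k)^`())%classic = cst 1.
  by apply/funext => x; rewrite derive1E derive_val.
have cF (x : R) : {for x, continuous (fun y : R => y + k)}.
  by apply/differentiable_continuous/derivable1_diffP; exact: ex_derive.
have sub (g : R -> R) : {within `[a + k, b + k], continuous g} ->
  \int[mu]_(x in `[a + k, b + k]) g x = \int[mu]_(x in `[a, b]) g (x + k).
  move=> gc; rewrite /Rintegral.
  rewrite (@integration_by_substitution_increasing _ (fun y => y + k) g a b ab).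
  - congr fine; apply: eq_integral => x _ /=.
    by rewrite fctE D1 /= mulr1.
  - by move=> x y _ _; rewrite ltrD2r.
  - by rewrite D1 => x _; exact: cvg_cst.
  - by rewrite D1; exact: is_cvg_cst.
  - by rewrite D1; exact: is_cvg_cst.
  - split; first by move=> x _; exact: ex_derive.
    + by apply: cvg_at_right_filter; exact: cF.
    + by apply: cvg_at_left_filter; exact: cF.
  - exact: gc.
by congr (_ +i* _); exact: sub.
Qed.

Lemma cintegral_oppr (f : R -> R[i]) a b : a <= b -> pathcont f (- b) (- a) ->
  cintegral `[- b, - a] f = cintegral `[a, b] (fun x => f (- x)).
Proof.
move=> ab /pathcont_within [c1 c2].
by congr (_ +i* _); rewrite /Rintegral integration_by_substitution_oppr.
Qed.

End Residues.

(** * A periodic kernel with simple poles at the integers *)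

Section IntegerPoles.
Set Implicit Arguments.
Unset Strict Implicit.
Context {R : realType}.
Implicit Types (F G : R[i] -> R[i]) (z w h : R[i]) (a b c d x y t e : R).
Local Notation mu := (@lebesgue_measure R).
Local Notation Re := complex.Re.
Local Notation Im := complex.Im.

Lemma norm1_gt0 z : (0 < norm1 z) = (z != 0).
Proof.
rewrite lt_neqAle norm1_ge0 andbT eq_sym; congr negb; apply/eqP/eqP.
  exact: norm1_eq0.
by move=> ->; rewrite norm10.
Qed.

Lemma norm1V z : z != 0 -> norm1 z^-1 <= 2 / norm1 z.
Proof.
move=> z0; have z0' : 0 < norm1 z by rewrite norm1_gt0.
rewrite ler_pdivlMr//.
have s0 : 0 < sqrnormc z.
  by have := norm1_sqr z; have := exprn_gt0 2 z0'; lra.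
have -> : norm1 z^-1 = norm1 z / sqrnormc z.
  case: z s0 {z0 z0'} => a b /= s0.
  by rewrite /norm1 /= normrN !normrM normfV (gtr0_norm s0) mulrDl.
rewrite mulrAC ler_pdivrMr//; have := norm1_sqr z; lra.
Qed.

Lemma norm1_subr_ge z w : norm1 z - norm1 w <= norm1 (w - z).
Proof.
have := norm1B w (w - z); rewrite opprB addrCA subrr addr0; lra.
Qed.

(** This is exp(-2 i pi z), of modulus exp(2 pi Im z). With this sign the kernel below is small in
    the upper half-plane, where a packet with y > 0 grows. *)
Definition pexp z := cexp ((0 -i* (2 * pi)) * z).

(* The residues of [pkernel] at the integers are all equal, and it is
   exponentially small far above the real axis, close to 1 far below it. *)
Definition pkernel z := (1 - pexp z)^-1.

Lemma pexpE x y : pexp (x +i* y) =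
  (expR (2 * pi * y) * cos (2 * pi * x)) -i*
  (expR (2 * pi * y) * sin (2 * pi * x)).
Proof.
rewrite /pexp /cexp /= mul0r sub0r mul0r add0r !mulNr opprK cosN sinN.
by rewrite mulrN.
Qed.

Lemma pexpDn z (n : nat) : pexp (z + n%:R) = pexp z.
Proof.
elim: n => [|n IH]; first by rewrite addr0.
rewrite -natr1 addrA /pexp mulrDr mulr1 cexpD -/(pexp _) IH.
rewrite -[RHS]mulr1; congr (_ * _); rewrite /cexp /= expR0 cosN sinN.
have -> : 2 * pi = pi *+ 2 :> R by rewrite mulr2n; ring.
by rewrite cos2pi sin2pi oppr0 !mul1r.
Qed.

Lemma pkernelDn z (n : nat) : pkernel (z + n%:R) = pkernel z.
Proof. by rewrite /pkernel pexpDn. Qed.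

Lemma holo_pexp z : holo pexp z.
Proof.
apply: holo_comp; last exact: holo_cexp.
by apply: holoM; [exact: holo_cst|exact: holo_id].
Qed.

Lemma holo_pkernel z : pexp z != 1 -> holo pkernel z.
Proof.
move=> z1; apply: holoV; first by rewrite subr_eq0 eq_sym.
by apply: holoB; [exact: holo_cst|exact: holo_pexp].
Qed.

Lemma pexp_neq1 x y : `|x| <= 1 / 2 -> x +i* y != 0 -> pexp (x +i* y) != 1.
Proof.
move=> x1; apply: contra => /eqP; rewrite pexpE => -[E1 E2].
have e0 := expR_gt0 (2 * pi * y).
have s0 : sin (2 * pi * x) = 0.
  move/eqP: E2; rewrite oppr_eq0 mulf_eq0 => /orP[/eqP E|/eqP//].
  by move: e0; rewrite E ltxx.
have p0 := pi_gt0 R.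
have c1 : cos (2 * pi * x) = 1.
  have := cos2Dsin2 (2 * pi * x); rewrite s0 expr0n /= addr0 => /eqP.
  rewrite sqrf_eq1 => /orP[/eqP//|/eqP E].
  by move: E1; rewrite E; lra.
move: E1; rewrite c1 mulr1 -[RHS]expR0 => /expR_inj/eqP.
rewrite !mulf_eq0 pnatr_eq0 /= gt_eqF//= => /eqP ->.
suff -> : x = 0 by [].
have x0 := normr_ge0 x.
have bx : 0 <= 2 * pi * `|x| <= pi by apply/andP; split; nra.
have : 2 * pi * `|x| = 0.
  apply: (@cos_inj R); rewrite ?in_itv /=.
  - exact: bx.
  - by rewrite lexx ltW.
  - have -> : 2 * pi * `|x| = `|2 * pi * x|.
      by rewrite !normrM ger0_norm// ger0_norm// ltW.
    by rewrite cos_norm c1 cos0.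
move=> /eqP; rewrite !mulf_eq0 pnatr_eq0 /= gt_eqF//= normr_eq0.
by move/eqP.
Qed.

Lemma pexp_neq1_im x y : y != 0 -> pexp (x +i* y) != 1.
Proof.
move=> y0; apply/eqP; rewrite pexpE => -[E1 /eqP].
rewrite oppr_eq0 mulf_eq0 => /orP[|/eqP s0].
  by rewrite expR_eq0.
have : expR (2 * pi * y) ^+ 2 = 1.
  have := cos2Dsin2 (2 * pi * x); rewrite s0 expr0n /= addr0 => c1.
  by rewrite -[LHS]mulr1 -[X in _ * X = _]c1 -exprMn E1 expr1n.
rewrite -expRM_natl -[RHS]expR0 => /expR_inj/eqP.
by rewrite !mulf_eq0 !pnatr_eq0 /= gt_eqF ?pi_gt0//= (negbTE y0).
Qed.

(** Near 0, [cexp v - 1] differs from v by at most half of [norm1 v], and v = -2 i pi h, so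
    [norm1 (1 - pexp h)] is at least pi times [norm1 h]; the factor 2 is that of [norm1V]. *)
Lemma pkernel_pole : exists2 e : R, 0 < e &
  forall h, 0 < norm1 h -> norm1 h < e -> norm1 (pkernel h) <= 2 / norm1 h.
Proof.
have [d d0 dP] := @cexp_expansion R 0 (1 / 2) ltac:(lra).
have p2 := pi_ge2 R.
exists (d / (2 * pi)); first by rewrite divr_gt0//; lra.
move=> h h0; rewrite ltr_pdivlMr; last lra.
have nh : norm1 ((0 -i* (2 * pi)) * h) = norm1 h * (2 * pi).
  rewrite /norm1 !ReImE /= !mul0r sub0r add0r mulNr opprK !normrM normrN.
  rewrite normrM (ger0_norm (ler0n _ _)) (ger0_norm (pi_ge0 _)) addrC; ring.
rewrite -nh => /dP; rewrite add0r cexp0 mul1r => Hh.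
have key : norm1 h <= norm1 (1 - pexp h).
  rewrite -[norm1 (1 - _)]norm1N opprB /pexp.
  set v := _ * h in nh Hh *.
  have H : norm1 v <= norm1 (cexp v - 1) + norm1 (cexp v - 1 - v).
    rewrite {1}(_ : v = (cexp v - 1) - (cexp v - 1 - v)); first exact: norm1B.
    by ring.
  apply: (@le_trans _ _ (norm1 v - 1 / 2 * norm1 v)); last by lra.
  by rewrite nh; nra.
have ne : 1 - pexp h != 0 by rewrite -norm1_gt0 (lt_le_trans h0 key).
apply: le_trans (norm1V ne) _.
by rewrite ler_pM2l// lef_pV2// posrE norm1_gt0.
Qed.

Definition strip_holo F (n : nat) (H : R) :=
  holo_rect F (n%:R - 1 / 2) (n%:R + 1 / 2) (- H) H.

Lemma pkernel_strip (n : nat) (H : R) :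
  holo_rect_except pkernel (n%:R - 1 / 2) (n%:R + 1 / 2) (- H) H (n%:R +i* 0).
Proof.
move=> x y /andP[x1 x2] _ ne; apply: holo_pkernel.
have E : x +i* y = ((x - n%:R) +i* y) + n%:R.
  rewrite -(rmorph_nat (real_complex R)).
  by apply: complex_ext; rewrite /= ?addr0 ?subrK.
rewrite E pexpDn; apply: pexp_neq1.
  by rewrite ler_norml; apply/andP; split; lra.
apply: contra ne => /eqP[/eqP]; rewrite subr_eq0 => /eqP -> ->; exact: eqxx.
Qed.

(** It is 2 i pi times the common residue, that is 1 by the residue theorem; the sequel divides by
    it, whence [pconst_neq0]. *)
Definition pconst : R[i] := rect pkernel (- (1 / 2)) (1 / 2) (- 2) 2.

(** Both contours shrink to squares of the same half-side e around n and 0, and these two squares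
    match by periodicity. *)
Lemma pkernel_rect (n : nat) (H : R) : 0 < H ->
  rect pkernel (n%:R - 1 / 2) (n%:R + 1 / 2) (- H) H = pconst.
Proof.
move=> H0; pose e := Num.min H (1 / 4).
have [e0 eH e4] : [/\ 0 < e, e <= H & e <= 1 / 4].
  by rewrite /e lt_min H0 !ge_min !lexx orbT; split=> //; lra.
clearbody e.
rewrite (@rect_shrink _ _ _ _ _ _ n%:R 0 e)//;
  [|lra|lra|lra|lra|exact: pkernel_strip].
have := @pkernel_strip 0%N 2; rewrite mulr0n !add0r => hs.
rewrite /pconst [RHS](@rect_shrink _ _ _ _ _ _ 0 0 e)//; [|lra..].
rewrite !sub0r !add0r.
have ee : - e <= e by lra.
have En x : n%:R + x = x + n%:R by rewrite addrC.
have sh y : y != 0 ->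
    cintegral `[n%:R - e, n%:R + e] (fun x => pkernel (x +i* y)) =
    cintegral `[- e, e] (fun x => pkernel (x +i* y)).
  move=> y0; rewrite En (En e) cintegral_shift//.
    apply: eq_cintegral => x _; rewrite -(pkernelDn (x +i* y) n).
    congr pkernel; rewrite -(rmorph_nat (real_complex R)).
    by apply: complex_ext; rewrite /= ?addr0.
  apply: (@rcont_h _ _ _ _ y y); first by rewrite lexx.
  move=> x y' _ /andP[y1 y2].
  have -> : y' = y by apply/eqP; rewrite eq_le y2 y1.
  exact/holo_contat/holo_pkernel/pexp_neq1_im.
have sv x : cintegral `[- e, e] (fun y => pkernel ((n%:R + x) +i* y)) =
    cintegral `[- e, e] (fun y => pkernel (x +i* y)).
  apply: eq_cintegral => y _; rewrite -(pkernelDn (x +i* y) n).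
  congr pkernel; rewrite -(rmorph_nat (real_complex R)).
  by apply: complex_ext; rewrite /= ?addr0 1?addrC.
rewrite /rect (sv e) (sv (- e)) (sh e) ?gt_eqF// (sh (- e))//.
by rewrite lt_eqF// oppr_lt0.
Qed.

(** Subtracting [k * pkernel] with k = F(n) leaves (F - F(n)) times the kernel: the zero of the
    first factor compensates the simple pole, so the singularity is removable. *)
Lemma strip_residue F (n : nat) (H : R) : 0 < H -> strip_holo F n H ->
  rect (fun z => F z * pkernel z) (n%:R - 1 / 2) (n%:R + 1 / 2) (- H) H =
  F n%:R%:C * pconst.
Proof.
move=> H0 Fh; pose k := F n%:R%:C.
have n1 x : x - 1 / 2 <= x - 1 / 2 <= x + 1 / 2 by apply/andP; split; lra.
have n2 x : x - 1 / 2 <= x + 1 / 2 <= x + 1 / 2 by apply/andP; split; lra.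
have H1 : - H <= - H <= H by apply/andP; split; lra.
have H2 : - H <= H <= H by apply/andP; split; lra.
have bc G : holo_rect_except G (n%:R - 1 / 2) (n%:R + 1 / 2) (- H) H (n%:R +i* 0) ->
    bcont G (n%:R - 1 / 2) (n%:R + 1 / 2) (- H) H.
  move=> Gh; split.
  - by apply: (except_pathcont_h _ _ Gh); rewrite //= lt_eqF// oppr_lt0.
  - by apply: (except_pathcont_h _ _ Gh); rewrite //= gt_eqF.
  - by apply: (except_pathcont_v _ _ Gh); rewrite //= lt_eqF//; lra.
  - by apply: (except_pathcont_v _ _ Gh); rewrite //= gt_eqF//; lra.
have hFp : holo_rect_except (fun z => F z * pkernel z) (n%:R - 1 / 2) (n%:R + 1 / 2) (- H) H (n%:R +i* 0).
  move=> x y xa yc ne; apply: holoM; first exact: Fh.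
  exact: (pkernel_strip xa yc).
have hkp : holo_rect_except (fun z => k * pkernel z) (n%:R - 1 / 2) (n%:R + 1 / 2) (- H) H (n%:R +i* 0).
  move=> x y xa yc ne; apply: holoM; first exact: holo_cst.
  exact: (pkernel_strip xa yc).
rewrite -(pkernel_rect n H0) -/k -rectZ; last exact/bc/pkernel_strip.
apply/eqP; rewrite -subr_eq0 -rectB; [|exact: bc..]; apply/eqP.
have n0 x : x - 1 / 2 <= x <= x + 1 / 2 by apply/andP; split; lra.
have h0 : - H <= 0 <= H by apply/andP; split; lra.
have /holo_norm1 [l Hl] := Fh _ _ (n0 _) h0.
have [d d0 dP] := Hl 1 ltr01.
have [e e0 eP] := pkernel_pole.
apply: (@rect_removable _ _ _ _ _ _ n%:R 0 ((1 + norm1 l) * 2) (Num.min d e)).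
- by rewrite lt_min d0 e0.
- by apply/andP; split; lra.
- by apply/andP; split; lra.
- by move=> x y xa yc ne; apply: holoB; [exact: hFp|exact: hkp].
move=> h hp; rewrite lt_min => /andP[hd he].
rewrite -mulrBl; apply: le_trans (norm1M _ _) _.
have -> : norm1 (pkernel (n%:R +i* 0 + h)) = norm1 (pkernel h).
  rewrite -(pkernelDn h n) addrC; congr (norm1 (pkernel (_ + _))).
  by rewrite -(rmorph_nat (real_complex R)).
have F1 : norm1 (F (n%:R +i* 0 + h) - k) <= (1 + norm1 l) * norm1 h.
  have -> : F (n%:R +i* 0 + h) - k = (F (n%:R +i* 0 + h) - F (n%:R +i* 0) - l * h) + l * h.
    by rewrite /k; ring.
  apply: le_trans (norm1D _ _) _.
  by have := dP _ hd; have := norm1M l h; lra.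
apply: (@le_trans _ _ ((1 + norm1 l) * norm1 h * (2 / norm1 h))).
  by apply: ler_pM; rewrite ?norm1_ge0//; exact: eP.
by rewrite le_eqVlt; apply/orP; left; apply/eqP; field; rewrite gt_eqF.
Qed.

(** The rectangle is cut at half-integers, where the kernel is regular, into strips that contain one
    integer each; for k = 0 it has zero width. *)
Lemma sum_residues F (m k : nat) (H : R) : 0 < H ->
  holo_rect F (m%:R - 1 / 2) (m%:R + k%:R - 1 / 2) (- H) H ->
  rect (fun z => F z * pkernel z) (m%:R - 1 / 2) (m%:R + k%:R - 1 / 2) (- H) H =
  (\sum_(i < k) F (m + i)%:R%:C) * pconst.
Proof.
move=> H0; elim: k => [|k IH] Fh.
  rewrite big_ord0 mul0r addr0 /rect set_itv1 subrr mulr0 addr0.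
  have z (f : R -> R[i]) x : cintegral [set x] f = 0.
    by apply: complex_ext; rewrite /cintegral /= Rintegral_set1.
  by rewrite !z subrr.
have E : m%:R + k.+1%:R - 1 / 2 = (m + k)%:R + 1 / 2 :> R.
  by rewrite -natr1 natrD; lra.
have E' : m%:R + k%:R - 1 / 2 = (m + k)%:R - 1 / 2 :> R by rewrite natrD.
have mk : m%:R <= (m + k)%:R :> R by rewrite natrD lerDl.
rewrite E in Fh *.
have pc y : - H <= y <= H -> y != 0 ->
    pathcont (fun x => F (x +i* y) * pkernel (x +i* y)) (m%:R - 1 / 2) ((m + k)%:R + 1 / 2).
  move=> yH y0; apply: (@rcont_h _ (fun z => F z * pkernel z) _ _ y y); first by rewrite lexx.
  move=> x y' xa /andP[y1 y2].
  have -> : y' = y by apply/eqP; rewrite eq_le y2 y1.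
  apply: holo_contat; apply: holoM; first exact: Fh.
  exact/holo_pkernel/pexp_neq1_im.
rewrite (@rect_splitx _ _ _ ((m + k)%:R - 1 / 2)); first last.
- by apply: pc; rewrite ?gt_eqF//; apply/andP; split; lra.
- by apply: pc; rewrite ?lt_eqF ?oppr_lt0//; apply/andP; split; lra.
- by lra.
- by lra.
rewrite strip_residue//; last first.
  by move=> x y /andP[x1 x2] yH; apply: Fh => //; apply/andP; split; lra.
rewrite -E' IH; last first.
  move=> x y /andP[x1 x2] yH; apply: Fh => //; apply/andP; split=> //.
  by move: x2; rewrite E'; lra.
by rewrite big_ord_recr /= mulrDl.
Qed.

Lemma pkernel_reflect z : pexp z != 1 -> pkernel (- z) = 1 - pkernel z.
Proof.
move=> z1; have E : pexp z * pexp (- z) = 1.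
  by rewrite /pexp -cexpD mulrN subrr cexp0.
have p0 : pexp z != 0.
  by apply/eqP => p0; move: E; rewrite p0 mul0r => /esym/eqP; rewrite oner_eq0.
have -> : pkernel (- z) = (1 - (pexp z)^-1)^-1.
  by rewrite /pkernel -[in LHS](mulfK p0 (pexp (- z))) [_ * pexp z]mulrC E mul1r.
rewrite /pkernel; field; rewrite p0 !subr_eq0 z1 eq_sym z1 //.
Qed.

Lemma norm1_pexp_ge x y : expR (2 * pi * y) <= norm1 (pexp (x +i* y)).
Proof.
rewrite pexpE /norm1 /= normrN !normrM gtr0_norm ?expR_gt0// -mulrDr.
rewrite ler_peMr ?expR_ge0//.
set c := cos _; set s := sin _.
have : `|c| ^+ 2 + `|s| ^+ 2 = 1.
  by rewrite !real_normK ?num_real// /c /s cos2Dsin2.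
by have := normr_ge0 c; have := normr_ge0 s; nra.
Qed.

Lemma norm1_pkernel_top x y (M : R) : 1 < M -> M <= expR (2 * pi * y) ->
  norm1 (pkernel (x +i* y)) <= 2 / (M - 1).
Proof.
move=> M1 My.
have key : M - 1 <= norm1 (1 - pexp (x +i* y)).
    have := norm1_pexp_ge x y.
  have := norm1_subr_ge (pexp (x +i* y)) 1.
  rewrite (_ : norm1 (1 : R[i]) = 1) ?norm1_real ?normr1//.
  lra.
have ne : 1 - pexp (x +i* y) != 0 by rewrite -norm1_gt0; lra.
apply: le_trans (norm1V ne) _; rewrite ler_pM2l// lef_pV2// posrE; lra.
Qed.

(** The vertical sides cancel by periodicity and the reflection z -> -z turns the lower side into 1
    minus the upper one, so [pconst] is 1 - 2 [top], and [top] is small because the kernel is small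
    at height 2. *)
Lemma pconst_neq0 : pconst != 0.
Proof.
have p2 := pi_ge2 R.
pose top := cintegral `[- (1 / 2), 1 / 2] (fun x => pkernel (x +i* 2)).
have tc : pathcont (fun x => pkernel (x +i* 2)) (- (1 / 2)) (1 / 2).
  apply: (@rcont_h _ _ _ _ 2 2); first by rewrite lexx.
  move=> x y _ /andP[y1 y2]; apply/holo_contat/holo_pkernel/pexp_neq1_im.
  by rewrite gt_eqF//; lra.
have bc : pathcont (fun x => pkernel (x +i* -2)) (- (1 / 2)) (1 / 2).
  apply: (@rcont_h _ _ _ _ (-2) (-2)); first by rewrite lexx.
  move=> x y _ /andP[y1 y2]; apply/holo_contat/holo_pkernel/pexp_neq1_im.
  by rewrite lt_eqF//; lra.
have hh : - (1 / 2) <= 1 / 2 :> R by lra.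
have ti := pathcont_cintegrable tc.
have bot : cintegral `[- (1 / 2), 1 / 2] (fun x => pkernel (x +i* -2)) = 1 - top.
  have : pathcont (fun x => pkernel (x +i* -2)) (- (1 / 2)) (- (- (1 / 2))).
    by rewrite opprK.
  move=> /(cintegral_oppr hh); rewrite opprK => ->.
  rewrite (eq_cintegral (g := fun x => (1 + 0 * x%:C) - pkernel (x +i* 2))).
    rewrite cintegralB//; last exact/pathcont_cintegrable/pathcont_affine.
    rewrite cintegral_affine// mul0r addr0 mul1r; congr (_ - _).
    by apply: complex_ext => //=; lra.
  move=> x _; rewrite mul0r addr0 -pkernel_reflect; last first.
    by apply: pexp_neq1_im; rewrite gt_eqF.
  by congr pkernel; apply: complex_ext.
have lr : cintegral `[- 2, 2] (fun y => pkernel ((1 / 2) +i* y)) =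
          cintegral `[- 2, 2] (fun y => pkernel ((- (1 / 2)) +i* y)).
  apply: eq_cintegral => y _; rewrite -(pkernelDn ((- (1 / 2)) +i* y) 1).
  by congr pkernel; apply: complex_ext => /=; [lra|rewrite addr0].
rewrite /pconst /rect bot lr subrr mulr0 addr0 -/top.
apply/eqP => E.
have : norm1 (1 : R[i]) <= norm1 top + norm1 top.
  have -> : 1 = top + top :> R[i] by apply/eqP; rewrite -subr_eq0 opprD addrA E.
  exact: norm1D.
have : norm1 top <= 1 / 4 * (1 / 2 - (- (1 / 2))).
  apply: norm1_cintegral_itv => // x _.
  (* Here 9 comes from exp(4 pi) >= 1 + 4 pi and pi >= 2; the kernel is then at most 2 / (9 - 1) =
     1/4. *)
  apply: le_trans (@norm1_pkernel_top x 2 9 _ _) _; [lra| |].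
    by apply: le_trans (expR_ge1Dx _); lra.
  by rewrite le_eqVlt; apply/orP; left; apply/eqP; field.
rewrite (_ : norm1 1 = 1) ?norm1_real ?normr1//; lra.
Qed.

End IntegerPoles.

(** * Wave packets *)

Section WavePackets.
Set Implicit Arguments.
Unset Strict Implicit.
Context {R : realType}.
Implicit Types (F G : R[i] -> R[i]) (z w : R[i]) (a b c d x y t e u v s : R).
Local Notation mu := (@lebesgue_measure R).
Local Notation Re := complex.Re.
Local Notation Im := complex.Im.
Variable rho : R[i] -> R[i].

(** The integrand of a packet at y = x - x0, extended to complex frequencies. Dividing the Gaussian
    exponent by N makes it linear in N when z - N is of order N. *)
Definition wave s (N : R) y z := cexp (s%:C * rho z -
  (N^-1)%:C * (z - N%:C) ^+ 2 - (0 +i* y) * z).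

Lemma holo_wave s N y z : holo rho z -> holo (wave s N y) z.
Proof.
move=> hz; apply: holo_comp; last exact: holo_cexp.
apply: holoB; last by apply: holoM; [exact: holo_cst|exact: holo_id].
apply: holoB; first by apply: holoM; [exact: holo_cst|].
apply: holoM; first exact: holo_cst.
by apply: holoM; (apply: holoB; [exact: holo_id|exact: holo_cst]).
Qed.

Lemma wave_bound s N y u v (A : R) : s * Re (rho (u +i* v)) <= A ->
  norm1 (wave s N y (u +i* v)) <=
  2 * expR (A - (u - N) ^+ 2 / N + v ^+ 2 / N + y * v).
Proof.
move=> sA; apply: le_trans (norm1_cexp _) _.
rewrite ler_pM2l// ler_expR expr2 !ReImE /=.
move: (Re _) sA => q sA; move: (Im _) => q'.
by set k := N^-1; nra.
Qed.

Lemma Rintegral_expR (A y c d : R) : c <= d -> y != 0 ->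
  \int[mu]_(t in `[c, d]) expR (A + y * t) =
  (expR (A + y * d) - expR (A + y * c)) / y.
Proof.
rewrite le_eqVlt => /predU1P[<-|ab] y0.
  by rewrite set_itv1 Rintegral_set1 subrr mul0r.
pose F t : R := expR (A + y * t) / y.
have dF (x : R) : is_derive x 1 F (expR (A + y * x)).
  rewrite /F; apply: is_derive_eq; rewrite /GRing.scale /=.
  by field.
have cF (x : R) : {for x, continuous F}.
  by apply/differentiable_continuous/derivable1_diffP; exact: ex_derive.
have FTC : (\int[mu]_(t in `[c, d]) (expR (A + y * t))%:E = (F d)%:E - (F c)%:E)%E.
  apply: continuous_FTC2 => //.
  - apply: continuous_subspaceT => z.
    have -> : (fun t => expR (A + y * t)) = (fun t => F t * y).
      by apply/funext => t; rewrite /F; field.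
    by apply: cvgM; [exact: cF|exact: cvg_cst].
  - split; first by move=> z _; exact: ex_derive.
    + by apply: cvg_at_right_filter; exact: cF.
    + by apply: cvg_at_left_filter; exact: cF.
  - by move=> z _; rewrite derive1E derive_val.
by rewrite /Rintegral FTC /= /F; field.
Qed.

(** The sign conditions keep the segment on the side where exp(y v) decays; integrating this factor
    exactly, instead of bounding it by 1, gains 1/|y|. *)
Lemma vertical_bound (f : R -> R[i]) c d (A y : R) : c <= d -> pathcont f c d ->
  y != 0 -> y * c <= 0 -> y * d <= 0 ->
  (forall v, c <= v <= d -> norm1 (f v) <= 2 * expR (A + y * v)) ->
  norm1 (cintegral `[c, d] f) <= 2 * expR A / `|y|.
Proof.
move=> cd fc y0 yc yd fA.
have fi := pathcont_cintegrable fc.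
have cexp' : {within `[c, d], continuous (fun v : R => 2 * expR (A + y * v))}.
  apply: derivable_within_continuous => v _; exact: ex_derive.
have ie : mu.-integrable `[c, d] (EFin \o (fun v => 2 * expR (A + y * v))).
  by apply: continuous_compact_integrable => //; exact: segment_compact.
have cexp1 : {within `[c, d], continuous (fun v : R => expR (A + y * v))}.
  apply: derivable_within_continuous => v _; exact: ex_derive.
have ie1 : mu.-integrable `[c, d] (EFin \o (fun v => expR (A + y * v))).
  by apply: continuous_compact_integrable => //; exact: segment_compact.
apply: le_trans (le_norm1_cintegral _ fi) _ => //.
apply: (@le_trans _ _ (\int[mu]_(v in `[c, d]) (2 * expR (A + y * v)))).
  by apply: le_Rintegral => //; exact: cintegrable_norm1.
rewrite RintegralZl// Rintegral_expR// -mulrA ler_pM2l//.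
apply: le_trans (ler_norm _) _; rewrite normrM normfV ler_wpM2r ?invr_ge0//.
have e1 : expR (A + y * d) <= expR A by rewrite ler_expR; lra.
have e2 : expR (A + y * c) <= expR A by rewrite ler_expR; lra.
have e3 := expR_ge0 (A + y * d); have e4 := expR_ge0 (A + y * c).
by rewrite ler_norml; apply/andP; split; lra.
Qed.

Lemma expRN_le t : 0 < t -> expR (- t) <= t^-1.
Proof.
move=> t0; rewrite expRN lef_pV2 ?posrE ?expR_gt0//.
by apply: le_trans (expR_ge1Dx t); rewrite lerDr.
Qed.

(* On the lines Im z = -+ delta N, the growth delta^2 N of the Gaussian and the
   growth eta N of s * rho are both absorbed by the decay delta r N of
   exp(-i y z). *)
Definition admissible (r delta eta N T : R) :=
  [/\ 0 < r <= 1, 0 < delta <= r / 4, eta <= delta * r / 8, 0 < N &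
   forall u v, N / 2 <= u <= 3 * N / 2 -> `|v| <= delta * N ->
     holo rho (u +i* v) /\
     forall s, 0 <= s <= T -> s * Re (rho (u +i* v)) <= eta * N].

(** Of the decay delta r N / 2, the Gaussian takes at most delta r N / 4 and rho at most delta r N /
    8, which leaves delta r N / 8; k records the surplus, which may be negative. *)
Lemma wave_horizontal r delta eta N T s y u v (k : R) :
  admissible r delta eta N T ->
  0 <= s <= T -> N / 2 <= u <= 3 * N / 2 -> `|v| = delta * N ->
  k + delta * N * r / 2 <= - (y * v) ->
  norm1 (wave s N y (u +i* v)) <= 2 * (expR (- (delta * r / 8) * N) * expR (- k)).
Proof.
move=> [/andP[r0 r1] /andP[d0 d1] e1 N0 H] sT uN vN yv.
have vle : `|v| <= delta * N by rewrite vN.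
have [_ /(_ s sT) sr] := H _ _ uN vle.
apply: le_trans (wave_bound _ _ sr) _; rewrite ler_pM2l// -expRD ler_expR.
have -> : v ^+ 2 = delta ^+ 2 * N ^+ 2.
  by rewrite -(real_normK (num_real v)) vN exprMn.
have -> : delta ^+ 2 * N ^+ 2 / N = delta ^+ 2 * N by field; rewrite gt_eqF.
have u2 : 0 <= (u - N) ^+ 2 / N by rewrite divr_ge0 ?sqr_ge0 ?ltW.
have dd : delta ^+ 2 * N <= delta * r / 4 * N.
  by rewrite ler_pM2r// expr2 -mulrA ler_pM2l.
have ee : eta * N <= delta * r / 8 * N by rewrite ler_pM2r.
lra.
Qed.

(** At the ends of the window the Gaussian weight exp(-N/4) pays for both losses, since delta^2 <=
    1/16 and delta r <= 1/4. The factor exp(y v) is kept for the integration in v. *)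
Lemma wave_vertical r delta eta N T s y u v : admissible r delta eta N T ->
  0 <= s <= T -> u = N / 2 \/ u = 3 * N / 2 -> `|v| <= delta * N ->
  norm1 (wave s N y (u +i* v)) <= 2 * expR (- (delta * r / 8) * N + y * v).
Proof.
move=> [/andP[r0 r1] /andP[d0 d1] e1 N0 H] sT uN vN.
have uN' : N / 2 <= u <= 3 * N / 2 by case: uN => ->; apply/andP; split; lra.
have [_ /(_ s sT) sr] := H _ _ uN' vN.
apply: le_trans (wave_bound _ _ sr) _; rewrite ler_pM2l// ler_expR.
rewrite lerD2r.
have -> : (u - N) ^+ 2 / N = N / 4.
  by case: uN => ->; field; rewrite (gt_eqF N0).
have v2 : v ^+ 2 / N <= delta ^+ 2 * N.
  rewrite ler_pdivrMr// -mulrA -expr2 -exprMn -(real_normK (num_real v)).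
  by rewrite !(expr2 _) ler_pM.
have dr : delta * r <= 1 / 4 by nra.
have d2 : delta ^+ 2 * N <= 1 / 16 * N by rewrite ler_pM2r//; nra.
have ee : eta * N <= delta * r / 8 * N by rewrite ler_pM2r.
have dN : delta * r * N <= 1 / 4 * N by rewrite ler_pM2r.
lra.
Qed.

Lemma admissible_holo r delta eta N T s y : admissible r delta eta N T ->
  forall u v, N / 2 <= u <= 3 * N / 2 -> `|v| <= delta * N ->
  holo (wave s N y) (u +i* v).
Proof. by move=> [_ _ _ _ H] u v uN vN; apply: holo_wave; case: (H _ _ uN vN). Qed.

(** The segment is moved to the half-plane where y v < 0. On the horizontal side half of the decay
    |y| delta N is surplus, and exp(-t) <= 1/t converts it into 1/|y|, with constant 4/delta; each
    vertical side contributes 2/|y|. *)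
Lemma line_estimate r delta eta N T s y : admissible r delta eta N T ->
  0 <= s <= T -> r <= `|y| ->
  norm1 (cintegral `[N / 2, 3 * N / 2] (fun u => wave s N y u%:C)) <=
  (4 / delta + 4) * expR (- (delta * r / 8) * N) / `|y|.
Proof.
move=> adm sT ry; have [/andP[r0 r1] /andP[d0 d1] e1 N0 _] := adm.
have ab : N / 2 <= 3 * N / 2 by lra.
have h0 : 0 < delta * N by rewrite mulr_gt0.
have y0 : 0 < `|y| by lra.
have yn0 : y != 0 by rewrite -normr_gt0.
pose W := wave s N y; set E := expR (- (delta * r / 8) * N).
have key c d : c <= d -> `|c| <= delta * N -> `|d| <= delta * N ->
    y * c <= 0 -> y * d <= 0 ->
    rect W (N / 2) (3 * N / 2) c d = 0 /\
    (forall x, x = N / 2 \/ x = 3 * N / 2 ->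
      norm1 (cintegral `[c, d] (fun v => W (x +i* v))) <= 2 * E / `|y|).
  move=> cd hc hd yc yd.
  have Wh : holo_rect W (N / 2) (3 * N / 2) c d.
    move=> u v uN /andP[v1 v2]; apply: admissible_holo adm _ _ uN _.
    move: hc hd; rewrite !ler_norml => /andP[h1 h2] /andP[h3 h4].
    by apply/andP; split; lra.
  split; first exact: goursat.
  move=> x xN; apply: vertical_bound => //.
    apply: rcont_v (holo_rect_rcont Wh).
    by case: xN => ->; apply/andP; split; lra.
  move=> v /andP[v1 v2]; apply: wave_vertical adm sT xN _.
  move: hc hd; rewrite !ler_norml => /andP[h1 h2] /andP[h3 h4].
  by apply/andP; split; lra.
have hor v : `|v| = delta * N -> y * v = - (`|y| * (delta * N)) ->
    norm1 (cintegral `[N / 2, 3 * N / 2] (fun u => W (u +i* v))) <=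
    4 / delta * E / `|y|.
  move=> vN yv.
  have pc : pathcont (fun u => W (u +i* v)) (N / 2) (3 * N / 2).
    apply: (@rcont_h _ _ _ _ v v); first by rewrite lexx.
    move=> u v' uN /andP[v1 v2].
    have -> : v' = v by apply/eqP; rewrite eq_le v2 v1.
    by apply: holo_contat; apply: admissible_holo adm _ _ uN _; rewrite vN.
  have kb u : N / 2 <= u <= 3 * N / 2 ->
      norm1 (W (u +i* v)) <= 2 * (E * expR (- (`|y| * (delta * N) / 2))).
    move=> uN; apply: wave_horizontal adm sT uN vN _.
    by rewrite yv opprK; nra.
  apply: le_trans (norm1_cintegral_itv _ _ kb) _ => //.
    exact: pathcont_cintegrable.
  have -> : 3 * N / 2 - N / 2 = N by field.
  have := @expRN_le (`|y| * (delta * N) / 2) ltac:(by rewrite divr_gt0// mulr_gt0).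
  move=> H; apply: (@le_trans _ _ (2 * (E * (`|y| * (delta * N) / 2)^-1) * N)).
    by rewrite ler_pM2r// ler_pM2l// ler_pM2l// expR_gt0.
  rewrite le_eqVlt; apply/orP; left; apply/eqP; field.
  by rewrite !gt_eqF.
have i1 z : norm1 ((0 +i* 1) * z) = norm1 z.
  by rewrite /norm1 !ReImE /= !mul0r !mul1r sub0r add0r normrN addrC.
have tot z1 z2 z3 : norm1 z1 <= 4 / delta * E / `|y| ->
    norm1 z2 <= 2 * E / `|y| -> norm1 z3 <= 2 * E / `|y| ->
    norm1 z1 + (norm1 z2 + norm1 z3) <= (4 / delta + 4) * E / `|y|.
  move=> b1 b2 b3.
  have -> : (4 / delta + 4) * E / `|y| =
    4 / delta * E / `|y| + (2 * E / `|y| + 2 * E / `|y|) by ring.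
  by apply: lerD => //; exact: lerD.
have nh : `|delta * N| = delta * N by rewrite gtr0_norm.
have [yp|yp] : 0 < y \/ y < 0 by case: (ltgtP y 0) yn0 => //; [right|left].
- have [|||||r0' vb] := key (- (delta * N)) 0; rewrite ?normrN ?nh ?normr0//; try nra.
  have E1 : cintegral `[N / 2, 3 * N / 2] (fun u => W u%:C) =
     cintegral `[N / 2, 3 * N / 2] (fun u => W (u +i* - (delta * N))) +
     (0 +i* 1) * (cintegral `[- (delta * N), 0] (fun v => W ((3 * N / 2) +i* v)) -
                  cintegral `[- (delta * N), 0] (fun v => W ((N / 2) +i* v))).
    by apply/eqP; rewrite eq_sym -subr_eq0 addrAC; apply/eqP.
  rewrite E1; apply: le_trans (norm1D _ _) _; rewrite i1.
  apply: (@le_trans _ _ _ _ _ (lerD (lexx _) (norm1B _ _))).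
  apply: tot; [|by apply: vb; right|by apply: vb; left].
  by apply: hor; rewrite ?normrN ?nh// gtr0_norm//; ring.
- have [|||||r0' vb] := key 0 (delta * N); rewrite ?nh ?normr0//; try nra.
  have E1 : cintegral `[N / 2, 3 * N / 2] (fun u => W u%:C) =
     cintegral `[N / 2, 3 * N / 2] (fun u => W (u +i* (delta * N))) -
     (0 +i* 1) * (cintegral `[0, delta * N] (fun v => W ((3 * N / 2) +i* v)) -
                  cintegral `[0, delta * N] (fun v => W ((N / 2) +i* v))).
    by apply/eqP; rewrite -subr_eq0 opprD opprK addrA; apply/eqP.
  rewrite E1; apply: le_trans (norm1B _ _) _; rewrite i1.
  apply: (@le_trans _ _ _ _ _ (lerD (lexx _) (norm1B _ _))).
  apply: tot; [|by apply: vb; right|by apply: vb; left].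
  by apply: hor; rewrite ?nh// ltr0_norm//; ring.
Qed.

Lemma norm1_pkernel_bottom x y : 2 * expR (2 * pi * y) <= 1 / 2 ->
  norm1 (pkernel (x +i* y)) <= 4.
Proof.
move=> ey.
have pb : norm1 (pexp (x +i* y)) <= 2 * expR (2 * pi * y).
  by rewrite /pexp; apply: le_trans (norm1_cexp _) _; rewrite /= mul0r sub0r mulNr opprK.
have key : 1 / 2 <= norm1 (1 - pexp (x +i* y)).
  rewrite -[norm1 (1 - _)]norm1N opprB.
  have := norm1_subr_ge 1 (pexp (x +i* y)).
  rewrite (_ : norm1 (1 : R[i]) = 1) ?norm1_real ?normr1//; lra.
have ne : 1 - pexp (x +i* y) != 0 by rewrite -norm1_gt0; lra.
apply: le_trans (norm1V ne) _.
rewrite ler_pdivrMr; lra.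
Qed.

(** On vertical lines through half-integers [pexp] is real and negative: the kernel has no pole
    there, and its decay for y > 0 compensates the growth of the packet. *)
Lemma norm1_pkernel_side (n : nat) y :
  norm1 (pkernel ((n%:R - 1 / 2) +i* y)) = (1 + expR (2 * pi * y))^-1.
Proof.
have -> : (n%:R - 1 / 2) +i* y = (- (1 / 2)) +i* y + n%:R.
  rewrite -(rmorph_nat (real_complex R)).
  by apply: complex_ext; rewrite /= ?addr0// addrC.
rewrite pkernelDn /pkernel pexpE.
have -> : 2 * pi * - (1 / 2) = - pi :> R by field.
rewrite cosN sinN cospi sinpi oppr0 mulr0 oppr0 mulrN1.
have -> : 1 - (- expR (2 * pi * y) +i* 0) = (1 + expR (2 * pi * y))%:C.
  by apply: complex_ext; rewrite /= ?opprK ?subr0.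
by rewrite -fmorphV norm1_real gtr0_norm// invr_gt0.
Qed.

(** N is odd so that N/2 and 3N/2 are half-integers. On the lower side the packet decays, with y >=
    r, and the kernel is bounded; on the upper side the packet grows but the kernel leaves exp(-(2
    pi - y) delta N), with 2 pi - y >= r. The integrand is at most 8E on the four sides, whose total
    length is at most 4N, whence 32. *)
Lemma circle_estimate r delta eta (l : nat) T s y (N := (l.*2.+1)%:R : R) :
  admissible r delta eta N T -> 3 <= 2 * pi * (delta * N) ->
  0 <= s <= T -> r <= y <= 2 * pi - r ->
  norm1 (\sum_(i < l.*2.+1) wave s N y (l.+1 + i)%:R%:C) <=
  32 * norm1 (pconst^-1 : R[i]) * (N * expR (- (delta * r / 8) * N)).
Proof.
move=> adm dN sT /andP[ry yr]; have [/andP[r0 r1] /andP[d0 d1] e1 N0 _] := adm.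
have h0 : 0 < delta * N by rewrite mulr_gt0.
have p2 := pi_ge2 R.
have EN : N = l%:R + l%:R + 1 by rewrite /N -addn1 natrD -addnn natrD.
have Ea : l.+1%:R - 1 / 2 = N / 2 :> R by rewrite EN -natr1; field.
have Eb : l.+1%:R + l.*2.+1%:R - 1 / 2 = 3 * N / 2 :> R.
  by rewrite -/N EN -natr1; field.
have Eb' : (l.+1 + l.*2.+1)%:R - 1 / 2 = 3 * N / 2 :> R by rewrite natrD.
have ab : N / 2 <= 3 * N / 2 by lra.
pose W := wave s N y; pose E := expR (- (delta * r / 8) * N).
have Wh : holo_rect W (N / 2) (3 * N / 2) (- (delta * N)) (delta * N).
  by move=> u v uN vN; apply: admissible_holo adm _ _ uN _; rewrite ler_norml.
have := @sum_residues R W l.+1 l.*2.+1 (delta * N) h0.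
rewrite Ea Eb => /(_ Wh) S.
have -> : \sum_(i < l.*2.+1) wave s N y (l.+1 + i)%:R%:C =
    pconst^-1 * rect (fun z => W z * pkernel z) (N / 2) (3 * N / 2) (- (delta * N)) (delta * N).
  by rewrite S mulrC mulfK ?pconst_neq0.
apply: le_trans (norm1M _ _) _.
rewrite [32 * _]mulrC -[leRHS]mulrA ler_wpM2l ?norm1_ge0//.
set P := rect _ _ _ _ _.
have yh v (vE : `|v| = delta * N) : v != 0 by rewrite -normr_gt0 vE.
have Ph v : `|v| = delta * N ->
    pathcont (fun u => W (u +i* v) * pkernel (u +i* v)) (N / 2) (3 * N / 2).
  move=> vE; apply: (@rcont_h _ (fun z => W z * pkernel z) _ _ v v);
    first by rewrite lexx.
  move=> u v' uN /andP[v1 v2].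
  have -> : v' = v by apply/eqP; rewrite eq_le v2 v1.
  apply: holo_contat; apply: holoM; last exact/holo_pkernel/pexp_neq1_im/yh.
  by apply: admissible_holo adm _ _ uN _; rewrite vE.
have side (n : nat) : n%:R - 1 / 2 = N / 2 \/ n%:R - 1 / 2 = 3 * N / 2 ->
    pathcont (fun v => W ((n%:R - 1 / 2) +i* v) * pkernel ((n%:R - 1 / 2) +i* v))
      (- (delta * N)) (delta * N) /\
    forall v, - (delta * N) <= v <= delta * N ->
      norm1 (W ((n%:R - 1 / 2) +i* v) * pkernel ((n%:R - 1 / 2) +i* v)) <= 8 * E.
  move=> nN; have nN' : N / 2 <= n%:R - 1 / 2 <= 3 * N / 2.
    by case: nN => ->; apply/andP; split; lra.
  split.
    apply: (@rcont_v _ (fun z => W z * pkernel z) (n%:R - 1 / 2) (n%:R - 1 / 2));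
      first by rewrite lexx.
    move=> u v /andP[u1 u2] vN.
    have -> : u = n%:R - 1 / 2 by apply/eqP; rewrite eq_le u2 u1.
    apply: holo_contat; apply: holoM; first exact: Wh.
    apply: holo_pkernel.
    have -> : (n%:R - 1 / 2) +i* v = (- (1 / 2)) +i* v + n%:R.
      rewrite -(rmorph_nat (real_complex R)).
      by apply: complex_ext; rewrite /= ?addr0// addrC.
    rewrite pexpDn; apply: pexp_neq1; first by rewrite normrN ger0_norm//; lra.
    by apply/eqP => -[/eqP]; rewrite oppr_eq0 gt_eqF//; lra.
  move=> v vN; apply: le_trans (norm1M _ _) _; rewrite norm1_pkernel_side.
  have := wave_vertical y adm sT nN (ltac:(by rewrite ler_norml) : `|v| <= delta * N).
  rewrite -/W expRD -/E => Wb.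
  have ev := expR_gt0 (2 * pi * v).
  rewrite ler_pdivrMr; last by lra.
  apply: le_trans Wb _; rewrite mulrA [8 * E]mulrC -mulrA.
  have E0 : 0 < E by exact: expR_gt0.
  (* Since 0 < y < 2 pi, the exponential is at most 1 for v <= 0 and at most exp(2 pi v) for v >
     0. *)
  suff : expR (y * v) <= 1 + expR (2 * pi * v) by move=> ?; nra.
  case: (leP v 0) => v0.
    have : expR (y * v) <= 1 by rewrite expR_le1; nra.
    lra.
  have : expR (y * v) <= expR (2 * pi * v) by rewrite ler_expR; nra.
  lra.
(* From exp(t) >= 1 + t with t >= 3, which is what the hypothesis on delta N is for: it keeps [pexp]
   away from 1 on both horizontal sides. *)
have e7 : expR (- (2 * pi * (delta * N))) <= 1 / 4.
  rewrite expRN (_ : 1 / 4 = 4^-1); last by rewrite div1r.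
  rewrite lef_pV2 ?posrE ?expR_gt0//.
  by apply: le_trans (expR_ge1Dx _); lra.
have nh : `|delta * N| = delta * N by rewrite gtr0_norm.
have nhN : `|- (delta * N)| = delta * N by rewrite normrN.
have bot u : N / 2 <= u <= 3 * N / 2 ->
    norm1 (W (u +i* - (delta * N)) * pkernel (u +i* - (delta * N))) <= 8 * E.
  move=> uN; apply: le_trans (norm1M _ _) _.
  have -> : 8 * E = 2 * (E * expR (- 0)) * 4 by rewrite oppr0 expR0; ring.
  apply: ler_pM; rewrite ?norm1_ge0//.
    apply: wave_horizontal adm sT uN nhN _; rewrite add0r mulrN opprK.
    by have := ler_wpM2r (ltW h0) ry; have := mulr_gt0 h0 r0; lra.
  by apply: norm1_pkernel_bottom; rewrite mulrN; lra.
have top u : N / 2 <= u <= 3 * N / 2 ->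
    norm1 (W (u +i* (delta * N)) * pkernel (u +i* (delta * N))) <= 8 * E.
  move=> uN; apply: le_trans (norm1M _ _) _.
  pose X := expR (2 * pi * (delta * N)).
  have X4 : 4 <= X by apply: le_trans (expR_ge1Dx _); lra.
  (* Here the surplus k of [wave_horizontal] is -2 pi delta N: a growth by X, repaid by the bound
     4/X on the kernel. *)
  have -> : 8 * E = 2 * (E * expR (- - (2 * pi * (delta * N)))) * (4 / X).
    by rewrite opprK -/X; field; rewrite gt_eqF//; lra.
  apply: ler_pM; rewrite ?norm1_ge0//.
    apply: wave_horizontal adm sT uN nh _.
    by have := ler_wpM2r (ltW h0) yr; have := mulr_gt0 h0 r0; lra.
  apply: le_trans (norm1_pkernel_top u _ (lexx X)) _; first by lra.
  rewrite ler_pdivrMr; last by lra.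
  rewrite mulrAC ler_pdivlMr; lra.
have [sa1 sa2] := side l.+1 (or_introl Ea).
have [sb1 sb2] := side (l.+1 + l.*2.+1)%N (or_intror Eb').
rewrite Ea in sa1 sa2; rewrite Eb' in sb1 sb2.
have vv : - (delta * N) <= delta * N by lra.
apply: le_trans (norm1_rect (M := 8 * E) ab vv _ _ _) _.
- by split => //; exact: Ph.
- by move=> u uN; split; [exact: bot|exact: top].
- by move=> v vN; split; [exact: sa2|exact: sb2].
have E0 : 0 < E by exact: expR_gt0.
have : 3 * N / 2 - N / 2 + (delta * N - - (delta * N)) <= 2 * N by nra.
rewrite -/E; nra.
Qed.

End WavePackets.

(** * Admissible parameters in the cone *)

Section ConeAdmissible.
Set Implicit Arguments.
Unset Strict Implicit.
Context {R : realType}.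
Local Notation Re := complex.Re.
Local Notation Im := complex.Im.

(** The bound delta <= 1/(4K) keeps |v| <= delta N below u/K, as u >= N/2. In the band |z| <= 2N, so
    the smallness of rho is used with eta/(2T): then s Re(rho) is at most T (eta/(2T)) 2N = eta
    N. *)
Lemma cone_admissible (K : R) (rho : R[i] -> R[i]) (r T : R) : 0 < K ->
  holomorphic_on (cone K) rho -> little_o_norm_on (cone K) rho ->
  0 < r <= 1 -> 0 < T ->
  exists delta eta N0 : R, [/\ 0 < delta, 1 <= delta * N0 &
    forall N, N0 <= N -> N / 2 > K /\ admissible rho r delta eta N T].
Proof.
move=> K0 hol rho_o r01 T0; have /andP[r0 r1] := r01.
pose delta := Num.min (r / 4) (1 / (4 * K)).
have [d0 d1 d2] : [/\ 0 < delta, delta <= r / 4 & delta <= 1 / (4 * K)].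
  by rewrite /delta lt_min !divr_gt0 ?mulr_gt0// !ge_min !lexx orbT.
clearbody delta; pose eta := delta * r / 8.
have eta0 : 0 < eta by rewrite divr_gt0// mulr_gt0.
have e0 : 0 < eta / (2 * T) by rewrite divr_gt0// mulr_gt0.
have [M HM] := rho_o _ e0.
(* The terms ensure N/2 > K, then |z| >= N/2 > M, and finally delta N >= 1. *)
exists delta, eta, (2 * K + 2 * `|M| + 2 + 1 / delta).
have id0 : 0 < 1 / delta by rewrite divr_gt0.
have M0 := normr_ge0 M.
split=> //.
  have -> : delta * (2 * K + 2 * `|M| + 2 + 1 / delta) =
    delta * (2 * K + 2 * `|M| + 2) + 1 by field; rewrite gt_eqF.
  by rewrite lerDr mulr_ge0 ?ltW//; lra.
move=> N NN; split; first by lra.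
split=> //.
- by rewrite d0.
- by lra.
move=> u v /andP[u1 u2] vN.
have NK : 2 * K < N by lra.
have zc : cone K (u +i* v).
  split=> /=; first by lra.
  apply: le_lt_trans vN _.
  apply: (@le_lt_trans _ _ (1 / (4 * K) * N)); first by rewrite ler_pM2r//; lra.
  have -> : 1 / (4 * K) * N = K^-1 * (N / 4) by field; rewrite gt_eqF.
  by rewrite ltr_pM2l ?invr_gt0//; lra.
split; first exact: hol.
move=> s /andP[s0 sT].
have zM : M%:C < `|u +i* v|.
  apply: (@lt_le_trans _ _ (`|u|)%:C).
    rewrite ltcR; apply: le_lt_trans (ler_norm M) _.
    by apply: lt_le_trans (ler_norm u); lra.
  exact: (normc_ge_Re (u +i* v)).
have := HM _ zc zM.
have vv : `|v| <= N / 2.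
  by apply: le_trans vN _; nra.
have -> : `|rho (u +i* v)| = (Normc.normc (rho (u +i* v)))%:C by [].
have -> : `|u +i* v| = (Normc.normc (u +i* v))%:C by [].
rewrite -[eta / _]/(eta / (2 * T)) -rmorphM lecR => H.
have RN : Re (rho (u +i* v)) <= Normc.normc (rho (u +i* v)).
  apply: le_trans (ler_norm _) _; rewrite -lecR.
  exact: (normc_ge_Re (rho (u +i* v))).
have n2 : Normc.normc (u +i* v) <= 2 * N.
  have := le_abs_norm1 (u +i* v).
  have -> : `|u +i* v| = (Normc.normc (u +i* v))%:C by [].
  rewrite lecR /norm1 /= => /le_trans; apply.
  by rewrite (ger0_norm (_ : 0 <= u)); lra.
have rb : Re (rho (u +i* v)) <= eta / T * N.
  apply: le_trans RN _; apply: le_trans H _.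
  have -> : eta / T * N = eta / (2 * T) * (2 * N) by field; rewrite gt_eqF.
  by rewrite ler_pM2l.
have [p|p] := leP 0 (Re (rho (u +i* v))).
  apply: (@le_trans _ _ (T * (eta / T * N))); first by apply: ler_pM.
  by rewrite le_eqVlt; apply/orP; left; apply/eqP; field; rewrite gt_eqF.
apply: (@le_trans _ _ 0); first by rewrite mulr_ge0_le0// ltW.
by rewrite mulr_ge0 ?ltW//; lra.
Qed.

End ConeAdmissible.

(** * Square integrable functions and Fubini on rectangles *)

Section RectangleFubini.
Set Implicit Arguments.
Unset Strict Implicit.
Context {R : realType}.
Implicit Types (A B D : set R).
Local Notation mu := (@lebesgue_measure R).
Local Notation mu2 := (@lebesgue_measure R \x @lebesgue_measure R)%E.
Local Notation Re := complex.Re.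
Local Notation Im := complex.Im.

(* The library's hint does not apply to the sigma-algebra carried by
   [lebesgue_measure]. *)
#[global] Instance lebesgue_ae_filter : Filter (nbhs (almost_everywhere mu)).
Proof. exact: (ae_filter_ringOfSetsType mu). Qed.

Lemma fubini_F_patch A B (h : R * R -> \bar R) :
  fubini_F mu (h \_ (A `*` B)) =
  (fun x => \int[mu]_(y in B) h (x, y))%E \_ A.
Proof.
apply/funext => x; rewrite /fubini_F patchE; case: ifPn => xA.
  rewrite [RHS]integral_mkcond; apply: eq_integral => y _.
  rewrite !patchE; congr (if _ then _ else _).
  by apply/idP/idP => /set_mem => [[_ /mem_set]//|yB]; apply/mem_set; split=> //; exact/set_mem.
rewrite -[RHS](integral0 mu setT); apply: eq_integral => y _.
rewrite patchE; case: ifPn => // /set_mem [/mem_set].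
by rewrite (negbTE xA).
Qed.

Lemma fubini_G_patch A B (h : R * R -> \bar R) :
  fubini_G mu (h \_ (A `*` B)) =
  (fun y => \int[mu]_(x in A) h (x, y))%E \_ B.
Proof.
apply/funext => y; rewrite /fubini_G patchE; case: ifPn => yB.
  rewrite [RHS]integral_mkcond; apply: eq_integral => x _.
  rewrite !patchE; congr (if _ then _ else _).
  by apply/idP/idP => /set_mem => [[/mem_set]//|xA]; apply/mem_set; split=> //; exact/set_mem.
rewrite -[RHS](integral0 mu setT); apply: eq_integral => x _.
rewrite patchE; case: ifPn => // /set_mem [_ /mem_set].
by rewrite (negbTE yB).
Qed.

Section Tonelli.
Variables (A B : set R) (h : R * R -> \bar R).
Hypotheses (mA : measurable A) (mB : measurable B).
Hypothesis mh : measurable_fun (A `*` B) h.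
Hypothesis h0 : forall x y, A x -> B y -> (0 <= h (x, y))%E.

Let mAB : measurable (A `*` B). Proof. exact: measurableX. Qed.

Let mph : measurable_fun setT (h \_ (A `*` B)).
Proof. exact/(measurable_restrictT _ _).1. Qed.

Let ph0 z : (0 <= (h \_ (A `*` B)) z)%E.
Proof.
by rewrite patchE; case: ifPn => // /set_mem; case: z => x y /= [? ?]; exact: h0.
Qed.

Lemma tonelli_measurable_x :
  measurable_fun A (fun x => \int[mu]_(y in B) h (x, y))%E.
Proof.
apply/(measurable_restrictT _ _).2 => //; rewrite -fubini_F_patch.
exact: measurable_fun_fubini_tonelli_F.
Qed.

Lemma tonelli_rect_x : (\int[mu2]_(z in A `*` B) h z =
  \int[mu]_(x in A) \int[mu]_(y in B) h (x, y))%E.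
Proof.
rewrite integral_mkcond fubini_tonelli1// [RHS]integral_mkcond.
by apply: eq_integral => x _; rewrite -fubini_F_patch.
Qed.

End Tonelli.

Section RealFubini.
Variables (A B : set R) (g : R * R -> R).
Hypotheses (mA : measurable A) (mB : measurable B).
Hypothesis ig : mu2.-integrable (A `*` B) (fun z => (g z)%:E).

Let mAB : measurable (A `*` B). Proof. exact: measurableX. Qed.

Let iph : mu2.-integrable setT ((fun z => (g z)%:E) \_ (A `*` B)).
Proof. exact/(integrable_mkcond _ _).1. Qed.

Lemma integrable_esection_x : mu.-integrable A (fun x => \int[mu]_(y in B) (g (x, y))%:E)%E.
Proof.
apply/(integrable_mkcond _ _).2 => //.
suff : mu.-integrable setT (fubini_F mu ((fun z => (g z)%:E) \_ (A `*` B))).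
  by rewrite fubini_F_patch.
exact: (integrable_fubini_F iph).
Qed.

(** [fine] sends both infinities to 0, so the real inner integral can differ from the extended one
    only where the latter is infinite, a null set by integrability. *)
Let fine_ix x : ((\int[mu]_(y in B) g (x, y))%:E =
   if (\int[mu]_(y in B) (g (x, y))%:E)%E \is a fin_num then
     \int[mu]_(y in B) (g (x, y))%:E else 0)%E.
Proof.
rewrite /Rintegral; case: ifPn; first by move/fineK.
by rewrite fin_numEn => /orP[] /eqP ->.
Qed.

Let ae_ix : {ae mu, forall x, A x -> (\int[mu]_(y in B) (g (x, y))%:E)%E =
  (\int[mu]_(y in B) g (x, y))%:E}.
Proof.
have : {ae mu, forall x, A x -> (\int[mu]_(y in B) (g (x, y))%:E)%E \is a fin_num}.
  exact: integrable_ae integrable_esection_x.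
by apply: filterS => x /= H Ax; rewrite fine_ix (H Ax).
Qed.

Let m_ix : measurable_fun A (fun x => (\int[mu]_(y in B) g (x, y))%:E).
Proof.
apply/measurable_EFinP; rewrite /Rintegral.
by apply: (measurableT_comp (f := fine)) => //; exact: measurable_int integrable_esection_x.
Qed.

Lemma integrable_section_x : mu.-integrable A (fun x => (\int[mu]_(y in B) g (x, y))%:E).
Proof.
move/integrableP : integrable_esection_x => [mi fi]; apply/integrableP; split=> //.
apply: le_lt_trans fi; apply: ae_ge0_le_integral => //.
- exact: measurableT_comp.
- exact: measurableT_comp.
- by move: ae_ix; apply: filterS => x H Ax; rewrite H.
Qed.

Lemma Rfubini_x : \int[mu2]_(z in A `*` B) g z =
  \int[mu]_(x in A) \int[mu]_(y in B) g (x, y).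
Proof.
rewrite /Rintegral; congr fine.
rewrite integral_mkcond -(integral12_prod_meas1 iph).
transitivity (\int[mu]_(x in A) \int[mu]_(y in B) (g (x, y))%:E)%E.
  rewrite [RHS]integral_mkcond; apply: eq_integral => x _.
  by have /= <- := fubini_F_patch A B (fun z => (g z)%:E).
by apply: ae_eq_integral => //; exact: measurable_int integrable_esection_x.
Qed.

Lemma integrable_esection_y : mu.-integrable B (fun y => \int[mu]_(x in A) (g (x, y))%:E)%E.
Proof.
apply/(integrable_mkcond _ _).2 => //.
suff : mu.-integrable setT (fubini_G mu ((fun z => (g z)%:E) \_ (A `*` B))).
  by rewrite fubini_G_patch.
have mph := measurable_int _ iph.
apply/integrableP; split; first exact: (measurable_fubini_G iph).
have H := (integrable21ltyP mu mu mph).1 iph.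
apply: le_lt_trans H; apply: ge0_le_integral => //.
- by apply: measurableT_comp => //; exact: (measurable_fubini_G iph).
- apply: (measurable_fun_fubini_tonelli_G (abse \o _)).
    exact: measurableT_comp.
  by move=> z; exact: abse_ge0.
- move=> y _; apply: le_abse_integral => //.
  exact: measurable_fun_pair1.
Qed.

Let fine_iy y : ((\int[mu]_(x in A) g (x, y))%:E =
   if (\int[mu]_(x in A) (g (x, y))%:E)%E \is a fin_num then
     \int[mu]_(x in A) (g (x, y))%:E else 0)%E.
Proof.
rewrite /Rintegral; case: ifPn; first by move/fineK.
by rewrite fin_numEn => /orP[] /eqP ->.
Qed.

Let ae_iy : {ae mu, forall y, B y -> (\int[mu]_(x in A) (g (x, y))%:E)%E =
  (\int[mu]_(x in A) g (x, y))%:E}.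
Proof.
have : {ae mu, forall y, B y -> (\int[mu]_(x in A) (g (x, y))%:E)%E \is a fin_num}.
  exact: integrable_ae integrable_esection_y.
by apply: filterS => x /= H Ax; rewrite fine_iy (H Ax).
Qed.

Let m_iy : measurable_fun B (fun y => (\int[mu]_(x in A) g (x, y))%:E).
Proof.
apply/measurable_EFinP; rewrite /Rintegral.
by apply: (measurableT_comp (f := fine)) => //; exact: measurable_int integrable_esection_y.
Qed.

Lemma integrable_section_y : mu.-integrable B (fun y => (\int[mu]_(x in A) g (x, y))%:E).
Proof.
move/integrableP : integrable_esection_y => [mi fi]; apply/integrableP; split=> //.
apply: le_lt_trans fi; apply: ae_ge0_le_integral => //.
- exact: measurableT_comp.
- exact: measurableT_comp.
- by move: ae_iy; apply: filterS => x H Ax; rewrite H.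
Qed.

Lemma Rfubini_y : \int[mu2]_(z in A `*` B) g z =
  \int[mu]_(y in B) \int[mu]_(x in A) g (x, y).
Proof.
rewrite /Rintegral; congr fine.
rewrite integral_mkcond -(integral21_prod_meas1 iph).
transitivity (\int[mu]_(y in B) \int[mu]_(x in A) (g (x, y))%:E)%E.
  rewrite [RHS]integral_mkcond; apply: eq_integral => x _.
  by have /= <- := fubini_G_patch A B (fun z => (g z)%:E).
by apply: ae_eq_integral => //; exact: measurable_int integrable_esection_y.
Qed.

End RealFubini.

End RectangleFubini.

(** * Square-integrable functions of one and two variables *)

Section SquareIntegrable.
Set Implicit Arguments.
Unset Strict Implicit.
Context {R : realType}.
Local Notation mu := (@lebesgue_measure R).
Local Notation mu2 := (@lebesgue_measure R \x @lebesgue_measure R)%E.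
Local Notation Re := complex.Re.
Local Notation Im := complex.Im.

Definition cmeasurable d (T : measurableType d) (D : set T) (f : T -> R[i]) :=
  measurable_fun D (fun x => Re (f x)) /\ measurable_fun D (fun x => Im (f x)).

Lemma cmeasurableM d (T : measurableType d) (D : set T) (f g : T -> R[i]) :
  cmeasurable D f -> cmeasurable D g -> cmeasurable D (fun x => f x * g x).
Proof.
move=> [f1 f2] [g1 g2]; split.
- under eq_fun do rewrite ReM.
  by apply: measurable_funB; exact: measurable_funM.
- under eq_fun do rewrite ImM.
  by apply: measurable_funD; exact: measurable_funM.
Qed.

Lemma measurable_sqrnormc d (T : measurableType d) (D : set T) (f : T -> R[i]) :
  cmeasurable D f -> measurable_fun D (fun x => sqrnormc (f x)).
Proof.
by move=> [f1 f2]; apply: measurable_funD; exact: measurable_funX.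
Qed.

Lemma cmeasurable_comp d d' (T : measurableType d) (T' : measurableType d')
    (D : set T) (E : set T') (p : T -> T') (f : T' -> R[i]) :
  measurable E -> p @` D `<=` E -> measurable_fun D p ->
  cmeasurable E f -> cmeasurable D (fun x => f (p x)).
Proof.
by move=> mE pDE mp [f1 f2]; split;
  [exact: (measurable_comp mE pDE f1 mp)|exact: (measurable_comp mE pDE f2 mp)].
Qed.

Lemma L2_sqr_integrable d (T : measurableType d) (m : {measure set T -> \bar R})
    (D : set T) (f : T -> R[i]) : L2 m D f -> measurable D ->
  m.-integrable D (fun x => (sqrnormc (f x))%:E).
Proof.
move=> [f1 f2 fi] mD; apply/integrableP; split.
  by apply/measurable_EFinP; exact: measurable_sqrnormc.
under eq_integral do rewrite gee0_abs ?lee_fin ?sqrnormc_ge0//.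
exact: fi.
Qed.

Lemma norm1M_le_sqr (z w : R[i]) : norm1 (z * w) <= sqrnormc z + sqrnormc w.
Proof.
apply: le_trans (norm1M _ _) _.
have := norm1_sqr z; have := norm1_sqr w; have := sqr_ge0 (norm1 z - norm1 w).
by rewrite !expr2; lra.
Qed.

(** The arithmetic-geometric inequality with a free weight e. Integrated over a set of finite
    measure, it plays the part of the Cauchy-Schwarz inequality: a suitable e makes the L^1 norm
    small with the L^2 norm. *)
Lemma norm1_le_sqr (z : R[i]) (e : R) : 0 < e ->
  norm1 z <= e + sqrnormc z / e.
Proof.
move=> e0; rewrite -(ler_pM2r e0).
have -> : (e + sqrnormc z / e) * e = e * e + sqrnormc z.
  by field; rewrite gt_eqF.
have := norm1_sqr z; have := sqr_ge0 (norm1 z - e); have := sqr_ge0 e.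
by rewrite !expr2; lra.
Qed.

Lemma cmeasurable_L2 d (T : measurableType d) (m : set T -> \bar R)
  (D : set T) (f : T -> R[i]) : L2 m D f -> cmeasurable D f.
Proof. by case. Qed.

Lemma L2_mul_cintegrable (D : set R) (f g : R -> R[i]) : measurable D ->
  L2 mu D f -> L2 mu D g -> cintegrable D (fun x => f x * g x).
Proof.
move=> mD fL gL.
have [m1 m2] := cmeasurableM (cmeasurable_L2 fL) (cmeasurable_L2 gL).
apply: (le_cintegrable (g := fun x => sqrnormc (f x) + sqrnormc (g x))) => //.
  by move=> x _; exact: norm1M_le_sqr.
under eq_fun do rewrite EFinD.
by apply: integrableD => //; exact: L2_sqr_integrable.
Qed.

Lemma integrable_cst_fin (D : set R) (k : R) : measurable D ->
  (mu D < +oo)%E -> mu.-integrable D (fun=> k%:E).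
Proof.
move=> mD Df; apply/integrableP; split; first exact: measurable_cst.
by rewrite integral_cst//= lte_mul_pinfty// lee_fin.
Qed.

Lemma L2_cintegrable (D : set R) (f : R -> R[i]) : measurable D ->
  (mu D < +oo)%E -> L2 mu D f -> cintegrable D f.
Proof.
move=> mD Df fL; have [m1 m2 _] := fL.
apply: (le_cintegrable (g := fun x => 1 + sqrnormc (f x))) => //.
  by move=> x _; have := norm1_le_sqr (f x) ltr01; rewrite divr1.
under eq_fun do rewrite EFinD.
apply: integrableD => //; last exact: L2_sqr_integrable.
exact: integrable_cst_fin.
Qed.

(* [L2 lebesgue2] integrates with respect to the canonical measurable
   structure of R * R, whereas the product measure is built on the
   (extensionally equal) structure carried by [lebesgue_measure]. *)
Lemma L2_lebesgue2 (D : set (R * R)) (f : R * R -> R[i]) : measurable D ->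
  L2 lebesgue2 D f -> L2 mu2 D f.
Proof.
move=> mD fL; have [f1 f2 fi] := fL; split=> //.
have mid : measurable_fun
    (setT : set (measurableTypeR R * measurableTypeR R)%type)
    (id : _ -> (R * R)%type) by exact: measurable_id.
have <- : (\int[pushforward mu2 (id : _ -> (R * R)%type)]_(z in D)
    (sqrnormc (f z))%:E = \int[mu2]_(z in D) (sqrnormc (f z))%:E)%E; last exact: fi.
apply: (ge0_integral_pushforward mid mu2) => //.
  apply: (measurableT_comp (f := EFin)) => //.
  exact: measurable_sqrnormc (cmeasurable_L2 fL).
by move=> z _; rewrite lee_fin sqrnormc_ge0.
Qed.

Definition cintegrable2 (D : set (R * R)) (f : R * R -> R[i]) :=
  mu2.-integrable D (fun z => (Re (f z))%:E) /\
  mu2.-integrable D (fun z => (Im (f z))%:E).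

Lemma le_cintegrable2 (D : set (R * R)) (f : R * R -> R[i]) (g : R * R -> R) :
  measurable D -> cmeasurable D f -> (forall z, D z -> norm1 (f z) <= g z) ->
  mu2.-integrable D (fun z => (g z)%:E) -> cintegrable2 D f.
Proof.
move=> mD [m1 m2] fg ig; split; apply: le_integrable ig => //;
  try exact/measurable_EFinP.
- move=> z Dz; rewrite /= lee_fin; apply: le_trans (ler_norm _).
  by apply: le_trans (fg _ Dz); rewrite lerDl.
- move=> z Dz; rewrite /= lee_fin; apply: le_trans (ler_norm _).
  by apply: le_trans (fg _ Dz); rewrite lerDr.
Qed.

Section Rectangle.
Variables (A B : set R).
Hypotheses (mA : measurable A) (mB : measurable B).

Lemma cfubini (f : R * R -> R[i]) : cintegrable2 (A `*` B) f ->
  [/\ cintegrable A (fun x => cintegral B (fun y => f (x, y))),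
      cintegrable B (fun y => cintegral A (fun x => f (x, y))) &
      cintegral A (fun x => cintegral B (fun y => f (x, y))) =
      cintegral B (fun y => cintegral A (fun x => f (x, y)))].
Proof.
move=> [i1 i2]; split.
- by split; [exact: (integrable_section_x mA mB i1)|exact: (integrable_section_x mA mB i2)].
- by split; [exact: (integrable_section_y mA mB i1)|exact: (integrable_section_y mA mB i2)].
- by apply: complex_ext;
    [exact: etrans (esym (Rfubini_x mA mB i1)) (Rfubini_y mA mB i1)
    |exact: etrans (esym (Rfubini_x mA mB i2)) (Rfubini_y mA mB i2)].
Qed.

Lemma integrable_snd (h : R -> R) : (mu A < +oo)%E ->
  mu.-integrable B (fun y => (h y)%:E) ->
  mu2.-integrable (A `*` B) (fun z => (h z.2)%:E).
Proof.
move=> Af /integrableP[mh ih].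
have mAB : measurable (A `*` B) by exact: measurableX.
have m2 : measurable_fun (A `*` B) (fun z : R * R => (h z.2)%:E).
  apply: (measurable_comp mB _ mh (f := fun y => (h y)%:E)) => //.
    by move=> _ [z [_ Bz] <-].
  exact: measurable_funTS.
apply/integrableP; split=> //.
rewrite (tonelli_rect_x mA mB (h := fun z => `|(h z.2)%:E|%E))//.
  have i0 : (0 <= \int[mu]_(y in B) `|(h y)%:E|)%E by exact: integral_ge0.
  rewrite (_ : (\int[mu]_(x in A) _ = \int[mu]_(x in A)
    cst (\int[mu]_(y in B) `|(h y)%:E|) x)%E)//.
  rewrite integral_cst//; apply: lte_mul_pinfty => //.
  by rewrite ge0_fin_numE.
exact: measurableT_comp.
Qed.

Lemma L2_mul_cintegrable2 (f : R -> R -> R[i]) (g : R -> R[i]) :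
  (mu A < +oo)%E -> L2 mu2 (A `*` B) (fun z => f z.1 z.2) -> L2 mu B g ->
  cintegrable2 (A `*` B) (fun z => f z.1 z.2 * g z.2).
Proof.
move=> Af fL gL; have mAB : measurable (A `*` B) by exact: measurableX.
have mg2 : cmeasurable (A `*` B) (fun z : R * R => g z.2).
  apply: cmeasurable_comp mB _ _ (cmeasurable_L2 gL).
    by move=> _ [z [_ Bz] <-].
  exact: measurable_funTS.
apply: (le_cintegrable2 (g := fun z => sqrnormc (f z.1 z.2) + sqrnormc (g z.2))) => //.
- exact: cmeasurableM (cmeasurable_L2 fL) mg2.
- by move=> z _; exact: norm1M_le_sqr.
- under eq_fun do rewrite EFinD.
  apply: integrableD => //; first exact: L2_sqr_integrable.
  apply: (integrable_snd (h := fun y => sqrnormc (g y))) => //.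
  exact: L2_sqr_integrable.
Qed.

Lemma cmeasurable_section (f : R * R -> R[i]) (y : R) : B y ->
  cmeasurable (A `*` B) f -> cmeasurable A (fun x => f (x, y)).
Proof.
move=> By; have mAB : measurable (A `*` B) by exact: measurableX.
apply: (@cmeasurable_comp _ _ _ _ A (A `*` B) (fun x : R => (x, y)) f) => //.
  by move=> _ [x Ax <-].
by apply: measurable_funTS; exact: measurable_pair2.
Qed.

Lemma L2_sections (f : R -> R -> R[i]) :
  L2 mu2 (A `*` B) (fun z => f z.1 z.2) ->
  {ae mu, forall y, B y -> L2 mu A (f^~ y)}.
Proof.
move=> fL; have mAB : measurable (A `*` B) by exact: measurableX.
have mf := cmeasurable_L2 fL.
have ms := measurable_sqrnormc mf.
have ig := L2_sqr_integrable fL mAB.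
have : {ae mu, forall y, B y ->
    (\int[mu]_(x in A) (sqrnormc (f x y))%:E)%E \is a fin_num}.
  exact: integrable_ae (integrable_esection_y mA mB ig).
 apply: filterS => y /= H By.
have [m1 m2] := cmeasurable_section By mf.
split=> //; rewrite -ge0_fin_numE ?H//.
by apply: integral_ge0 => x _; rewrite lee_fin sqrnormc_ge0.
Qed.

End Rectangle.

End SquareIntegrable.

(** * Duality *)

Section Duality.
Set Implicit Arguments.
Unset Strict Implicit.
Context {R : realType}.
Local Notation mu := (@lebesgue_measure R).
Local Notation mu2 := (@lebesgue_measure R \x @lebesgue_measure R)%E.
Local Notation Re := complex.Re.
Local Notation Im := complex.Im.

Lemma cintegrable_cmeasurable (D : set R) (f : R -> R[i]) :
  cintegrable D f -> cmeasurable D f.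
Proof.
move=> [/measurable_int m1 /measurable_int m2].
by split; apply/measurable_EFinP.
Qed.

Lemma ae_eq_cintegral (D : set R) (f g : R -> R[i]) : measurable D ->
  cmeasurable D f -> cmeasurable D g ->
  {ae mu, forall x, D x -> f x = g x} -> cintegral D f = cintegral D g.
Proof.
move=> mD [f1 f2] [g1 g2] fg; congr (_ +i* _); congr fine;
  (apply: ae_eq_integral => //; first exact/measurable_EFinP;
    first exact/measurable_EFinP);
  by apply: filterS fg => x fgx Dx; rewrite fgx.
Qed.

Lemma EFin_Rintegral d (S : measurableType d) (m : {measure set S -> \bar R})
    (D : set S) (g : S -> R) :
  m.-integrable D (fun x => (g x)%:E) -> measurable D ->
  (\int[m]_(x in D) g x)%:E = (\int[m]_(x in D) (g x)%:E)%E.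
Proof. by move=> ig mD; rewrite fineK//; exact: integrable_fin_num. Qed.

Lemma measurable_domain (Omega : ambient) : measurable (domain Omega : set R).
Proof. by case: Omega => /=; [exact: measurableT|exact: measurable_itv]. Qed.

Lemma cmeasurable_section_x (A B : set R) (f : R * R -> R[i]) (x : R) :
  measurable A -> measurable B -> A x ->
  cmeasurable (A `*` B) f -> cmeasurable B (fun y => f (x, y)).
Proof.
move=> mA mB Ax; have mAB : measurable (A `*` B) by exact: measurableX.
apply: (@cmeasurable_comp _ _ _ _ _ B (A `*` B) (fun y : R => (x, y)) f) => //.
  by move=> _ [y By <-].
by apply: measurable_funTS; exact: measurable_pair1.
Qed.

Lemma semigroup_L2 (Omega : ambient) (rho : R[i] -> R[i]) (t : R)
    (f g : R -> R[i]) : semigroup Omega rho t f g ->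
  L2 mu (domain Omega) f /\ L2 mu (domain Omega) g.
Proof.
case: Omega => /=; last by case.
by move=> [fh [gh [[? _ _] [? _ _] _]]].
Qed.

(** C is chosen before [kappa] and [eps]: it depends on the control of f0 and on the weight w alone.
    The weight, 1 on the circle, has to decay on the line, where constants are not
    square-integrable. *)
Lemma duality (Omega : ambient) (rho : R[i] -> R[i]) (omega : set R) (T : R)
    (f0 : R -> R[i]) (w : R -> R) : 0 <= T -> measurable omega ->
  null_controllable Omega rho omega T ->
  L2 mu (domain Omega) f0 ->
  measurable_fun (omega `&` domain Omega) w ->
  (\int[mu]_(x in omega `&` domain Omega) (w x ^+ 2)%:E < +oo)%E ->
  exists C : R, forall (kappa : R -> R -> R[i]) (eps : R), 0 <= eps ->
    L2 mu (domain Omega) (kappa T) ->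
    (forall s f g, 0 <= s <= T -> semigroup Omega rho (T - s) f g ->
      cintegrable (domain Omega) (fun x => f x * kappa s x) /\
      cintegral (domain Omega) (fun x => g x * kappa T x) =
      cintegral (domain Omega) (fun x => f x * kappa s x)) ->
    (forall s x, 0 <= s <= T -> omega x -> domain Omega x ->
      norm1 (kappa s x) <= eps * w x) ->
    norm1 (cintegral (domain Omega) (fun x => f0 x * kappa 0 x)) <= eps * C.
Proof.
move=> T0 momega nc f0L mw wfin.
set D := domain Omega in f0L mw wfin *; set E := omega `&` D in mw wfin *.
have mD : measurable D by exact: measurable_domain.
have mE : measurable E by exact: measurableI.
pose I0T : set R := [set` `[0, T]]; have mI : measurable I0T by exact: measurable_itv.
have If : (mu I0T < +oo)%E.
  by rewrite lebesgue_measure_itv /=; case: ifPn => _; rewrite -?EFinB ltry.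
have [u [uL [f [mild fT0]]]] := nc f0 f0L.
have TT : 0 <= T <= T by rewrite T0 lexx.
have [fL [a [b [sg_a bL sg_b fab]]]] := mild T TT.
have {}bL : L2 mu2 (I0T `*` D) (fun z => b z.1 z.2).
  by apply: L2_lebesgue2 bL; exact: measurableX.
have {}uL : L2 mu2 (I0T `*` E) (fun z => u z.1 z.2).
  by apply: L2_lebesgue2 uL; exact: measurableX.
have mIE : measurable (I0T `*` E) by exact: measurableX.
(* A majorant of [norm1] of u times w, hence, up to the factor [eps], of the product of u and
   [kappa] on omega; its integral is C. *)
pose h (z : R * R) : R := 2 * sqrnormc (u z.1 z.2) + w z.2 ^+ 2.
have h0 z : 0 <= h z by rewrite addr_ge0 ?sqr_ge0// mulr_ge0// sqrnormc_ge0.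
have iw : mu.-integrable E (fun x => (w x ^+ 2)%:E).
  apply/integrableP; split; first by apply/measurable_EFinP; exact: measurable_funX.
  by under eq_integral do rewrite gee0_abs ?lee_fin ?sqr_ge0//.
have ih : mu2.-integrable (I0T `*` E) (fun z => (h z)%:E).
  rewrite /h; under eq_fun do rewrite EFinD EFinM.
  apply: integrableD => //.
    by apply: integrableZl => //; exact: L2_sqr_integrable uL mIE.
  exact: (integrable_snd mI mE (h := fun x => w x ^+ 2)).
exists (\int[mu2]_(z in I0T `*` E) h z) => kappa eps eps0 kL adj kw.
pose k := kappa T.
(* The time integral in a mild solution is taken pointwise in x, while the adjoint relation needs
   the pairing in x at fixed s: Fubini's theorem links [chi] and [Phi]. *)
pose Phi s := cintegral D (fun x => b s x * k x).
pose chi x := cintegral I0T (fun s => b s x * k x).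
have [cA cI fub] : [/\ cintegrable I0T Phi, cintegrable D chi &
    cintegral I0T Phi = cintegral D chi].
  exact: (cfubini mI mD (L2_mul_cintegrable2 mI mD If bL kL)).
have sg_a' : semigroup Omega rho (T - 0) f0 a by rewrite subr0.
have [_ <-] := adj 0 f0 a ltac:(by rewrite lexx T0) sg_a'.
have -> : cintegral D (fun x => a x * k x) = - cintegral I0T Phi.
  rewrite fub -(cintegralN mD cI); apply: (ae_eq_cintegral mD).
  - have [_ aL] := semigroup_L2 sg_a.
    exact: cmeasurableM (cmeasurable_L2 aL) (cmeasurable_L2 kL).
  - exact: cintegrable_cmeasurable (cintegrableN mD cI).
  (* As f(T) vanishes, a(x) is minus the time integral of b; almost every section of b is
     square-integrable, hence integrable on [0, T], so k(x) can enter the integral. *)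
  - have sec := L2_sections mI mD bL.
    apply: filterS3 fT0 fab sec => x H1 H2 H3 Dx.
    have bi : cintegrable I0T (b^~ x) by exact: L2_cintegrable mI If (H3 Dx).
    have : a x + cintegral I0T (b^~ x) = 0 by exact: etrans (esym (H2 Dx)) (H1 Dx).
    move=> /eqP; rewrite addr_eq0 => /eqP ->.
    rewrite mulNr mulrC -(cintegralZ _ mI bi); congr (- _).
    by apply: eq_cintegral => s _; rewrite mulrC.
rewrite norm1N; apply: le_trans (le_norm1_cintegral mI cA) _.
have iPhi := cintegrable_norm1 mI cA.
rewrite -lee_fin (EFin_Rintegral iPhi mI).
(* Kept with extended real values, as the integral over E may be infinite for exceptional s. *)
pose Psi s := (\int[mu]_(x in E) (eps * h (s, x))%:E)%E.
have meh : measurable_fun (I0T `*` E) (fun z : R * R => (eps * h z)%:E).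
  have mh : measurable_fun (I0T `*` E) h.
    by apply/measurable_EFinP; exact: measurable_int ih.
  by apply/measurable_EFinP; apply: measurable_funM.
have -> : (eps * \int[mu2]_(z in I0T `*` E) h z)%:E = (\int[mu]_(s in I0T) Psi s)%E.
  rewrite -(tonelli_rect_x mI mE meh).
    have -> : (\int[mu2]_(z in I0T `*` E) (eps * h z)%:E =
        eps%:E * \int[mu2]_(z in I0T `*` E) (h z)%:E)%E.
      by rewrite -(integralZl _ ih eps); [|exact: mIE].
    by rewrite EFinM (EFin_Rintegral ih mIE).
  by move=> x y _ _; rewrite lee_fin mulr_ge0.
have mPsi : measurable_fun I0T Psi.
  apply: (tonelli_measurable_x mI mE meh).
  by move=> x y _ _; rewrite lee_fin mulr_ge0.
apply: ae_ge0_le_integral; [exact: mI| | | |exact: mPsi|].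
- by move=> s _; rewrite lee_fin norm1_ge0.
- exact: measurable_int iPhi.
- by move=> s _; apply: integral_ge0 => x _; rewrite lee_fin mulr_ge0.
apply: filterS sg_b => s sg Is.
have sT : 0 <= s <= T by move: Is; rewrite /I0T /= in_itv.
have [vi Phis] := adj s _ _ sT (sg sT).
rewrite -/(Phi s) /Phi Phis.
apply: (@le_trans _ _ (\int[mu]_(x in D) (norm1 ((\1_omega x)%:C * u s x * kappa s x))%:E)%E).
  rewrite -(EFin_Rintegral (cintegrable_norm1 mD vi) mD).
  by rewrite lee_fin; exact: le_norm1_cintegral mD vi.
have ms : measurable_fun E (fun x => (eps * h (s, x))%:E).
  have mu' := cmeasurable_section_x mI mE Is (cmeasurable_L2 uL).
  apply/measurable_EFinP; apply: measurable_funM; first exact: measurable_cst.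
  apply: measurable_funD; last exact: measurable_funX.
  apply: measurable_funM; first exact: measurable_cst.
  exact: measurable_sqrnormc mu'.
rewrite /Psi /E integral_mkcondl.
apply: ge0_le_integral; first exact: mD.
- by move=> x _; rewrite lee_fin norm1_ge0.
- exact: measurable_int (cintegrable_norm1 mD vi).
- apply: (iffLR (measurable_restrict _ momega mD)).
  by rewrite [D `&` omega]setIC; exact: ms.
move=> x Dx; rewrite patchE; case: ifPn => xo.
  rewrite indicE xo lee_fin mul1r; apply: le_trans (norm1M _ _) _.
  have wo := kw _ _ sT (set_mem xo) Dx.
  have n0 := norm1_ge0 (u s x).
  apply: (@le_trans _ _ (norm1 (u s x) * (eps * w x))); first exact: ler_wpM2l.
  rewrite mulrCA; apply: ler_wpM2l; first exact: eps0.
  rewrite /h /=.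
  have := norm1_sqr (u s x); have := sqr_ge0 (norm1 (u s x) - w x).
  by have := sqr_ge0 (norm1 (u s x)); have := sqr_ge0 (w x); rewrite !expr2; lra.
by rewrite indicE (negbTE xo) !mul0r norm10.
Qed.

End Duality.

(** * Testing the Fourier transform *)

Section FourierTest.
Set Implicit Arguments.
Unset Strict Implicit.
Context {R : realType}.
Local Notation mu := (@lebesgue_measure R).
Local Notation mu2 := (@lebesgue_measure R \x @lebesgue_measure R)%E.
Local Notation Re := complex.Re.
Local Notation Im := complex.Im.

Lemma Rintegral_truncation (g : R -> R) (e : R) : 0 < e ->
  mu.-integrable setT (fun x => (g x)%:E) ->
  exists N, forall n, (N <= n)%N ->
    `|\int[mu]_(x in setT) g x - \int[mu]_(x in `[- n%:R, n%:R]) g x| <= e.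
Proof.
move=> e0 ig.
pose I n : set R := [set` `[- n%:R, n%:R]].
have mI n : measurable (I n) by exact: measurable_itv.
have mg : measurable_fun setT (fun x => (g x)%:E) := measurable_int _ ig.
have [|||||_ _] := @dominated_convergence _ _ R mu setT measurableT
  (fun n => (fun x => (g x)%:E) \_ (I n)) (fun x => (g x)%:E)
  (fun x => `|(g x)%:E|%E).
- move=> n; apply: (iffLR (measurable_restrictT _ (mI n))).
  exact: (@measurable_funTS _ _ _ _ (I n) _ mg).
- exact: mg.
- apply: aeW => x _; apply: cvg_near_cst; near=> n.
  rewrite patchE ifT// inE /I /= in_itv /= -ler_norml.
  near: n; exact: nbhs_infty_ger.
- exact: integrable_abse.
- apply: aeW => x n _; rewrite patchE; case: ifPn => // _.
  by rewrite abse0.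
rewrite -(EFin_Rintegral ig measurableT) => /fine_cvgP [_ /cvgrPdist_le /(_ _ e0) [N _ HN]].
exists N => n /HN /=; rewrite /Rintegral -integral_mkcond.
exact.
Unshelve. all: by end_near. Qed.

Lemma cintegral_truncation (g : R -> R[i]) (e : R) : 0 < e ->
  cintegrable setT g -> exists N, forall n, (N <= n)%N ->
    norm1 (cintegral setT g - cintegral `[- n%:R, n%:R] g) <= e.
Proof.
move=> e0 [i1 i2]; have e2 : 0 < e / 2 by rewrite divr_gt0.
have [N1 H1] := Rintegral_truncation e2 i1.
have [N2 H2] := Rintegral_truncation e2 i2.
exists (maxn N1 N2) => n; rewrite geq_max => /andP[/H1 h1 /H2 h2].
by rewrite /norm1 !ReImE /cintegral /=; lra.
Qed.

Lemma cmeasurable_cexp_prod :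
  @cmeasurable R _ _ setT (fun z : measurableTypeR R * measurableTypeR R =>
    cexp (0 -i* (z.2 * z.1))).
Proof.
have mz : measurable_fun setT
    (fun z : measurableTypeR R * measurableTypeR R => - (z.2 * z.1) : R).
  apply: measurableT_comp => //.
  by apply: measurable_funM; [exact: measurable_snd|exact: measurable_fst].
split => /=.
- apply: measurable_funM; first exact: measurable_cst.
  apply: (measurableT_comp (f := @cos R)) => //.
  by apply: continuous_measurable_fun; exact: continuous_cos.
- apply: measurable_funM; first exact: measurable_cst.
  apply: (measurableT_comp (f := @sin R)) => //.
  by apply: continuous_measurable_fun; exact: continuous_sin.
Qed.

Lemma norm1_cexp_im (x : R) : norm1 (cexp (0 -i* x)) <= 2.
Proof. by apply: le_trans (norm1_cexp _) _; rewrite /= expR0 mulr1. Qed.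

Lemma pathcont_bounded (f : R -> R[i]) (a b : R) : a <= b -> pathcont f a b ->
  exists2 M : R, 0 < M & forall t, a <= t <= b -> norm1 (f t) <= M.
Proof.
move=> ab /pathcont_within [c1 c2].
have bd (h : R -> R) : {within `[a, b], continuous h} ->
    exists M : R, forall t, a <= t <= b -> `|h t| <= M.
  move=> hc.
  have hc' : {within `[a, b], continuous (fun t => `|h t|)}.
    by move=> t; apply: continuous_comp; [exact: hc|exact: norm_continuous].
  have [c _ cP] := EVT_max ab hc'.
  by exists (`|h c|) => t tab; apply: cP; rewrite in_itv.
have [M1 H1] := bd _ c1; have [M2 H2] := bd _ c2.
exists (`|M1| + `|M2| + 1); first by rewrite ltr_wpDl// addr_ge0.
move=> t tab; rewrite /norm1.
have := H1 t tab; have := H2 t tab; have := ler_norm M1; have := ler_norm M2.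
lra.
Qed.

Lemma pathcontM (f g : R -> R[i]) (a b : R) : a <= b -> pathcont f a b ->
  pathcont g a b -> pathcont (fun t => f t * g t) a b.
Proof.
move=> ab fc gc t tab eps eps0.
have [k k0 [k1 k2]] : exists2 k : R, 0 < k & norm1 (f t) <= k /\ norm1 (g t) <= k.
  exists (norm1 (f t) + norm1 (g t) + 1).
    by rewrite ltr_wpDl// addr_ge0 ?norm1_ge0.
  by have := norm1_ge0 (f t); have := norm1_ge0 (g t); split; lra.
pose e := Num.min 1 (eps / (2 * k + 1)).
have [e0 e1 e2] : [/\ 0 < e, e <= 1 & e * (2 * k + 1) <= eps].
  split; rewrite /e ?lt_min ?ltr01 ?divr_gt0 ?ge_min ?lexx//=; first lra.
  by rewrite -ler_pdivlMr ?ge_min ?lexx ?orbT//; lra.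
clearbody e.
have [d1 d10 D1] := fc t tab _ e0; have [d2 d20 D2] := gc t tab _ e0.
exists (Num.min d1 d2); first by rewrite lt_min d10.
move=> s; rewrite lt_min => /andP[/D1 s1 /D2 s2].
have -> : f s * g s - f t * g t =
  (f s - f t) * (g s - g t) + ((f s - f t) * g t + f t * (g s - g t)) by ring.
apply: le_trans (norm1D _ _) _.
apply: le_trans (lerD (norm1M _ _) (norm1D _ _)) _.
have := norm1M (f s - f t) (g t); have := norm1M (f t) (g s - g t).
have := norm1_ge0 (f s - f t); have := norm1_ge0 (g s - g t).
have := norm1_ge0 (f t); have := norm1_ge0 (g t).
move: (norm1 (f s - f t)) (norm1 (g s - g t)) s1 s2 => p q s1 s2.
move: (norm1 (f t)) (norm1 (g t)) k1 k2 => F G k1 k2 G0 F0 q0 p0 h1 h2.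
have : p * q <= e * 1 by apply: ler_pM => //; exact: le_trans s2 e1.
have : p * G <= e * k by apply: ler_pM.
have : F * q <= k * e by apply: ler_pM.
lra.
Qed.

Lemma pathcont_phase (x a b : R) : pathcont (fun xi => cexp (0 -i* (x * xi))) a b.
Proof.
move=> t _ eps eps0.
have hl : holo (fun z => cexp ((0 -i* x) * z)) (t%:C).
  apply: holo_comp; last exact: holo_cexp.
  by apply: holoM; [exact: holo_cst|exact: holo_id].
have [d d0 dP] := holo_contat hl eps0.
exists d => // s st.
have E u : 0 -i* (x * u) = (0 -i* x) * u%:C by apply: complex_ext => /=; ring.
rewrite !E (_ : s%:C = t%:C + (s - t)%:C); last by rewrite -rmorphD addrC subrK.
by apply: dP; rewrite norm1_real.
Qed.

Section Test.
Variables (a b : R) (eta : R -> R[i]).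
Hypotheses (ab : a <= b) (eta_cont : pathcont eta a b).

Definition eta_hat (x : R) : R[i] :=
  cintegral `[a, b] (fun xi => eta xi * cexp (0 -i* (x * xi))).

Let J : set R := [set` `[a, b]].
Let mJ : measurable J. Proof. exact: measurable_itv. Qed.
Let muJ : (mu J < +oo)%E.
Proof. by rewrite lebesgue_measure_itv /=; case: ifPn => _; rewrite -?EFinB ltry. Qed.

Let eta_meas : cmeasurable J eta.
Proof. exact: cintegrable_cmeasurable (pathcont_cintegrable eta_cont). Qed.

Variables (f : R -> R[i]).
Hypothesis fL : L2 mu setT f.

Section Truncated.
Variable n : nat.
Let I : set R := [set` `[- n%:R, n%:R]].
Let mI : measurable I. Proof. exact: measurable_itv. Qed.
Let muI : (mu I < +oo)%E.
Proof. by rewrite lebesgue_measure_itv /=; case: ifPn => _; rewrite -?EFinB ltry. Qed.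

Definition truncated_fourier (xi : R) : R[i] :=
  cintegral `[- n%:R, n%:R] (fun x => f x * cexp (0 -i* (x * xi))).

Let fLI : L2 mu I f.
Proof.
case: fL => f1 f2 fi; split; [exact: measurable_funTS|exact: measurable_funTS|].
apply: le_lt_trans fi; apply: ge0_subset_integral; [exact: mI|exact: measurableT| | |].
- by apply/measurable_EFinP; apply: measurable_sqrnormc; split.
- by move=> x _; rewrite lee_fin sqrnormc_ge0.
- by [].
Qed.

Let f_int : cintegrable I f.
Proof. exact: L2_cintegrable mI muI fLI. Qed.

Let mJI : measurable (J `*` I). Proof. exact: measurableX. Qed.

Lemma cintegrable2_kernel (g : R -> R[i]) : pathcont g a b ->
  cintegrable2 (J `*` I) (fun z => f z.2 * (g z.1 * cexp (0 -i* (z.2 * z.1)))).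
Proof.
move=> gc; have [M M0 gM] := pathcont_bounded ab gc.
have gm : cmeasurable J g := cintegrable_cmeasurable (pathcont_cintegrable gc).
have m1 : cmeasurable (J `*` I) (fun z : R * R => g z.1).
  apply: (cmeasurable_comp mJ _ _ gm); first by move=> _ [z [Jz _] <-].
  exact: measurable_funTS.
have m2 : cmeasurable (J `*` I) (fun z : R * R => f z.2).
  apply: (cmeasurable_comp mI _ _ (cmeasurable_L2 fLI)).
    by move=> _ [z [_ Iz] <-].
  exact: measurable_funTS.
have m3 : cmeasurable (J `*` I) (fun z : R * R => cexp (0 -i* (z.2 * z.1))).
  by have [e1 e2] := cmeasurable_cexp_prod; split; apply: measurable_funTS.
apply: (le_cintegrable2 (g := fun z => M * 2 * norm1 (f z.2))).
- exact: mJI.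
- exact: cmeasurableM m2 (cmeasurableM m1 m3).
- move=> z [Jz _]; apply: le_trans (norm1M _ _) _; rewrite mulrC.
  apply: ler_wpM2r; first exact: norm1_ge0.
  apply: le_trans (norm1M _ _) _; apply: ler_pM; rewrite ?norm1_ge0//.
    by apply: gM; move: Jz; rewrite /J /= in_itv.
  exact: norm1_cexp_im.
- under eq_fun do rewrite EFinM.
  apply: integrableZl; first exact: mJI.
  exact: (integrable_snd mJ mI (h := fun x => norm1 (f x)) muJ (cintegrable_norm1 mI f_int)).
Qed.

(** The multiplication formula for the truncated transform, by Fubini's theorem on a bounded
    rectangle. With g = 1 it also gives the integrability of that transform on [a, b]. *)
Lemma truncated_fubini (g : R -> R[i]) : pathcont g a b ->
  cintegrable J (fun xi => truncated_fourier xi * g xi) /\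
  cintegral J (fun xi => truncated_fourier xi * g xi) =
  cintegral I (fun x => f x *
    cintegral `[a, b] (fun xi => g xi * cexp (0 -i* (x * xi)))).
Proof.
move=> gc.
have [c1 _ c3] : [/\ cintegrable J (fun xi => cintegral I
      (fun x => f x * (g xi * cexp (0 -i* (x * xi))))),
    cintegrable I (fun x => cintegral J
      (fun xi => f x * (g xi * cexp (0 -i* (x * xi))))) &
    cintegral J (fun xi => cintegral I
      (fun x => f x * (g xi * cexp (0 -i* (x * xi))))) =
    cintegral I (fun x => cintegral J
      (fun xi => f x * (g xi * cexp (0 -i* (x * xi)))))].
  exact: (cfubini mJ mI (cintegrable2_kernel gc)).
have phase_int xi : cintegrable I (fun x => f x * cexp (0 -i* (x * xi))).
  apply: (le_cintegrable (g := fun x => 2 * norm1 (f x))); first exact: mI.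
  - have [m1 _] := cmeasurableM (cmeasurable_L2 fLI)
      (cintegrable_cmeasurable (pathcont_cintegrable (@pathcont_phase xi (- n%:R) n%:R))).
    by under eq_fun do rewrite [X in 0 -i* X]mulrC.
  - have [_ m2] := cmeasurableM (cmeasurable_L2 fLI)
      (cintegrable_cmeasurable (pathcont_cintegrable (@pathcont_phase xi (- n%:R) n%:R))).
    by under eq_fun do rewrite [X in 0 -i* X]mulrC.
  - move=> x _; apply: le_trans (norm1M _ _) _; rewrite mulrC.
    by apply: ler_wpM2r; [exact: norm1_ge0|exact: norm1_cexp_im].
  - under eq_fun do rewrite EFinM.
    by apply: integrableZl; [exact: mI|exact: cintegrable_norm1 mI f_int].
have E1 xi : cintegral I (fun x => f x * (g xi * cexp (0 -i* (x * xi)))) =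
    truncated_fourier xi * g xi.
  rewrite mulrC -(cintegralZ _ mI (phase_int xi)).
  by apply: eq_cintegral => x _; ring.
have E2 x : cintegral J (fun xi => f x * (g xi * cexp (0 -i* (x * xi)))) =
    f x * cintegral `[a, b] (fun xi => g xi * cexp (0 -i* (x * xi))).
  apply: (cintegralZ _ mJ); apply: pathcont_cintegrable.
  exact: pathcontM ab gc (@pathcont_phase x a b).
split.
  by apply: (eq_cintegrable mJ _ c1) => xi _; exact: E1.
transitivity (cintegral J (fun xi => cintegral I (fun x => f x * (g xi * cexp (0 -i* (x * xi)))))).
  by apply: eq_cintegral => xi _; rewrite E1.
by rewrite c3; apply: eq_cintegral => x _; exact: E2.
Qed.

End Truncated.

End Test.

Lemma truncated_fourier_measurable (f : R -> R[i]) (n : nat) : L2 mu setT f ->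
  cmeasurable setT (truncated_fourier f n).
Proof.
move=> fL; pose J (m : nat) : set R := [set` `[- m%:R, m%:R]].
have JT : \bigcup_m J m = setT.
  apply/seteqP; split=> // x _; exists (Num.bound `|x|) => //.
  rewrite /J /= in_itv /= -ler_norml ltW//; exact: archi_boundP.
have mJ m : measurable (J m) by exact: measurable_itv.
have FJ m : cmeasurable (J m) (truncated_fourier f n).
  have ab : - m%:R <= m%:R :> R by rewrite (le_trans _ (ler0n _ m))// oppr_le0.
  (* The constant 1 as an affine function: Fubini's theorem then yields measurability on each
     interval of an exhaustion of the line. *)
  have one : pathcont (fun t : R => 1 + 0 * t%:C : R[i]) (- m%:R) m%:R.
    exact: pathcont_affine.
  have [i1 _] := truncated_fubini ab fL n one.
  apply: cintegrable_cmeasurable; apply: (eq_cintegrable (mJ m) _ i1) => xi _.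
  by rewrite mul0r addr0 mulr1.
by rewrite -JT; split; apply/(measurable_fun_bigcup _ mJ) => m; case: (FJ m).
Qed.

Section Formula.
Variables (a b : R) (eta : R -> R[i]).
Hypotheses (ab : a <= b) (eta_cont : pathcont eta a b).
Variables (f fhat : R -> R[i]).
Hypothesis fL : L2 mu setT f.
Hypothesis ffhat : is_fourier_transform f fhat.
Hypothesis etahatL : L2 mu setT (eta_hat a b eta).

Let J : set R := [set` `[a, b]].
Let mJ : measurable J. Proof. exact: measurable_itv. Qed.
Let muJ : (mu J < +oo)%E.
Proof. by rewrite lebesgue_measure_itv /=; case: ifPn => _; rewrite -?EFinB ltry. Qed.
Let eta_meas : cmeasurable J eta.
Proof. exact: cintegrable_cmeasurable (pathcont_cintegrable eta_cont). Qed.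

(* No Plancherel theorem: the multiplication formula survives the L^2 limit
   defining the Fourier transform because [eta] is bounded with compact
   support and [eta_hat] is square integrable. *)
Lemma fourier_test :
  cintegrable J (fun xi => fhat xi * eta xi) /\
  cintegral J (fun xi => fhat xi * eta xi) =
  cintegral setT (fun x => f x * eta_hat a b eta x).
Proof.
have [M M0 etaM] := pathcont_bounded ab eta_cont.
have [_ fhL lim] := ffhat.
have fhJ : L2 mu J fhat.
  case: fhL => f1 f2 fi; split; [exact: measurable_funTS|exact: measurable_funTS|].
  apply: le_lt_trans fi; apply: ge0_subset_integral; [exact: mJ|exact: measurableT| | |].
  - by apply/measurable_EFinP; apply: measurable_sqrnormc; split.
  - by move=> x _; rewrite lee_fin sqrnormc_ge0.
  - by [].
have fh_int : cintegrable J fhat := L2_cintegrable mJ muJ fhJ.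
have mulM (g : R -> R[i]) : cintegrable J g -> cintegrable J (fun xi => g xi * eta xi).
  move=> gi; have [m1 m2] := cmeasurableM (cintegrable_cmeasurable gi) eta_meas.
  apply: (le_cintegrable (g := fun x => M * norm1 (g x))); [exact: mJ|exact: m1|exact: m2| |].
    move=> x Jx; apply: le_trans (norm1M _ _) _; rewrite mulrC.
    apply: ler_wpM2r; first exact: norm1_ge0.
    by apply: etaM; move: Jx; rewrite /J /= in_itv.
  under eq_fun do rewrite EFinM.
  by apply: integrableZl; [exact: mJ|exact: cintegrable_norm1 mJ gi].
have fe_int := L2_mul_cintegrable measurableT fL etahatL.
split; first exact: mulM.
apply/eqP; rewrite -subr_eq0; apply/eqP; apply: norm1_eq0; apply/eqP.
rewrite eq_le norm1_ge0 andbT; apply/ler_addgt0Pr => e e0; rewrite add0r.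
have [N1 H1] := cintegral_truncation (divr_gt0 e0 (ltr0n _ 2)) fe_int.
pose L := b - a + 1.
have L0 : 0 < L by rewrite ltr_wpDl// subr_ge0.
(* If the squared L^2 error is at most d^2, [norm1_le_sqr] with weight d bounds the L^1 error on
   [a, b] by d (b - a) + d = d L, and M d L = e/2. *)
pose d := e / (2 * M * L).
have d0 : 0 < d by rewrite divr_gt0// !mulr_gt0.
have [N2 _ H2] : \forall n \near \oo, (\int[mu]_(xi in setT)
    (sqrnormc (truncated_fourier f n xi - fhat xi))%:E <= (d ^+ 2)%:E)%E.
  have /fine_cvgP [Hf /cvgrPdist_le Hl] := lim.
  have d2 : 0 < d ^+ 2 by rewrite exprn_gt0.
  near=> n.
  have hf : (\int[mu]_(xi in setT)
    (sqrnormc (truncated_fourier f n xi - fhat xi))%:E)%E \is a fin_num.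
    by near: n; exact: Hf.
  rewrite -(fineK hf) lee_fin.
  have : `|0 - fine (\int[mu]_(xi in setT)
    (sqrnormc (truncated_fourier f n xi - fhat xi))%:E)%E| <= d ^+ 2.
    by near: n; exact: Hl.
  by rewrite sub0r normrN; apply: le_trans; exact: ler_norm.
pose n := maxn N1 N2.
have {}H1 := H1 n (leq_maxl _ _); have {}H2 := H2 n (leq_maxr _ _).
have [Fe_int Fe] := truncated_fubini ab fL n eta_cont.
have FT := truncated_fourier_measurable n fL.
have F_int : cintegrable J (truncated_fourier f n).
  have one : pathcont (fun t : R => 1 + 0 * t%:C : R[i]) a b by exact: pathcont_affine.
  have [i1 _] := truncated_fubini ab fL n one.
  by apply: (eq_cintegrable mJ _ i1) => xi _; rewrite mul0r addr0 mulr1.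
set A := cintegral J _; set B := cintegral setT _.
have -> : A - B = - (cintegral J (fun xi => truncated_fourier f n xi * eta xi) - A)
   - (B - cintegral J (fun xi => truncated_fourier f n xi * eta xi)) by ring.
apply: le_trans (norm1B _ _) _; rewrite norm1N.
suff key : norm1 (cintegral J (fun xi => truncated_fourier f n xi * eta xi) - A) <= e / 2.
  by have := lerD key (H1 : norm1 (B - _) <= _); rewrite -Fe => /le_trans; apply; lra.
rewrite /A -(cintegralB mJ Fe_int (mulM _ fh_int)).
have D_int : cintegrable J (fun xi => truncated_fourier f n xi - fhat xi).
  exact: cintegrableB mJ F_int fh_int.
rewrite (eq_cintegral (g := fun xi => (truncated_fourier f n xi - fhat xi) * eta xi));
  last by move=> xi _; rewrite mulrBl.
apply: le_trans (le_norm1_cintegral mJ (mulM _ D_int)) _.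
have iD := cintegrable_norm1 mJ D_int.
apply: (@le_trans _ _ (\int[mu]_(xi in J) (M * norm1 (truncated_fourier f n xi - fhat xi)))).
  apply: le_Rintegral; [exact: mJ|exact: cintegrable_norm1 mJ (mulM _ D_int)| |].
    by rewrite /comp; under eq_fun do rewrite EFinM; apply: integrableZl; [exact: mJ|exact: iD].
  move=> x Jx; apply: le_trans (norm1M _ _) _; rewrite mulrC.
  apply: ler_wpM2r; first exact: norm1_ge0.
  by apply: etaM; move: Jx; rewrite /J /= in_itv.
rewrite RintegralZl; [|exact: mJ|exact: iD].
suff : \int[mu]_(xi in J) norm1 (truncated_fourier f n xi - fhat xi) <= d * L.
  have -> : e / 2 = M * (d * L) by rewrite /d; field; rewrite !gt_eqF.
  by rewrite ler_pM2l.
rewrite -lee_fin (EFin_Rintegral iD mJ).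
apply: (@le_trans _ _ (\int[mu]_(xi in J) (d%:E + d^-1%:E * (sqrnormc (truncated_fourier f n xi - fhat xi))%:E))%E).
  have [mD1 mD2] := cintegrable_cmeasurable D_int.
  have ms : measurable_fun J (fun xi => (sqrnormc (truncated_fourier f n xi - fhat xi))%:E).
    by apply/measurable_EFinP; apply: measurable_sqrnormc.
  apply: ge0_le_integral; first exact: mJ.
  - by move=> x _; rewrite lee_fin norm1_ge0.
  - exact: measurable_int iD.
  - by apply: emeasurable_funD => //; exact: measurable_funeM.
  - by move=> x _; rewrite -EFinM -EFinD lee_fin mulrC; exact: norm1_le_sqr.
have [mD1 mD2] := cintegrable_cmeasurable D_int.
have ms : measurable_fun J (fun xi => (sqrnormc (truncated_fourier f n xi - fhat xi))%:E).
  by apply/measurable_EFinP; apply: measurable_sqrnormc.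
rewrite ge0_integralD; last 5 first.
- exact: mJ.
- by move=> x _; rewrite lee_fin ltW.
- exact: measurable_cst.
- move=> x _; rewrite -EFinM lee_fin; apply: mulr_ge0; last exact: sqrnormc_ge0.
  by rewrite invr_ge0 ltW.
- exact: measurable_funeM.
rewrite integral_cst; last exact: mJ.
rewrite ge0_integralZl_EFin; last 4 first.
- exact: mJ.
- by move=> x _; rewrite lee_fin sqrnormc_ge0.
- exact: ms.
- by rewrite invr_ge0 ltW.
have -> : (d * L)%:E = (d%:E * (b - a)%:E + d^-1%:E * (d ^+ 2)%:E)%E.
  by rewrite -!EFinM -EFinD; congr (_%:E); rewrite /L; field; rewrite gt_eqF.
apply: leeD.
  rewrite /J /= lebesgue_measure_itv /= lte_fin; move: ab; rewrite le_eqVlt.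
  by case/predU1P => [->|->]; rewrite ?ltxx ?subrr ?mule0 -?EFinB.
apply: lee_wpmul2l; first by rewrite lee_fin invr_ge0 ltW.
apply: le_trans H2; apply: ge0_subset_integral.
- exact: mJ.
- exact: measurableT.
- apply/measurable_EFinP; apply: measurable_sqrnormc.
  case: FT fhL => t1 t2 [h1 h2 _]; split.
  + by under eq_fun do rewrite ReD ReN; exact: measurable_funB.
  + by under eq_fun do rewrite ImD ImN; exact: measurable_funB.
- by move=> x _; rewrite lee_fin sqrnormc_ge0.
- by [].
Unshelve. all: by end_near. Qed.

End Formula.

End FourierTest.

(** * Identities and growth bounds for wave packets *)

Section WaveTests.
Set Implicit Arguments.
Unset Strict Implicit.
Context {R : realType}.
Local Notation mu := (@lebesgue_measure R).
Local Notation Re := complex.Re.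
Local Notation Im := complex.Im.
Variable rho : R[i] -> R[i].

Lemma wave_shift (s N x y xi : R) :
  wave rho s N (x + y) xi%:C = wave rho s N y xi%:C * cexp (0 -i* (x * xi)).
Proof.
rewrite /wave -cexpD; congr cexp.
have -> : 0 -i* (x * xi) = - ((0 +i* x) * xi%:C).
  by apply: complex_ext => /=; ring.
have -> : 0 +i* (x + y) = (0 +i* x) + (0 +i* y).
  by apply: complex_ext => /=; ring.
ring.
Qed.

Lemma wave_time (s t N y : R) (z : R[i]) :
  wave rho (s + t) N y z = cexp (t%:C * rho z) * wave rho s N y z.
Proof. by rewrite /wave -cexpD rmorphD; congr cexp; ring. Qed.

Lemma wave0E (N y xi : R) : wave rho 0 N y xi%:C =
  (expR (- ((xi - N) ^+ 2 / N)))%:C * cexp (0 -i* (y * xi)).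
Proof.
have -> : (expR (- ((xi - N) ^+ 2 / N)))%:C = cexp ((- ((xi - N) ^+ 2 / N))%:C).
  by apply: complex_ext; rewrite /cexp /= ?cos0 ?sin0 ?mulr1 ?mulr0.
rewrite -cexpD /wave; congr cexp; rewrite mul0r.
by apply: complex_ext; rewrite !expr2 !ReImE /=; ring.
Qed.

Lemma cintegral_phase (x0 alpha xi : R) : 0 <= alpha -> xi != 0 ->
  Im (cintegral `[x0, x0 + alpha] (fun x => cexp (0 -i* ((x - x0) * xi)))) =
  - ((1 - cos (alpha * xi)) / xi).
Proof.
move=> a0 xi0.
rewrite /cintegral /=; pose x1 : R := x0 + alpha; rewrite -/x1.
have -> : \int[mu]_(x in `[x0, x1]) (expR 0 * sin (- (((x : R) - x0) * xi))) =
          \int[mu]_(x in `[x0, x1]) (- sin (((x : R) - x0) * xi)).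
  by apply: eq_Rintegral => x _; rewrite expR0 mul1r sinN.
move: a0; rewrite le_eqVlt => /predU1P[a0|a0].
  by rewrite /x1 -a0 addr0 set_itv1 Rintegral_set1 mul0r cos0 subrr mul0r oppr0.
pose F (x : R) : R := cos (((x : R) - x0) * xi) / xi.
have dF (x : R) : is_derive x 1 F (- sin (((x : R) - x0) * xi)).
  rewrite /F; apply: is_derive_eq; rewrite /GRing.scale /=.
  by field.
have cF (x : R) : {for x, continuous F}.
  by apply/differentiable_continuous/derivable1_diffP; exact: ex_derive.
have FTC : (\int[mu]_(x in `[x0, x1]) (- sin (((x : R) - x0) * xi))%:E =
    (F x1)%:E - (F x0)%:E)%E.
  apply: continuous_FTC2; first by rewrite /x1 ltrDl.
  - apply: derivable_within_continuous => x _; exact: ex_derive.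
  - split; first by move=> x _; exact: ex_derive.
    + by apply: cvg_at_right_filter; exact: cF.
    + by apply: cvg_at_left_filter; exact: cF.
  - by move=> x _; rewrite derive1E derive_val.
rewrite /Rintegral FTC /= /F /x1 subrr mul0r cos0 addrAC subrr add0r.
by field.
Qed.

Lemma expR_dominates (B c : R) : 0 < c -> exists N0 : R, forall N, N0 <= N ->
  1 <= N -> B * (N ^+ 2 * expR (- c * N)) < 1 / 4.
Proof.
move=> c0; pose B' := `|B| + 1; have B0 : 0 < B' by rewrite ltr_wpDl.
(* The cubic term of the series, exp(cN) > (cN)^3 / 6, leaves a factor N to spare over N^2; 25
   exceeds 4 times 6. *)
exists (25 * B' / c ^+ 3) => N NN N1.
have N0 : 0 < N by lra.
have cN : 0 < c * N by rewrite mulr_gt0.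
have e3 : (c * N) ^+ 3 / 6 < expR (c * N).
  have := @expR_ge1Dxn R (c * N) 2 (ltW cN).
  have -> : 2.+1`!%:R = 6 :> R by [].
  by lra.
apply: (@le_lt_trans _ _ (B' * (N ^+ 2 * expR (- c * N)))).
  apply: ler_wpM2r; first by apply: mulr_ge0; [exact: sqr_ge0|exact: expR_ge0].
  by rewrite /B'; have := ler_norm B; lra.
rewrite mulNr expRN mulrA ltr_pdivrMr ?expR_gt0//.
apply: (@le_lt_trans _ _ (1 / 4 * ((c * N) ^+ 3 / 6))); last first.
  by rewrite ltr_pM2l.
have c3 : 0 < c ^+ 3 by rewrite exprn_gt0.
move: NN; rewrite ler_pdivrMr// => NN.
have -> : 1 / 4 * ((c * N) ^+ 3 / 6) = (N * c ^+ 3) * N ^+ 2 / 24 by field.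
have N2 : 0 < N ^+ 2 by rewrite exprn_gt0.
have := ler_wpM2r (ltW N2) NN; have := mulr_gt0 B0 N2; lra.
Qed.

Lemma L2_bounded (D : set R) (f : R -> R[i]) (M : R) : measurable D ->
  (mu D < +oo)%E -> cmeasurable D f -> (forall x, D x -> norm1 (f x) <= M) ->
  L2 mu D f.
Proof.
move=> mD Df [m1 m2] fM; split=> //.
apply: (@le_lt_trans _ _ (\int[mu]_(x in D) (M ^+ 2)%:E)%E).
  apply: ge0_le_integral; first exact: mD.
  - by move=> x _; rewrite lee_fin sqrnormc_ge0.
  - by apply/measurable_EFinP; exact: measurable_sqrnormc (conj m1 m2).
  - exact: measurable_cst.
  - move=> x Dx; rewrite lee_fin; apply: le_trans (sqrnormc_norm1 _) _.
    by rewrite !(expr2 _) ler_pM ?norm1_ge0 ?fM.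
rewrite integral_cst; last exact: mD.
by rewrite lte_mul_pinfty// lee_fin sqr_ge0.
Qed.

Lemma cmeasurable_phase (D : set R) (k : R) :
  cmeasurable D (fun x : measurableTypeR R => cexp (0 -i* (x * k))).
Proof.
have mz : measurable_fun setT (fun x : measurableTypeR R => - (x * k) : R).
  by apply: measurableT_comp => //; apply: measurable_funM.
split; apply: measurable_funTS => /=.
- apply: measurable_funM; first exact: measurable_cst.
  apply: (measurableT_comp (f := @cos R)) => //.
  by apply: continuous_measurable_fun; exact: continuous_cos.
- apply: measurable_funM; first exact: measurable_cst.
  apply: (measurableT_comp (f := @sin R)) => //.
  by apply: continuous_measurable_fun; exact: continuous_sin.
Qed.

End WaveTests.

(** * The circle *)

Section Circle.
Set Implicit Arguments.
Unset Strict Implicit.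
Context {R : realType}.
Local Notation mu := (@lebesgue_measure R).
Local Notation Re := complex.Re.
Local Notation Im := complex.Im.
Variable rho : R[i] -> R[i].

Lemma cos_sin_odd_pi (j : nat) :
  cos (j.*2.+1%:R * pi) = -1 :> R /\ sin (j.*2.+1%:R * pi) = 0 :> R.
Proof.
elim: j => [|j [c s]]; first by rewrite mul1r cospi sinpi.
have -> : j.+1.*2.+1%:R * pi = j.*2.+1%:R * pi + pi *+ 2 :> R.
  by rewrite doubleS -[j.*2.+3]addn2 natrD mulrDl [2 * pi]mulr_natl.
by rewrite cosD2pi sinD2pi.
Qed.

Lemma ler_Im_norm1 (z : R[i]) : `|Im z| <= norm1 z.
Proof. by rewrite lerDr. Qed.

Lemma Im_sum (I : Type) (s : seq I) (F : I -> R[i]) :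
  Im (\sum_(i <- s) F i) = \sum_(i <- s) Im (F i).
Proof.
elim: s => [|i s IH]; first by rewrite !big_nil.
by rewrite !big_cons ImD IH.
Qed.

Lemma pathcont_phase_l (k a b : R) : pathcont (fun x => cexp (0 -i* (x * k))) a b.
Proof.
have -> : (fun x => cexp (0 -i* (x * k))) = (fun x => cexp (0 -i* (k * x))).
  by apply/funext => x; rewrite mulrC.
exact: pathcont_phase.
Qed.

Definition window_function (x0 alpha : R) (x : R) : R[i] :=
  (\1_([set` `[x0, x0 + alpha]] : set R) x)%:C.

Lemma window_cmeasurable (D : set R) (x0 alpha : R) :
  cmeasurable D (window_function x0 alpha : measurableTypeR R -> R[i]).
Proof.
split => /=; last exact: measurable_cst.
by apply: measurable_funTS; apply: measurable_indic; exact: measurable_itv.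
Qed.

Lemma window_norm1 (x0 alpha x : R) : norm1 (window_function x0 alpha x) <= 1.
Proof.
rewrite norm1_real indicE; case: (_ \in _); rewrite ?normr1 ?normr0//.
Qed.

Lemma cintegral_indic (D I : set R) (g : R -> R[i]) : I `<=` D ->
  cintegral D (fun x => (\1_I x)%:C * g x) = cintegral I g.
Proof.
move=> ID; have DI : I = D `&` I by apply/esym/setIidr.
rewrite [in RHS]DI; congr (_ +i* _); rewrite Rintegral_mkcondr;
  apply: eq_Rintegral => x _; rewrite patchE indicE;
  by case: (x \in I); rewrite ?mul1r ?mul0r.
Qed.

(** The phase exp(i x0 xi) of [wave] at -x0 translates the interval to [0, alpha], which is what
    gives the imaginary part a fixed sign for xi > 0. *)
Lemma wave0_window (N x0 alpha xi : R) : 0 <= alpha -> xi != 0 ->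
  Im (wave rho 0 N (- x0) xi%:C *
      cintegral `[x0, x0 + alpha] (fun x => cexp (0 -i* (x * xi)))) =
  - (expR (- ((xi - N) ^+ 2 / N)) * ((1 - cos (alpha * xi)) / xi)).
Proof.
move=> a0 xi0; rewrite wave0E -mulrA; set g := expR _.
have ci : cintegrable `[x0, x0 + alpha] (fun x => cexp (0 -i* (x * xi))).
  exact: pathcont_cintegrable (@pathcont_phase_l _ _ _).
rewrite -(cintegralZ _ (measurable_itv _) ci).
have -> : cintegral `[x0, x0 + alpha]
      (fun x => cexp (0 -i* (- x0 * xi)) * cexp (0 -i* (x * xi))) =
    cintegral `[x0, x0 + alpha] (fun x => cexp (0 -i* ((x - x0) * xi))).
  apply: eq_cintegral => x _; rewrite -cexpD; congr cexp.
  by apply: complex_ext => /=; rewrite ?addr0//; ring.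
by rewrite ImM cintegral_phase//= mul0r addr0 mulrN.
Qed.

Section Packets.
Variables (x0 : R) (l : nat).
Let N : R := l.*2.+1%:R.
Local Notation freq i := ((l.+1 + i)%:R : R).

(** As N = 2l + 1, the frequencies l + 1, ..., 3l + 1 are all the integers between N/2 and 3N/2, and
    i = l gives N itself. *)
Definition circle_packet (s x : R) : R[i] :=
  \sum_(i < l.*2.+1) wave rho s N (x - x0) (freq i)%:C.

Let D : set R := domain Circle.
Let mD : measurable D. Proof. exact: measurable_domain. Qed.

Lemma circle_measure : (mu (domain Circle) < +oo)%E.
Proof. by rewrite lebesgue_measure_itv /=; case: ifPn => _; rewrite -?EFinB ltry. Qed.

Lemma circle_packetE (s x : R) : circle_packet s x =
  \sum_(i < l.*2.+1) wave rho s N (- x0) (freq i)%:C * cexp (0 -i* (x * freq i)).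
Proof. by apply: eq_bigr => i _; rewrite wave_shift. Qed.

Lemma phase_L2 (k : R) : L2 mu D (fun x => cexp (0 -i* (x * k))).
Proof.
apply: (L2_bounded (M := 2)); [exact: mD|exact: circle_measure| |].
  exact: cmeasurable_phase.
by move=> x _; exact: norm1_cexp_im.
Qed.

Lemma circle_packet_integral (s : R) (f : R -> R[i]) : L2 mu D f ->
  cintegrable D (fun x => f x * circle_packet s x) /\
  cintegral D (fun x => f x * circle_packet s x) =
  \sum_(i < l.*2.+1) wave rho s N (- x0) (freq i)%:C *
    cintegral D (fun x => f x * cexp (0 -i* (x * freq i))).
Proof.
move=> fL.
have fi (i : 'I_l.*2.+1) : cintegrable D (fun x => f x * cexp (0 -i* (x * freq i))).
  exact: L2_mul_cintegrable mD fL (phase_L2 _).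
have wi (i : 'I_l.*2.+1) : cintegrable D (fun x => wave rho s N (- x0) (freq i)%:C *
    (f x * cexp (0 -i* (x * freq i)))).
  exact: cintegrableZ mD (fi i).
have E : (fun x => f x * circle_packet s x) = (fun x => \sum_(i < l.*2.+1)
    wave rho s N (- x0) (freq i)%:C * (f x * cexp (0 -i* (x * freq i)))).
  apply/funext => x; rewrite circle_packetE mulr_sumr.
  by apply: eq_bigr => i _; rewrite mulrCA.
rewrite E; split; first exact: cintegrable_sum mD wi.
rewrite (cintegral_sum _ mD wi); apply: eq_bigr => i _.
exact: cintegralZ mD (fi i).
Qed.

Lemma circle_packet_L2 (s : R) : L2 mu D (circle_packet s).
Proof.
have one : L2 mu D (fun=> 1).
  apply: (L2_bounded (M := 1)); [exact: mD|exact: circle_measure| |].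
    by split; exact: measurable_cst.
  by move=> x _; rewrite norm1_real normr1.
have [/cintegrable_cmeasurable m _] := circle_packet_integral s one.
apply: (L2_bounded (M := \sum_(i < l.*2.+1) (norm1 (wave rho s N (- x0) (freq i)%:C) * 2)));
  [exact: mD|exact: circle_measure| |].
  by move: m; under eq_fun do rewrite mul1r.
move=> x _; rewrite circle_packetE; apply: le_trans (norm1_sum _ _ _) _.
apply: ler_sum => i _; apply: le_trans (norm1M _ _) _.
by apply: ler_wpM2l; [exact: norm1_ge0|exact: norm1_cexp_im].
Qed.

(** The bilinear pairing with exp(-i n x) reads off the n-th Fourier coefficient, which the
    semigroup multiplies by exp(-(T - s) rho(n)) because n > 0; [wave_time] supplies the inverse
    factor. *)
Lemma circle_adjoint (T s : R) (f g : R -> R[i]) :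
  semigroup Circle rho (T - s) f g ->
  cintegrable D (fun x => f x * circle_packet s x) /\
  cintegral D (fun x => g x * circle_packet T x) =
  cintegral D (fun x => f x * circle_packet s x).
Proof.
move=> [fL gL fg]; have [fi ->] := circle_packet_integral s fL.
have [_ ->] := circle_packet_integral T gL; split=> //.
apply: eq_bigr => i _; set n := (l.+1 + i)%N.
have coefE h : cintegral D (fun x => h x * cexp (0 -i* (x * n%:R))) =
    (2 * pi)%:C * fourier_coef h n%:Z.
  rewrite /fourier_coef mulrA -rmorphM mulfV ?mul1r; last first.
    by rewrite mulf_neq0// gt_eqF// pi_gt0.
  by apply: eq_cintegral => x _; rewrite mulrC [in RHS]mulrC (mulrC x).
rewrite (coefE g) (coefE f) fg.
have -> : T = s + (T - s) by rewrite addrC subrK.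
rewrite wave_time; set A := wave _ _ _ _ _; set c := fourier_coef _ _.
have -> : `|(n%:Z)%:~R| = n%:R :> R by rewrite normr_nat.
have -> : s + (T - s) - s = T - s by ring.
set q := rho _; set t := (T - s)%:C.
have E : cexp (t * q) * cexp (- t * q) = 1.
  by rewrite -cexpD mulNr subrr cexp0.
transitivity (cexp (t * q) * cexp (- t * q) * (A * ((2 * pi)%:C * c))).
  by ring.
by rewrite E mul1r.
Qed.

Lemma wave_period (s y : R) (n : nat) :
  wave rho s N (y + 2 * pi) (n%:R)%:C = wave rho s N y (n%:R)%:C.
Proof.
rewrite addrC wave_shift -[RHS]mulr1; congr (_ * _).
rewrite /cexp /= expR0 cosN sinN !mul1r.
have : cos (2 * pi * n%:R) = 1 :> R /\ sin (2 * pi * n%:R) = 0 :> R.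
  elim: n => [|n [c s']]; first by rewrite mulr0 cos0 sin0.
  have -> : 2 * pi * n.+1%:R = 2 * pi * n%:R + pi *+ 2 :> R.
    by rewrite -[n.+1%:R]natr1 mulrDr mulr1 mulr2n; ring.
  by rewrite cosD2pi sinD2pi.
by move=> [-> ->]; rewrite oppr0.
Qed.

(** All terms have one sign, so the term of frequency N is enough. The shape of l means N = (2p +
    1)(2j + 1): then alpha N is an odd multiple of pi, its cosine is -1 and the term equals 2/N in
    absolute value. *)
Lemma circle_packet_lower (p j : nat) : l = (2 * p * j + p + j)%N ->
  [set` `[x0, x0 + pi / p.*2.+1%:R]] `<=` D ->
  2 / N <= norm1 (cintegral D (fun x =>
    window_function x0 (pi / p.*2.+1%:R) x * circle_packet 0 x)).
Proof.
move=> El ID; set alpha := pi / p.*2.+1%:R in ID *.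
have a0 : 0 <= alpha by rewrite divr_ge0 ?pi_ge0.
have f0L : L2 mu D (window_function x0 alpha).
  apply: (L2_bounded (M := 1)); [exact: mD|exact: circle_measure| |].
    exact: window_cmeasurable.
  by move=> x _; exact: window_norm1.
have [_ ->] := circle_packet_integral 0 f0L.
have N0 : 0 < N by rewrite ltr0n.
pose gauss (xi : R) : R := expR (- ((xi - N) ^+ 2 / N)).
have term (i : 'I_l.*2.+1) : Im (wave rho 0 N (- x0) (freq i)%:C *
     cintegral D (fun x => window_function x0 alpha x * cexp (0 -i* (x * freq i)))) =
   - (gauss (freq i) * ((1 - cos (alpha * freq i)) / freq i)).
  have fn0 : freq i != 0 by rewrite pnatr_eq0 addSn.
  by rewrite cintegral_indic// wave0_window.
apply: le_trans (ler_Im_norm1 _).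
rewrite Im_sum (eq_bigr _ (fun i _ => term i)) sumrN normrN.
apply: le_trans (ler_norm _).
have tpos (i : 'I_l.*2.+1) : 0 <= gauss (freq i) * ((1 - cos (alpha * freq i)) / freq i).
  rewrite mulr_ge0 ?expR_ge0// divr_ge0// subr_ge0; exact: cos_le1.
have ll : (l < l.*2.+1)%N by rewrite ltnS -addnn leq_addr.
rewrite (bigD1 (Ordinal ll))//=.
have EN : (l.+1 + l)%:R = N by rewrite addSn addnn.
rewrite EN /gauss subrr expr0n /= mul0r oppr0 expR0 mul1r.
have -> : cos (alpha * N) = -1.
  have -> : alpha * N = j.*2.+1%:R * pi.
    have -> : N = p.*2.+1%:R * j.*2.+1%:R.
      have dbl k : k.*2.+1%:R = 2 * k%:R + 1 :> R.
        by rewrite -addn1 natrD -muln2 natrM mulrC.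
      by rewrite /N !dbl El !natrD !natrM; ring.
    by rewrite /alpha mulrA divfK ?pnatr_eq0// mulrC.
  by have [] := cos_sin_odd_pi j.
rewrite opprK lerDl; apply: sumr_ge0 => i _; exact: tpos.
Qed.

End Packets.
End Circle.

(** * The contradiction on the circle *)

Section CircleCase.
Set Implicit Arguments.
Unset Strict Implicit.
Context {R : realType}.
Local Notation mu := (@lebesgue_measure R).

Lemma packet_frequency (p : nat) (a b : R) : exists j : nat,
  let N := (2 * p * j + p + j)%N.*2.+1%:R : R in [/\ a <= N, b <= N & 1 <= N].
Proof.
exists (Num.bound (`|a| + `|b|)); set j := Num.bound _; cbv zeta.
have jB : `|a| + `|b| < j%:R by apply: archi_boundP; rewrite addr_ge0.
have jN : j%:R <= (2 * p * j + p + j)%N.*2.+1%:R :> R.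
  rewrite ler_nat; apply: leqW; rewrite -addnn.
  by rewrite addnC -!addnA leq_addr.
have := ler_norm a; have := ler_norm b; have := normr_ge0 a; have := normr_ge0 b.
by split; [lra|lra|rewrite ler1n].
Qed.

Variables (K r T x0 : R) (rho : R[i] -> R[i]) (omega : set R).
Hypotheses (K0 : 0 < K) (hol : holomorphic_on (cone K) rho)
  (rho_o : little_o_norm_on (cone K) rho) (r01 : 0 < r <= 1) (T0 : 0 < T)
  (omega_open : open omega) (gap : forall x, `|x - x0| < r -> ~ omega x).

Let momega : measurable omega. Proof. exact: open_measurable. Qed.

Lemma not_null_controllable_circle : 0 <= x0 < 2 * pi ->
  (forall x, omega (x + 2 * pi) <-> omega x) ->
  ~ null_controllable Circle rho omega T.
Proof.
move=> /andP[x00 x02] per nc; have /andP[r0 r1] := r01.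
have pi0 := pi_gt0 R.
(* Large enough for the interval of length pi / (2p + 1) starting at x0 to end before 2 pi. *)
pose p := Num.bound (pi / (2 * pi - x0)).
have q0 : 0 < p.*2.+1%:R :> R by rewrite ltr0n.
have a2 : x0 + pi / p.*2.+1%:R < 2 * pi.
  have x2 : 0 < 2 * pi - x0 by rewrite subr_gt0.
  rewrite -ltrBrDl ltr_pdivrMr// mulrC -ltr_pdivrMr//.
  apply: (@lt_le_trans _ _ p%:R).
    by apply: archi_boundP; rewrite divr_ge0 ?ltW.
  by rewrite ler_nat; apply: leqW; rewrite -addnn leq_addr.
have ID : [set` `[x0, x0 + pi / p.*2.+1%:R]] `<=` domain Circle.
  move=> x /=; rewrite !in_itv /= => /andP[xx xq].
  by rewrite (le_trans x00 xx) (le_lt_trans xq a2).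
have mD := @measurable_domain R Circle.
have mO : measurable (omega `&` domain Circle) by exact: measurableI.
have f0L : L2 mu (domain Circle) (window_function x0 (pi / p.*2.+1%:R)).
  apply: (L2_bounded (M := 1)); [exact: mD|exact: circle_measure| |].
    exact: window_cmeasurable.
  by move=> x _; exact: window_norm1.
have wi : (\int[mu]_(x in omega `&` domain Circle) ((1 : R) ^+ 2)%:E < +oo)%E.
  rewrite integral_cst; last exact: mO.
  rewrite expr1n mul1e; apply: le_lt_trans circle_measure.
  by apply: le_measure; rewrite ?inE; [exact: mO|exact: mD|exact: subIsetr].
have [C HC] := duality (ltW T0) momega nc f0L (measurable_cst (1 : R)) wi.
have [delta [eta [M [d0 dM HM]]]] := cone_admissible K0 hol rho_o r01 T0.
pose c := delta * r / 8; have c0 : 0 < c by rewrite divr_gt0 ?mulr_gt0.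
pose A := 32 * norm1 (pconst^-1 : R[i]).
have [M' HM'] := expR_dominates (A * C) c0.
have [j [/= NM NM' N1]] := packet_frequency p M M'.
set l := (2 * p * j + p + j)%N in NM NM' N1; set N : R := l.*2.+1%:R in NM NM' N1.
have [_ adm] := HM _ NM.
have dN : 3 <= 2 * pi * (delta * N).
  have : 1 <= delta * N by apply: le_trans dM _; rewrite ler_pM2l.
  have := pi_ge2 R; nra.
have A0 : 0 <= A by rewrite mulr_ge0 ?norm1_ge0.
have N0 : 0 < N by rewrite (lt_le_trans ltr01).
have eps0 : 0 <= A * (N * expR (- c * N)).
  by rewrite mulr_ge0// mulr_ge0 ?expR_ge0 ?ltW.
have := HC (circle_packet rho x0 l) _ eps0 (circle_packet_L2 _ _ _ _).
move=> /(_ (fun s f g _ => @circle_adjoint _ _ _ _ _ _ _ _)).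
move=> lower; move: (circle_packet_lower rho (x0 := x0) (erefl l) ID).
rewrite -/l -/N; apply/negP; rewrite -ltNge.
apply: le_lt_trans (lower _) _ => [s x sT ox|].
  rewrite /= in_itv /= mulr1 => /andP[x0' x2].
  have far y : omega y -> r <= `|y - x0|.
    by move=> oy; rewrite leNgt; apply/negP => /gap.
  (* The representative of x - x0 in [0, 2 pi[ must be at distance r from both ends: the gap is
     applied to x and to its neighbour by one period. If x < x0, the packet is rewritten at x - x0 +
     2 pi by periodicity. *)
  have [xx|xx] := leP x0 x.
    have := far _ ox; rewrite ger0_norm ?subr_ge0// => rx.
    have : omega (x - 2 * pi) by apply/per; rewrite subrK.
    move=> /far; rewrite ler0_norm; last by lra.
    move=> rx'; apply: circle_estimate adm dN sT _.
    by apply/andP; split; lra.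
  have := far _ ox; rewrite ltr0_norm ?subr_lt0// => rx.
  have /far := (per x).2 ox; rewrite ger0_norm; last by lra.
  move=> rx'; rewrite /circle_packet.
  under eq_bigr do rewrite -wave_period.
  apply: circle_estimate adm dN sT _.
  by apply/andP; split; lra.
rewrite ltr_pdivlMr//.
have -> : A * (N * expR (- c * N)) * C * N = A * C * (N ^+ 2 * expR (- c * N)).
  by ring.
by apply: lt_trans (HM' _ NM' N1) _; lra.
Qed.

End CircleCase.

(** * The line *)

Section LineWeight.
Set Implicit Arguments.
Unset Strict Implicit.
Context {R : realType}.
Local Notation mu := (@lebesgue_measure R).
Local Notation Re := complex.Re.
Local Notation Im := complex.Im.

(** This is (1 + x^2)^(-1/2): of the order 1/|x| to which the packets decay, and
    square-integrable. *)
Definition line_weight (x : R) : R := Num.sqrt (oneDsqr x)^-1.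

Lemma line_weight_ge0 x : 0 <= line_weight x.
Proof. exact: sqrtr_ge0. Qed.

Lemma line_weight_sqr x : line_weight x ^+ 2 = (oneDsqr x)^-1.
Proof. by rewrite sqr_sqrtr// invr_ge0 (le_trans ler01)// oneDsqr_ge1. Qed.

Lemma line_weight_bound (x B : R) : 0 <= B -> 1 + `|x| <= B -> 1 <= B * line_weight x.
Proof.
move=> B0 xB; rewrite -(@ler_pXn2r _ 2)// ?nnegrE ?mulr_ge0 ?line_weight_ge0//.
have q0 : 0 < oneDsqr x by rewrite (lt_le_trans ltr01)// oneDsqr_ge1.
rewrite expr1n exprMn line_weight_sqr ler_pdivlMr// mul1r.
apply: (@le_trans _ _ ((1 + `|x|) ^+ 2)).
  rewrite /oneDsqr -(real_normK (num_real x)); have := normr_ge0 x; nra.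
by rewrite ler_pXn2r// nnegrE addr_ge0.
Qed.

Lemma integral_oneDsqrV : (\int[mu]_x ((oneDsqr x)^-1)%:E < +oo)%E.
Proof.
rewrite ge0_symfun_integralT.
- have -> : [set x : R | 0 <= x] = [set` `[0, +oo[].
    by apply/seteqP; split => x /=; rewrite in_itv /= andbT.
  by rewrite integral0y_oneDsqr ltry.
- by move=> x; rewrite invr_ge0 (le_trans ler01)// oneDsqr_ge1.
- exact: continuous_oneDsqrV.
- by move=> x; rewrite /= /oneDsqr sqrrN.
Qed.

Lemma measurable_oneDsqrV (D : set R) :
  measurable_fun D (fun x : measurableTypeR R => (oneDsqr x)^-1 : R).
Proof.
by apply: measurable_funTS; apply: continuous_measurable_fun; exact: continuous_oneDsqrV.
Qed.

Lemma measurable_line_weight (D : set R) :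
  measurable_fun D (line_weight : measurableTypeR R -> R).
Proof.
apply: (measurableT_comp (f := @Num.sqrt R)); last exact: measurable_oneDsqrV.
by apply: continuous_measurable_fun; exact: sqrt_continuous.
Qed.

Lemma L2_line_weight (f : R -> R[i]) (C : R) : cmeasurable setT f ->
  (forall x, norm1 (f x) <= C * line_weight x) -> L2 mu setT f.
Proof.
move=> mf fC; have [m1 m2] := mf; split=> //.
apply: (@le_lt_trans _ _ (\int[mu]_x ((C ^+ 2)%:E * ((oneDsqr x)^-1)%:E))%E).
  apply: ge0_le_integral; first exact: measurableT.
  - by move=> x _; rewrite lee_fin sqrnormc_ge0.
  - by apply/measurable_EFinP; exact: measurable_sqrnormc mf.
  - apply/measurable_EFinP; apply: measurable_funM; first exact: measurable_cst.
    exact: measurable_oneDsqrV.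
  - move=> x _; rewrite -EFinM lee_fin -line_weight_sqr -exprMn.
    apply: le_trans (sqrnormc_norm1 _) _.
    by rewrite !(expr2 _) ler_pM ?norm1_ge0 ?fC.
rewrite ge0_integralZl//.
- apply: lte_mul_pinfty; [|by []|exact: integral_oneDsqrV].
  by rewrite lee_fin sqr_ge0.
- by apply/measurable_EFinP; exact: measurable_oneDsqrV.
- by rewrite lee_fin sqr_ge0.
Qed.

Lemma L2_indic (J : set R) (f : R -> R[i]) : measurable J -> L2 mu J f ->
  L2 mu setT (fun x => (\1_J x)%:C * f x).
Proof.
move=> mJ [m1 m2 fi].
have -> : (fun x => (\1_J x)%:C * f x) = (fun x => if x \in J then f x else 0).
  by apply/funext => x; rewrite indicE; case: (x \in J); rewrite ?mul1r ?mul0r.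
split.
- have -> : (fun x => Re (if x \in J then f x else 0)) = (fun x => Re (f x)) \_ J.
    by apply/funext => x; rewrite patchE; case: ifP.
  exact/(measurable_restrictT _ _).1.
- have -> : (fun x => Im (if x \in J then f x else 0)) = (fun x => Im (f x)) \_ J.
    by apply/funext => x; rewrite patchE; case: ifP.
  exact/(measurable_restrictT _ _).1.
- have -> : (fun x => (sqrnormc (if x \in J then f x else 0))%:E) =
      (fun x => (sqrnormc (f x))%:E) \_ J.
    apply/funext => x; rewrite patchE; case: ifP => // _.
    by rewrite /sqrnormc /= expr0n addr0.
  by rewrite -integral_mkcond.
Qed.

Lemma window_L2 (x0 alpha : R) : L2 mu setT (window_function x0 alpha).
Proof.
rewrite (_ : window_function x0 alpha = fun x => window_function x0 alpha x * 1).
  apply: L2_indic (measurable_itv _) _.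
  apply: (L2_bounded (M := 1)); [exact: measurable_itv| | |].
  - by rewrite lebesgue_measure_itv /=; case: ifPn => _; rewrite -?EFinB ltry.
  - by split; exact: measurable_cst.
  - by move=> x _; rewrite norm1_real normr1.
by apply/funext => x; rewrite mulr1.
Qed.

End LineWeight.

(** * Packets on the line *)

Section LinePacket.
Set Implicit Arguments.
Unset Strict Implicit.
Context {R : realType}.
Local Notation mu := (@lebesgue_measure R).
Local Notation Re := complex.Re.
Local Notation Im := complex.Im.

Section Packet.
Variables (rho : R[i] -> R[i]) (r delta eta N T x0 : R).
Hypothesis adm : admissible rho r delta eta N T.
Let a := N / 2.
Let b := 3 * N / 2.
Let J : set R := [set` `[a, b]].
Let mJ : measurable J. Proof. exact: measurable_itv. Qed.
Let muJ : (mu J < +oo)%E.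
Proof. by rewrite lebesgue_measure_itv /=; case: ifPn => _; rewrite -?EFinB ltry. Qed.
Let N0 : 0 < N. Proof. by case: adm. Qed.
Let a0 : 0 < a. Proof. by rewrite divr_gt0. Qed.
Let ab : a <= b.
Proof. by rewrite /a /b ler_pM2r ?invr_gt0// ler_peMl ?ler1n// ltW. Qed.

Lemma pathcont_wave (s y : R) : pathcont (fun xi => wave rho s N y xi%:C) a b.
Proof.
move=> t tab eps eps0; have [_ /andP[d0' _] _ _ _] := adm.
have hl : holo (wave rho s N y) (t%:C).
  by apply: (@admissible_holo _ _ _ _ _ _ _ s y adm t 0 tab); rewrite normr0 mulr_ge0 ?ltW.
have [d d0 dP] := holo_contat hl eps0; exists d => // s' st.
rewrite (_ : s'%:C = t%:C + (s' - t)%:C); last by rewrite -rmorphD addrC subrK.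
by apply: dP; rewrite norm1_real.
Qed.

Definition line_packet (s x : R) : R[i] :=
  eta_hat a b (fun xi => wave rho s N (- x0) xi%:C) x.

Lemma line_packetE (s x : R) :
  line_packet s x = cintegral J (fun xi => wave rho s N (x - x0) xi%:C).
Proof. by apply: eq_cintegral => xi _; rewrite wave_shift. Qed.

(** The packet is the truncated Fourier transform of the wave cut off to the window, provided that
    the truncation contains the window. *)
Lemma line_packet_measurable (s : R) : cmeasurable setT (line_packet s).
Proof.
pose e xi := (\1_J xi)%:C * wave rho s N (- x0) xi%:C.
have [M M0 eM] := pathcont_bounded ab (pathcont_wave s (- x0)).
have eL : L2 mu setT e.
  apply: L2_indic mJ _; apply: (L2_bounded (M := M)) => //.
  exact: cintegrable_cmeasurable (pathcont_cintegrable (pathcont_wave _ _)).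
pose n := Num.bound b.
have bn : b < n%:R by apply: archi_boundP; exact: le_trans (ltW a0) ab.
have JI : J `<=` [set` `[- n%:R, n%:R]].
  move=> xi; rewrite /J /= !in_itv /= => /andP[h1 h2].
  have n0 : - n%:R <= 0 :> R by rewrite oppr_le0.
  by rewrite (le_trans n0 (le_trans (ltW a0) h1)) (le_trans h2 (ltW bn)).
have -> : line_packet s = truncated_fourier e n.
  apply/funext => x; rewrite /truncated_fourier.
  transitivity (cintegral `[- n%:R, n%:R] (fun xi => (\1_J xi)%:C *
      (wave rho s N (- x0) xi%:C * cexp (0 -i* (xi * x))))).
    by rewrite cintegral_indic//; apply: eq_cintegral => xi _; rewrite (mulrC xi).
  by apply: eq_cintegral => xi _; rewrite mulrA.
exact: truncated_fourier_measurable.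
Qed.

Let norm_shift (x : R) : `|x| <= `|x - x0| + `|x0|.
Proof. by rewrite -{1}(subrK x0 x) ler_normD. Qed.

Let norm_near (x : R) : `|x - x0| < r -> 1 + `|x| <= 2 + `|x0|.
Proof.
case: adm => /andP[_ r1] _ _ _ _; have := norm_shift x; lra.
Qed.

Lemma line_packet_far (s x : R) : 0 <= s <= T -> r <= `|x - x0| ->
  norm1 (line_packet s x) <=
  (4 / delta + 4) * (1 + (1 + `|x0|) / r) * expR (- (delta * r / 8) * N) *
  line_weight x.
Proof.
move=> sT xr; have [/andP[r0 _] /andP[d0 _] _ _ _] := adm.
rewrite line_packetE; apply: le_trans (line_estimate adm sT xr) _.
set e := expR _; set A := 4 / delta + 4; set y := `|x - x0| in xr *.
have y0 : 0 < y by apply: lt_le_trans xr.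
have Ae0 : 0 <= A * e.
  by rewrite mulr_ge0 ?expR_ge0// addr_ge0// divr_ge0// ltW.
(* With y >= r, 1 + |x| <= y + (1 + |x0|) <= y (1 + (1 + |x0|) / r), which trades 1/y for the weight
   at x. *)
have -> : A * (1 + (1 + `|x0|) / r) * e * line_weight x =
    A * e * ((1 + (1 + `|x0|) / r) * line_weight x) by ring.
apply: ler_wpM2l => //; rewrite -(ler_pM2l y0) mulfV ?gt_eqF// mulrA.
have xx0 : `|x| <= y + `|x0| := norm_shift x.
apply: line_weight_bound.
  by apply: mulr_ge0 (ltW y0) _; rewrite addr_ge0// divr_ge0// ?addr_ge0// ltW.
have : 1 + `|x0| <= y * ((1 + `|x0|) / r).
  by rewrite mulrA ler_pdivlMr// mulrC ler_wpM2r// addr_ge0.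
rewrite mulrDr mulr1; lra.
Qed.

(** Far from x0 the contour shift gives the decay; within r <= 1 of x0 a crude bound suffices, as
    the weight is bounded below there. *)
Let line_packet_bound (s : R) : 0 <= s <= T ->
  exists C, forall x : R, norm1 (line_packet s x) <= C * line_weight x.
Proof.
move=> sT; have [/andP[r0 r1] /andP[d0 _] _ _ _] := adm.
have [M M0 eM] := pathcont_bounded ab (pathcont_wave s (- x0)).
set E : R := (4 / delta + 4) * (1 + (1 + `|x0|) / r) * expR (- (delta * r / 8) * N).
have E0 : 0 <= E.
  have h1 : 0 <= 4 / delta + 4 by rewrite addr_ge0// divr_ge0// ltW.
  have h2 : 0 <= 1 + (1 + `|x0|) / r by rewrite addr_ge0// divr_ge0 ?addr_ge0// ltW.
  by rewrite mulr_ge0 ?expR_ge0// mulr_ge0.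
pose G := 2 * M * (b - a) * (2 + `|x0|).
have M1 : 0 <= 2 * M * (b - a) by rewrite !mulr_ge0 ?subr_ge0// ltW.
have G0 : 0 <= G by rewrite mulr_ge0// addr_ge0.
exists (E + G) => x.
have w0 := line_weight_ge0 x.
have [xr|xr] := leP r `|x - x0|.
  apply: le_trans (line_packet_far sT xr) _; rewrite -/E.
  by rewrite ler_wpM2r// lerDl.
apply: (@le_trans _ _ (G * line_weight x)); last by rewrite ler_wpM2r// lerDr.
apply: (@le_trans _ _ (2 * M * (b - a))).
  have pc : pathcont (fun xi => wave rho s N (x - x0) xi%:C) a b := pathcont_wave _ _.
  rewrite line_packetE; apply: norm1_cintegral_itv ab (pathcont_cintegrable pc) _.
  move=> xi axi; rewrite wave_shift mulrC; apply: le_trans (norm1M _ _) _.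
  apply: ler_pM; [exact: norm1_ge0|exact: norm1_ge0|exact: norm1_cexp_im|].
  exact: eM.
rewrite /G -[leRHS]mulrA ler_peMr//; apply: line_weight_bound; first by rewrite addr_ge0.
exact: norm_near xr.
Qed.

Lemma line_packet_L2 (s : R) : 0 <= s <= T -> L2 mu setT (line_packet s).
Proof.
move=> /line_packet_bound [C HC].
exact: L2_line_weight (line_packet_measurable s) HC.
Qed.

(** The packet is the Fourier transform of a wave carried by positive frequencies, so both pairings
    move to the frequency side, where |xi| = xi and the semigroup factor cancels against
    [wave_time]. *)
Lemma line_adjoint (s : R) (f g : R -> R[i]) : 0 <= s <= T ->
  semigroup Line rho (T - s) f g ->
  cintegrable setT (fun x => f x * line_packet s x) /\
  cintegral setT (fun x => g x * line_packet T x) =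
  cintegral setT (fun x => f x * line_packet s x).
Proof.
move=> sT [fh [gh [ff fg fgh]]].
have TT : 0 <= T <= T by have /andP[h1 h2] := sT; rewrite lexx (le_trans h1).
have [fL _ _] := ff; have [gL _ _] := fg.
split; first exact: L2_mul_cintegrable measurableT fL (line_packet_L2 sT).
have [i1 <-] := fourier_test ab (pathcont_wave s (- x0)) fL ff (line_packet_L2 sT).
have [i2 <-] := fourier_test ab (pathcont_wave T (- x0)) gL fg (line_packet_L2 TT).
apply: ae_eq_cintegral mJ (cintegrable_cmeasurable i2) (cintegrable_cmeasurable i1) _.
apply: filterS fgh => xi -> ; rewrite /J /= in_itv /= => /andP[axi _].
have xi0 : 0 <= xi := le_trans (ltW a0) axi.
rewrite ger0_norm//; have -> : T = s + (T - s) by rewrite addrC subrK.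
rewrite wave_time; have -> : s + (T - s) - s = T - s by ring.
set q := rho _; set t := (T - s)%:C; set A := wave _ _ _ _ _.
have E : cexp (t * q) * cexp (- t * q) = 1 by rewrite -cexpD mulNr subrr cexp0.
transitivity (cexp (t * q) * cexp (- t * q) * (fh xi * A)); first by ring.
by rewrite E mul1r.
Qed.

(** The integrand on the frequency side has one sign, so it may be restricted to [N - 1/2, N + 1/2].
    There cos(pi xi) <= 0 because N is odd, and the Gaussian is at least 3/4. *)
Lemma line_packet_lower (l : nat) : N = l.*2.+1%:R ->
  1 / (2 * N) <= norm1 (cintegral setT (fun x =>
    window_function x0 pi x * line_packet 0 x)).
Proof.
move=> El; have pi0 := pi_gt0 R.
have N1 : 1 <= N by rewrite El ler1n.
pose W : set R := [set` `[x0, x0 + pi]].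
have f0L := window_L2 x0 pi.
pose n := Num.bound (`|x0| + pi).
have WI : W `<=` [set` `[- n%:R, n%:R]].
  have nB : `|x0| + pi < n%:R by apply: archi_boundP; rewrite addr_ge0// ltW.
  move=> x; rewrite /W /= !in_itv /= => /andP[h1 h2].
  have := ler_norm x0; have := ler_norm (- x0); rewrite normrN => h3 h4.
  by apply/andP; split; lra.
have [i1 E1] := truncated_fubini ab f0L n (pathcont_wave 0 (- x0)).
have -> : cintegral setT (fun x => window_function x0 pi x * line_packet 0 x) =
    cintegral J (fun xi => truncated_fourier (window_function x0 pi) n xi *
      wave rho 0 N (- x0) xi%:C).
  by rewrite E1 cintegral_indic// cintegral_indic.
rewrite -norm1N -(cintegralN mJ i1); have iF := cintegrableN mJ i1.
pose h (xi : R) : R := Im (- (truncated_fourier (window_function x0 pi) n xi *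
      wave rho 0 N (- x0) xi%:C)).
have hE xi : a <= xi -> h xi =
    expR (- ((xi - N) ^+ 2 / N)) * ((1 - cos (pi * xi)) / xi).
  move=> axi; rewrite /h ImN mulrC /truncated_fourier cintegral_indic//.
  rewrite (_ : [set` `[x0, x0 + pi]] = W)// wave0_window ?opprK// ?ltW//.
  by rewrite gt_eqF// (lt_le_trans a0).
apply: le_trans (ler_Im_norm1 _); apply: le_trans (ler_norm _).
rewrite -[leRHS]/(\int[mu]_(xi in J) h xi) -lee_fin (EFin_Rintegral iF.2 mJ).
have mh := measurable_int _ iF.2.
have h0 xi : J xi -> 0 <= h xi.
  rewrite /J /= in_itv /= => /andP[axi _]; rewrite hE//.
  rewrite mulr_ge0 ?expR_ge0// divr_ge0 ?subr_ge0 ?cos_le1//.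
  exact: le_trans (ltW a0) axi.
pose J1 : set R := [set` `[N - 1 / 2, N + 1 / 2]].
have J1J : J1 `<=` J.
  move=> xi; rewrite /J1 /J /= !in_itv /= /a /b => /andP[h1 h2].
  by apply/andP; split; lra.
have mJ1 : measurable J1 by exact: measurable_itv.
apply: (@le_trans _ _ (\int[mu]_(xi in J1) (h xi)%:E)%E); last first.
  by apply: ge0_subset_integral => // xi Jxi; rewrite lee_fin h0.
apply: (@le_trans _ _ (\int[mu]_(xi in J1) (1 / (2 * N))%:E)%E).
  have muJ1 : mu J1 = 1%:E.
    rewrite /J1 lebesgue_measure_itv /= lte_fin ifT; last by lra.
    by rewrite -EFinB; congr _%:E; field.
  apply: (@le_trans _ _ ((1 / (2 * N))%:E * mu J1)%E).
    by rewrite muJ1 mule1.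
  by rewrite integral_cst; [exact: lexx|exact: mJ1].
apply: ge0_le_integral => //.
- by move=> xi _; rewrite lee_fin divr_ge0// mulr_ge0// ltW.
- exact: measurable_funS mJ J1J mh.
move=> xi Jxi; rewrite lee_fin.
have axi : a <= xi.
  have : J xi by exact: J1J.
  by rewrite /J /= in_itv /= => /andP[].
rewrite hE//; move: Jxi; rewrite /J1 /= in_itv /= => /andP[h1 h2].
have xi0 : 0 < xi := lt_le_trans a0 axi.
have cle : cos (pi * xi) <= 0.
  have -> : pi * xi = l.*2.+1%:R * pi + pi * (xi - N) by rewrite El; ring.
  have [c1 s1] := @cos_sin_odd_pi R l.
  rewrite cosD c1 s1 mul0r subr0 mulN1r oppr_le0; apply: cos_ge0_pihalf.
  by apply/andP; split; nra.
(* As xi <= N + 1/2 and N >= 1, xi is at most 3N/2, which gives exactly 1/(2N). *)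
apply: (@le_trans _ _ (3 / 4 * xi^-1)).
  by rewrite ler_pdivlMr// mulrAC mul1r ler_pdivrMr ?mulr_gt0//; lra.
apply: ler_pM; [lra|by rewrite invr_ge0 ltW| |].
  apply: le_trans (expR_ge1Dx _).
  have : (xi - N) ^+ 2 / N <= 1 / 4 by rewrite ler_pdivrMr//; nra.
  lra.
by rewrite ler_peMl ?invr_ge0 ?(ltW xi0)//; lra.
Qed.

End Packet.
End LinePacket.

(** * The contradiction on the line *)

Section LineCase.
Set Implicit Arguments.
Unset Strict Implicit.
Context {R : realType}.
Local Notation mu := (@lebesgue_measure R).

Variables (K r T x0 : R) (rho : R[i] -> R[i]) (omega : set R).
Hypotheses (K0 : 0 < K) (hol : holomorphic_on (cone K) rho)
  (rho_o : little_o_norm_on (cone K) rho) (r01 : 0 < r <= 1) (T0 : 0 < T)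
  (omega_open : open omega) (gap : forall x, `|x - x0| < r -> ~ omega x).

Lemma not_null_controllable_line : ~ null_controllable Line rho omega T.
Proof.
move=> nc; have /andP[r0 r1] := r01.
have mO : measurable omega by exact: open_measurable.
have mO' : measurable (omega `&` domain Line) by rewrite /= setIT.
have f0L : L2 mu (domain Line) (window_function x0 pi) := window_L2 _ _.
have wi : (\int[mu]_(x in omega `&` domain Line) (line_weight x ^+ 2)%:E < +oo)%E.
  under eq_integral do rewrite line_weight_sqr.
  apply: le_lt_trans (@integral_oneDsqrV R).
  apply: ge0_subset_integral; [exact: mO'|exact: measurableT| | |by []].
    by apply/measurable_EFinP; exact: measurable_oneDsqrV.
  by move=> x _; rewrite lee_fin invr_ge0 (le_trans ler01)// oneDsqr_ge1.
have [C HC] := duality (ltW T0) mO nc f0L (@measurable_line_weight R _) wi.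
have [delta [eta [M [d0 dM HM]]]] := cone_admissible K0 hol rho_o r01 T0.
pose c := delta * r / 8; have c0 : 0 < c by rewrite divr_gt0 ?mulr_gt0.
pose A := (4 / delta + 4) * (1 + (1 + `|x0|) / r).
have [M' HM'] := expR_dominates (A * C * 2) c0.
have [j [/= NM NM' N1]] := packet_frequency 0 M M'.
set l := (2 * 0 * j + 0 + j)%N in NM NM' N1; set N : R := l.*2.+1%:R in NM NM' N1.
have [_ adm] := HM _ NM.
have A0 : 0 <= A.
  have d4 : 0 <= 4 / delta by rewrite divr_ge0// ltW.
  have x4 : 0 <= (1 + `|x0|) / r by rewrite divr_ge0 ?addr_ge0// ltW.
  by rewrite mulr_ge0// addr_ge0.
have N0 : 0 < N by rewrite (lt_le_trans ltr01).
(* The factor N >= 1 only enlarges the bound; multiplied by the 2N of the lower bound it gives the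
   N^2 of [expR_dominates]. *)
have eps0 : 0 <= A * (N * expR (- c * N)).
  by rewrite mulr_ge0// mulr_ge0 ?expR_ge0 ?ltW.
have TT : 0 <= T <= T by rewrite lexx ltW.
have := HC (line_packet rho N x0) _ eps0 (line_packet_L2 x0 adm TT).
move=> /(_ (fun s f g => @line_adjoint _ _ _ _ _ _ _ x0 adm s f g)) upper.
move: (line_packet_lower x0 adm (erefl _)); apply/negP; rewrite -ltNge.
apply: le_lt_trans (upper _) _ => [s x sT ox _|].
  have xr : r <= `|x - x0| by rewrite leNgt; apply/negP => /gap.
  apply: le_trans (line_packet_far adm sT xr) _.
  apply: ler_wpM2r; first exact: line_weight_ge0.
  by rewrite -/A -/c; apply: ler_wpM2l => //; rewrite ler_peMl ?expR_ge0.
rewrite ltr_pdivlMr ?mulr_gt0//.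
have -> : A * (N * expR (- c * N)) * C * (2 * N) =
    A * C * 2 * (N ^+ 2 * expR (- c * N)) by ring.
by apply: lt_trans (HM' _ NM' N1) _; lra.
Qed.

End LineCase.

(** * Translation by multiples of the period *)

Section Periodicity.

Lemma periodic_int (R : realType) (omega : set R) (p : R) :
  (forall x, omega (x + p) <-> omega x) ->
  forall (k : int) (x : R), omega (x + p * k%:~R) <-> omega x.
Proof.
move=> per; have pern (n : nat) (x : R) : omega (x + p * n%:R) <-> omega x.
  elim: n x => [|n IH] x; first by rewrite mulr0 addr0.
  by rewrite -[n.+1%:R]natr1 mulrDr mulr1 addrA per IH.
move=> k x; case: (intP k) => [|n|n]; first by rewrite mulr0 addr0.
  exact: pern.
rewrite -(pern n.+1) mulrN subrK; split; by [].
Qed.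

End Periodicity.

Theorem theorem1p4 (R : realType) (K : R) (hK : 0 < K)
  (rho : R[i] -> R[i])
  (rho_holo : holomorphic_on (cone K) rho)
  (rho_o : little_o_norm_on (cone K) rho)
  (rho_mRe : lebesgue_measurable_fun `[0, +oo[
     (fun x : R => complex.Re (rho x%:C)))
  (rho_mIm : lebesgue_measurable_fun `[0, +oo[
     (fun x : R => complex.Im (rho x%:C)))
  (rho_inf : exists m : R, forall x : R, 0 <= x -> m <= complex.Re (rho x%:C))
  (Omega : ambient) (omega : set R)
  (omega_sub : subset_of Omega omega)
  (omega_open : open omega)
  (omega_co : (~` omega)° !=set0)
  (T : R) (hT : 0 < T) :
  ~ null_controllable Omega rho omega T.
Proof.
move=> nc; have [x1 /nbhs_normP [d /= d0 dP]] := omega_co.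
(* A radius at most 1, as [admissible] requires. *)
pose r := Num.min d 1.
have r01 : 0 < r <= 1 by rewrite lt_min d0 ltr01 ge_min lexx orbT.
have gap x : `|x - x1| < r -> ~ omega x.
  by rewrite lt_min distrC => /andP[/dP].
case: Omega omega_sub nc => [_|per].
  exact: (not_null_controllable_line hK rho_holo rho_o r01 hT omega_open gap).
have pi2 : 0 < 2 * pi :> R by rewrite mulr_gt0 ?pi_gt0.
have perz := @periodic_int R omega (2 * pi) per.
(* Translating x1 by k periods brings the base point into the fundamental domain, where the window
   has to start. *)
pose k := Num.floor (x1 / (2 * pi)).
apply: (not_null_controllable_circle (x0 := x1 - 2 * pi * k%:~R) hK rho_holo
  rho_o r01 hT omega_open) => //.
- move=> x; rewrite opprB addrA => xr ox.
  exact: gap xr ((perz k x).2 ox).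
- have := floor_itv (x1 / (2 * pi) : R).
  rewrite -/k ler_pdivlMr// ltr_pdivrMr// intrD mulrDl mul1r => /andP[h1 h2].
  by apply/andP; split; lra.
Qed.
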